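(* Let $\varphi$ be an entire function, $0<s<1$ and $0<p<\infty$. Then: (a) $S_\varphi(Q_s)\subset \mathcal{D}^p_{p-1}$ if and only if $\varphi$ is of order less than one, or of order one and type zero. (b) $S_\varphi(\mathcal{D}^p_{p-1})\subset Q_s$ if and only if $\varphi$ is constant.
   Context: $\mathbb{D}=\{z\in\mathbb{C}:|z|<1\}$, $\mathcal{H}ol(\mathbb{D})$ is the space of analytic functions in $\mathbb{D}$, and $dA(z)=\frac1\pi\,dx\,dy$. Superposition operator: for an entire function $\varphi$, $S_\varphi(f)=\varphi\circ f$ for $f\in\mathcal{H}ol(\mathbb{D})$. For $X,Y\subset\mathcal{H}ol(\mathbb{D})$, $S_\varphi(X)\subset Y$ means $\varphi\circ f\in Y$ for every $f\in X$. Spaces: for $0<p<\infty$ and $\alpha>-1$, $\mathcal{D}^p_\alpha$ is the set of $f\in\mathcal{H}ol(\mathbb{D})$ with $\int_{\mathbb{D}}(1-|z|^2)^\alpha|f'(z)|^p\,dA(z)<\infty$; $\mathcal{D}^p_{p-1}$ is the case $\alpha=p-1$. For $0\le s<\infty$, $Q_s$ is the set of $f\in\mathcal{H}ol(\mathbb{D})$ with $\sup_{a\in\mathbb{D}}\int_{\mathbb{D}}|f'(z)|^2g(z,a)^s\,dA(z)<\infty$, where $g(z,a)=\log\left|\frac{1-\overline{a}z}{z-a}\right|$. Order and type: with $M(r,\varphi)=\max_{|z|=r}|\varphi(z)|$, the order of a non-constant entire function $\varphi$ is $\rho=\limsup_{r\to\infty}\frac{\log\log M(r,\varphi)}{\log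 r}$, and if $0<\rho<\infty$ its type is $\tau=\limsup_{r\to\infty}\frac{\log M(r,\varphi)}{r^\rho}$. Constant functions are regarded as having order $0$. *)

(* Defs.v *)
(* MathComp-Analysis, over an arbitrary [R : realType]; complex numbers are
   [R[i]] from real-closed, with the topology of its norm. *)
From HB Require Import structures.
From mathcomp Require Import all_boot all_order all_algebra.
From mathcomp Require Import complex.
From mathcomp Require Import all_classical all_reals all_analysis.

Set Implicit Arguments.
Unset Strict Implicit.
Unset Printing Implicit Defensive.

Import Order.TTheory GRing.Theory Num.Theory.
Import numFieldNormedType.Exports.

Local Open Scope classical_set_scope.
Local Open Scope ring_scope.

(* Seeing [R[i]] as a [numFieldType] is what selects its norm topology and,
   in [derivable] and [derive1], complex scalars. *)
Definition Cplx (R : realType) : numFieldType := R[i].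

Section HolomorphicSpaces.
Variable R : realType.
Local Notation C := (Cplx R).

(* The library norm [`|z|] is [C]-valued; this is the same number in [R]. *)
Definition cabs (z : C) : R := Normc.normc z.

Definition mkC (w : R * R) : C := Complex w.1 w.2.

Definition disc : set C := [set z | cabs z < 1].

Definition disc2 : set (R * R) := mkC @^-1` disc.

Definition dA :
    {measure set (measurableTypeR R * measurableTypeR R) -> \bar R} :=
  mscale (NngNum (divr_ge0 ler01 (pi_ge0 R)))
    (lebesgue_measure \x lebesgue_measure)%E.

Definition int_disc (u : C -> R) : \bar R :=
  (\int[dA]_(w in disc2) (u (mkC w))%:E)%E.

(* Functions on the disc are represented by total functions; here and below,
   only their values on the disc matter. *)
Definition Hol_disc : set (C -> C) :=
  [set f | forall z, disc z -> derivable f z 1].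

Definition entire (phi : C -> C) : Prop := forall z, derivable phi z 1.

Definition superposition (phi f : C -> C) : C -> C := phi \o f.

Definition Dirichlet (p alpha : R) : set (C -> C) :=
  [set f | Hol_disc f /\
    (int_disc (fun z =>
       ((1 - cabs z ^+ 2) `^ alpha * cabs (derive1 f z) `^ p)%R) < +oo)%E].

(* At the single point [z = a], where the Green function is [+oo], this takes
   the value [ln 0 = 0]; that point is negligible for [dA]. *)
Definition green (z a : C) : R := ln (cabs ((1 - conjc a * z) / (z - a))).

Definition Qspace (s : R) : set (C -> C) :=
  [set f | Hol_disc f /\
    (ereal_sup
       [set int_disc (fun z => (cabs (derive1 f z) ^+ 2 * green z a `^ s)%R)
       | a in disc] < +oo)%E].

(* For continuous [phi] this supremum is a maximum (compactness). *)
Definition maxmod (phi : C -> C) (r : R) : R :=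
  sup [set cabs (phi z) | z in [set z | cabs z = r]].

Definition is_constant (phi : C -> C) : Prop := exists c, forall z, phi z = c.

Definition growth_order (phi : C -> C) : \bar R :=
  if `[< is_constant phi >] then 0%E
  else limf_esup (fun r => (ln (ln (maxmod phi r)) / ln r)%:E) (pinfty_nbhs R).

(* Meaningful when [0 < growth_order phi < +oo]. *)
Definition growth_type (phi : C -> C) : \bar R :=
  limf_esup (fun r => (ln (maxmod phi r) / r `^ fine (growth_order phi))%:E)
    (pinfty_nbhs R).

End HolomorphicSpaces.

(* Main.v *)
Require Import Defs.
From mathcomp Require Import all_boot all_order all_algebra.
From mathcomp Require Import complex.
From mathcomp Require Import all_classical all_reals all_analysis.
From mathcomp Require Import measurable_realfun.
From mathcomp Require Import ring lra.
Import Order.TTheory GRing.Theory Num.Theory.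
Import numFieldNormedType.Exports.
Local Open Scope classical_set_scope.
Local Open Scope ring_scope.
Set Implicit Arguments.
Unset Strict Implicit.
Unset Printing Implicit Defensive.

(* A function f of Q_s satisfies (1 - |z|) |f'(z)| <= B, so |f| grows at most
   like B log (1 / (1 - |z|)), and the integral of |f'|^2 (1 - |z|)^s is finite.
   If phi has order less than one, or order one and type zero, then
   |phi'(w)| = O(exp (e |w|)) for every e > 0, hence phi' o f is
   O((1 - |z|)^(-eta)) for every eta > 0, and Young's inequality against the
   two previous facts puts phi o f in D^p_{p-1}.

   For the necessity, any sum f = sum_j c_j / (1 + 2^j (1 - z)) with bounded
   c_j satisfies |f'(z)| = O(1 / |1 - z|), which suffices for f to be in Q_s.
   On the points 1 - 2^-n the j-th summand is between c_j / 2 and c_j for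
   j <= n and decays geometrically for j > n.  Choosing the c_j in successive
   blocks, f can be made to come as close as desired to prescribed values w_k
   at points 1 - 2^-(n_k), as soon as |w_k| <= A n_k and the n_k grow fast
   enough.  So a bound |phi (f (1 - 2^-n))| <= K_f V_n valid for all f in Q_s
   forces |phi(w)| <= K V_n whenever |w| <= A n.  In (a), functions of
   D^p_{p-1} are O((1 - |z|)^(-q)), V_n = 2^(q n), and A is arbitrary.  In (b),
   f^2 is in D^p_{p-1} for f in Q_s by (a), so phi (f^2) is in Q_s and
   V_n = n + 1; therefore |phi (w^2)| = O(|w| + 1) and phi is constant.

   Holomorphy on the disc is only complex differentiability, so Cauchy's
   estimates and the mean value inequalities are derived from Goursat's
   theorem, for squares and for the real part of contour integrals, where they
   reduce to integrals over intervals. *)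

(** Goursat's theorem yields vanishing contour integrals but not the holomorphy of [f'], so no mean
    value inequality can be applied to [f'] directly. It is obtained from the difference quotients
    [(f (w + h) - f w) / h], which are holomorphic and, once [f'] is known to be Lipschitz,
    uniformly close to [f']. Sharp constants are never sought. Cauchy's formula survives as an
    inequality, and linear bounds [x <= al + be * psi x] under the integral take the place of
    Hölder's inequality and of the subharmonicity of [|f'|^p]. This costs exponents, but (a) only
    uses that one power of [1 / (1 - |z|)] serves all functions of the Dirichlet space. In (b), the
    test functions reach [|w| = O(n)] at the n-th grid point while [Q_s] allows growth [O(n)] there:
    applied to [phi] itself the argument would still admit affine functions. Squaring [f] first
    turns the bound into [|phi(w)| = O(|w|^(1/2) + 1)]. Conventions on [ln] matter twice: the Green
    function is [0] at its pole, and [ln (ln M)] is [0] when [M <= 1]. *)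

Lemma le_of_eq d (T : porderType d) (x y : T) : x = y -> (x <= y)%O.
Proof. by move=> ->. Qed.

(** * Complex derivatives *)

Section Modulus.
Variable R : realType.
Local Notation C := (Cplx R).
Implicit Types (z w : C) (x y : R).

Definition cof x : C := Complex x 0.

Lemma cabs_norm z : `|z| = cof (cabs z).
Proof. by case: z => a b. Qed.

Lemma cabs_ge0 z : 0 <= cabs z.
Proof. by case: z => a b; exact: sqrtr_ge0. Qed.

Lemma cabs0 : cabs (0 : C) = 0.
Proof. exact: Normc.normc0. Qed.

Lemma cabs1 : cabs (1 : C) = 1.
Proof. exact: Normc.normc1. Qed.

Lemma cabs_eq0 z : cabs z = 0 -> z = 0.
Proof. exact: Normc.eq0_normc. Qed.

Lemma cabs_gt0 z : z != 0 -> 0 < cabs z.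
Proof.
move=> z0; rewrite lt_neqAle cabs_ge0 andbT eq_sym.
by apply: contra z0 => /eqP/cabs_eq0 ->.
Qed.

Lemma cabsM z w : cabs (z * w) = cabs z * cabs w.
Proof. exact: Normc.normcM. Qed.

Lemma cabsV z : cabs z^-1 = (cabs z)^-1.
Proof. exact: Normc.normcV. Qed.

Lemma cabsD z w : cabs (z + w) <= cabs z + cabs w.
Proof.
have := ler_normD z w; rewrite !cabs_norm {1}/cof.
by rewrite /GRing.add /= lecE /= => /andP[].
Qed.

Lemma cabsN z : cabs (- z) = cabs z.
Proof. by have := normrN z; rewrite !cabs_norm => -[]. Qed.

Lemma cabsBC z w : cabs (z - w) = cabs (w - z).
Proof. by rewrite -cabsN opprB. Qed.

Lemma cabsB z w : cabs (z - w) <= cabs z + cabs w.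
Proof. by rewrite -(cabsN w); exact: cabsD. Qed.

Lemma cabs_sub z w : cabs z - cabs w <= cabs (z - w).
Proof. by rewrite lerBlDr; apply: le_trans (cabsD _ _); rewrite subrK. Qed.

Lemma cabsX z n : cabs (z ^+ n) = cabs z ^+ n.
Proof. by elim: n => [|n ih]; rewrite ?expr0 ?cabs1// !exprS cabsM ih. Qed.

Lemma cabs_sqr z : cabs z ^+ 2 = complex.Re z ^+ 2 + complex.Im z ^+ 2.
Proof. by case: z => a b; rewrite sqr_sqrtr// addr_ge0// sqr_ge0. Qed.

Lemma ler_Re_cabs z : `|complex.Re z| <= cabs z.
Proof.
case: z => a b; rewrite -(sqrtr_sqr a) ler_wsqrtr//.
by rewrite lerDl sqr_ge0.
Qed.

Lemma ler_Im_cabs z : `|complex.Im z| <= cabs z.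
Proof.
case: z => a b; rewrite -(sqrtr_sqr b) ler_wsqrtr//.
by rewrite lerDr sqr_ge0.
Qed.

Lemma cabs_cof x : cabs (cof x) = `|x|.
Proof. by rewrite /cabs /= expr0n addr0 sqrtr_sqr. Qed.

Lemma cabs_mkC_le x y : cabs (mkC (x, y)) <= `|x| + `|y|.
Proof.
rewrite (_ : mkC (x, y) = cof x + Complex 0 1 * cof y).
  by apply: le_trans (cabsD _ _) _; rewrite cabsM !cabs_cof /cabs /= expr0n
    add0r expr1n sqrtr1 mul1r.
by rewrite /cof /mkC; apply/eqP; rewrite eq_complex /=; apply/andP; split; apply/eqP; ring.
Qed.

Lemma cofD x y : cof (x + y) = cof x + cof y.
Proof. by apply/eqP; rewrite eq_complex /= addr0 !eqxx. Qed.

Lemma cofN x : cof (- x) = - cof x.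
Proof. by apply/eqP; rewrite eq_complex /= oppr0 !eqxx. Qed.

Lemma cofB x y : cof (x - y) = cof x - cof y.
Proof. by rewrite cofD cofN. Qed.

Lemma cofM x y : cof (x * y) = cof x * cof y.
Proof. by apply/eqP; rewrite eq_complex /= !mul0r !mulr0 subr0 addr0 !eqxx. Qed.

Lemma cof0 : cof 0 = 0. Proof. by []. Qed.
Lemma cof1 : cof 1 = 1. Proof. by []. Qed.

Lemma cofV x : cof x^-1 = (cof x)^-1.
Proof.
have [->|x0] := eqVneq x 0; first by rewrite invr0 cof0 invr0.
have c0 : cof x != 0 by apply: contra x0 => /eqP [->].
by apply: (mulfI c0); rewrite -cofM !mulfV// .
Qed.

Lemma lt_cof x y : (cof x < cof y) = (x < y).
Proof. by rewrite /cof ltcE /= eqxx. Qed.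

(** In the order of [R[i]], being positive forces a zero imaginary part; this turns the radii and
    tolerances of the [C]-valued norm into real ones. *)
Lemma gt0_cof (e : C) : 0 < e -> exists2 x, 0 < x & e = cof x.
Proof.
case: e => a b; rewrite ltcE /= => /andP[/eqP -> a0]; by exists a.
Qed.

(** Complex differentiability with real tolerances and without division, so that [h = 0] needs no
    separate treatment. *)
Definition cderiv (f : C -> C) z (d : C) : Prop := forall e : R, 0 < e ->
  exists2 r : R, 0 < r & forall h : C, cabs h < r ->
    cabs (f (z + h) - f z - d * h) <= e * cabs h.

Lemma cderiv_cvg f z d : cderiv f z d ->
  (fun h : C => h^-1 *: (f (h + z) - f z)) @ 0^' --> d.
Proof.
move=> fd; apply/cvgrPdist_lt => e /gt0_cof[x x0 ->].
have [r r0 H] := fd _ (divr_gt0 x0 (ltr0n _ 2)).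
exists (cof r); first by rewrite /= -cof0 lt_cof.
move=> h /=; rewrite sub0r normrN cabs_norm lt_cof => hr h0.
rewrite cabs_norm lt_cof.
have ch := cabs_gt0 h0.
have -> : d - h^-1 *: (f (h + z) - f z) = - (h^-1 * (f (z + h) - f z - d * h)).
  rewrite [h + z]addrC mulrBr [d * h]mulrC mulrA mulVf// mul1r opprB.
  by rewrite /GRing.scale.
rewrite cabsN cabsM cabsV ltr_pdivrMl//.
apply: le_lt_trans (H _ hr) _; rewrite mulrC ltr_pM2l//.
by rewrite ltr_pdivrMr// ltr_pMr// ltr1n.
Qed.

Lemma cderiv_derivable f z d : cderiv f z d -> derivable f z 1.
Proof.
move=> /cderiv_cvg fd; apply/cvg_ex; exists d.
rewrite (_ : (fun h : C => _) = (fun h : C => h^-1 *: (f (h + z) - f z)))//.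
by apply/funext => h /=; rewrite /GRing.scale /= mulr1.
Qed.

Lemma cderiv_derive1 f z d : cderiv f z d -> derive1 f z = d.
Proof. by move=> /cderiv_cvg fd; apply/cvg_lim. Qed.

Lemma derivable_cderiv f z : derivable f z 1 -> cderiv f z (derive1 f z).
Proof.
move=> fz e e0.
have : (fun h : C => h^-1 *: (f (h + z) - f z)) @ 0^' --> derive1 f z.
  move: fz; rewrite /derivable (_ : (fun h : C => _) =
    (fun h : C => h^-1 *: (f (h + z) - f z)))//.
  by apply/funext => h /=; rewrite /GRing.scale /= mulr1.
move/cvgrPdist_lt/(_ (cof e)); rewrite -{1}cof0 lt_cof => /(_ e0) [r /=].
move=> /gt0_cof[x x0 ->] H; exists x => // h hx.
have [->|h0] := eqVneq h 0.
  by rewrite addr0 mulr0 !subrr cabs0 mulr0.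
have := H h; rewrite /= sub0r normrN !cabs_norm !lt_cof => /(_ hx h0).
have ch := cabs_gt0 h0.
have -> : derive1 f z - h^-1 *: (f (h + z) - f z) =
    - (h^-1 * (f (z + h) - f z - derive1 f z * h)).
  rewrite [h + z]addrC mulrBr [_ * h]mulrC mulrA mulVf// mul1r opprB.
  by rewrite /GRing.scale.
by rewrite cabsN cabsM cabsV ltr_pdivrMl // [cabs h * e]mulrC => /ltW.
Qed.

End Modulus.

(** * Goursat's theorem and Cauchy estimates on squares *)

Section Bisection.
Variable R : realType.
Implicit Types x y w h : R.

(** Compactness by quartering: if [P] failed on the whole rectangle it would fail on one quarter,
    then on a quarter of that one, and so on; the nested rectangles shrink to a point where the
    local hypothesis is contradicted. It serves both Goursat's theorem and the boundedness of
    continuous functions on squares. *)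
Lemma bisection (P : R -> R -> R -> R -> Prop) (x0 y0 W H : R) :
  0 <= W -> 0 <= H ->
  (forall x y w h, 0 <= w -> 0 <= h ->
     P x y w h -> P (x + w) y w h -> P x (y + h) w h -> P (x + w) (y + h) w h ->
     P x y (w + w) (h + h)) ->
  (forall x y, x0 <= x <= x0 + W -> y0 <= y <= y0 + H ->
     exists2 r, 0 < r & forall x' y' w h, 0 <= w < r -> 0 <= h < r ->
       x' <= x <= x' + w -> y' <= y <= y' + h -> P x' y' w h) ->
  P x0 y0 W H.
Proof.
move=> W0 H0 Pquart Ploc; apply: contrapT => nP.
pose w n := W / 2 ^+ n; pose h n := H / 2 ^+ n.
have w0 n : 0 <= w n by rewrite divr_ge0// exprn_ge0.
have h0 n : 0 <= h n by rewrite divr_ge0// exprn_ge0.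
have wS n : w n = w n.+1 + w n.+1.
  by rewrite /w exprS invfM; field; rewrite expf_neq0.
have hS n : h n = h n.+1 + h n.+1.
  by rewrite /h exprS invfM; field; rewrite expf_neq0.
pose good n (p : R * R) := ~ P p.1 p.2 (w n) (h n).
pose rel n (p q : R * R) := p.1 <= q.1 <= p.1 + w n.+1 /\ p.2 <= q.2 <= p.2 + h n.+1.
have step n p : good n p -> exists q, good n.+1 q /\ rel n p q.
  rewrite /good /rel wS hS => np; apply: contrapT => nq; apply: np.
  have wp := w0 n.+1; have hp := h0 n.+1.
  apply: Pquart => //; apply: contrapT => nr; apply: nq.
  - by exists (p.1, p.2); split => //=; rewrite !lexx !lerDl wp hp.
  - by exists (p.1 + w n.+1, p.2); split => //=; rewrite !lexx !lerDl wp hp.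
  - by exists (p.1, p.2 + h n.+1); split => //=; rewrite !lexx !lerDl wp hp.
  - by exists (p.1 + w n.+1, p.2 + h n.+1); split => //=; rewrite !lexx !lerDl wp hp.
have [f fP] : {f : nat -> R * R -> R * R |
    forall n p, good n p -> good n.+1 (f n p) /\ rel n p (f n p)}.
  have /choice[g gP] : forall np : nat * (R * R), exists q,
      good np.1 np.2 -> good np.1.+1 q /\ rel np.1 np.2 q.
    move=> [n p]; have [gp|ngp] := pselect (good n p); last by exists p.
    by have [q qP] := step _ _ gp; exists q.
  by exists (fun n p => g (n, p)) => n p; exact: (gP (n, p)).
pose s := fix s n := if n is m.+1 then f m (s m) else (x0, y0).
have sg n : good n (s n).
  elim: n => [|n ih]; last by have [] := fP _ _ ih.
  by rewrite /good /w /h !expr0 !divr1.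
have sr n : rel n (s n) (s n.+1) by have [] := fP _ _ (sg n).
(* The upper bounds say that the right and top edges only move inwards: each rectangle contains all
   later ones. *)
have mono n k : (s n).1 <= (s (n + k)%N).1 <= (s n).1 + w n - w (n + k)%N /\
    (s n).2 <= (s (n + k)%N).2 <= (s n).2 + h n - h (n + k)%N.
  elim: k => [|k [ih1 ih2]]; first by rewrite addn0 !addrK !lexx.
  rewrite addnS; have [r1 r2] := sr (n + k)%N.
  move: ih1 ih2 r1 r2; rewrite (wS (n + k)%N) (hS (n + k)%N) => *; split; lra.
have bnd n m : (s m).1 <= (s n).1 + w n /\ (s m).2 <= (s n).2 + h n.
  have [nm|mn] := leqP n m.
    have [] := mono n (m - n)%N; rewrite subnKC// => *.
    by have := w0 m; have := h0 m; split; lra.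
  have [] := mono m (n - m)%N; rewrite subnKC ?(ltnW mn)// => *.
  by have := w0 n; have := h0 n; split; lra.
(* The suprema of the lower left corners give the common point of all the rectangles. *)
pose X := sup [set (s n).1 | n in setT]; pose Y := sup [set (s n).2 | n in setT].
have hX : has_sup [set (s n).1 | n in setT].
  split; first by exists (s 0%N).1; exists 0%N.
  by exists ((s 0%N).1 + w 0%N) => _ [n _ <-]; have [] := bnd 0%N n.
have hY : has_sup [set (s n).2 | n in setT].
  split; first by exists (s 0%N).2; exists 0%N.
  by exists ((s 0%N).2 + h 0%N) => _ [n _ <-]; have [] := bnd 0%N n.
have Xn n : (s n).1 <= X <= (s n).1 + w n.
  apply/andP; split; first by apply: (sup_upper_bound hX); exists n.
  by apply: ge_sup; [case: hX|move=> _ [m _ <-]; have [] := bnd n m].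
have Yn n : (s n).2 <= Y <= (s n).2 + h n.
  apply/andP; split; first by apply: (sup_upper_bound hY); exists n.
  by apply: ge_sup; [case: hY|move=> _ [m _ <-]; have [] := bnd n m].
have w00 : w 0%N = W by rewrite /w expr0 divr1.
have h00 : h 0%N = H by rewrite /h expr0 divr1.
have [r r0 Hr] : exists2 r, 0 < r & forall x' y' w h, 0 <= w < r -> 0 <= h < r ->
       x' <= X <= x' + w -> y' <= Y <= y' + h -> P x' y' w h.
  by apply: Ploc; [have := Xn 0%N; rewrite w00|have := Yn 0%N; rewrite h00].
have [n [wn hn]] : exists n, w n < r /\ h n < r.
  have [n nW] : exists n : nat, (W + H) / r < n%:R.
    by exists (Num.truncn ((W + H) / r)).+1; exact: truncnS_gt.
  exists n; have n2 : n%:R < 2 ^+ n :> R by rewrite -natrX ltr_nat ltn_expl.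
  have : W + H < r * 2 ^+ n.
    by rewrite mulrC -ltr_pdivrMr//; exact: lt_trans n2.
  move=> lt; rewrite /w /h !ltr_pdivrMr ?exprn_gt0//; split; lra.
by apply: (sg n); apply: Hr; rewrite ?w0 ?h0 ?wn ?hn//.
Qed.

End Bisection.

(** * Contour integrals over rectangles and Goursat's theorem for real closed forms *)

Section ContourIntegral.
Variable R : realType.
Implicit Types (a b c x y w h : R) (u v : R -> R).

Definition itg u a b : R := \int[@lebesgue_measure R]_(t in `[a, b]) u t.

(** Two-sided continuity at every point, end points included, is inherited by subintervals at
    once. *)
Definition ctson u a b := forall t, a <= t <= b -> {for t, continuous u}.

Lemma ctson_sub u a b c d : ctson u a b -> a <= c -> d <= b -> ctson u c d.
Proof.
by move=> cu ac db t /andP[ct td]; apply: cu; rewrite (le_trans ac ct) (le_trans td db).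
Qed.

Lemma ctson_within u a b : ctson u a b -> {within `[a, b], continuous u}.
Proof.
move=> cu; apply: continuous_in_subspaceT => t.
by rewrite inE /= in_itv /= => /cu.
Qed.

Lemma ctson_integrable u a b : ctson u a b ->
  (@lebesgue_measure R).-integrable `[a, b] (EFin \o u).
Proof.
move=> /ctson_within cu.
by apply: continuous_compact_integrable => //; exact: segment_compact.
Qed.

Lemma itg_split u a c b : a <= c -> c <= b -> ctson u a b ->
  itg u a b = itg u a c + itg u c b.
Proof.
move=> ac cb cu; apply/eqP; rewrite addrC -subr_eq; apply/eqP.
rewrite /itg Rintegral_itvB ?bnd_simp//; last exact: ctson_integrable.
apply: Rintegral_itv_obnd_cbnd.
apply: integrableS (ctson_integrable (ctson_sub cu ac (lexx b))) => //.
by apply: subset_itvr; rewrite bnd_simp.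
Qed.

Lemma itgB u v a b : ctson u a b -> ctson v a b ->
  itg (fun t => u t - v t) a b = itg u a b - itg v a b.
Proof. by move=> cu cv; rewrite /itg RintegralB//; exact: ctson_integrable. Qed.

Lemma itg_cst k a b : a <= b -> itg (fun=> k) a b = k * (b - a).
Proof.
move=> ab; rewrite /itg Rintegral_cst//= lebesgue_measure_itv/= lte_fin.
by have [ab'|ba] := ltP a b => //=; rewrite (_ : b = a) ?subrr//; apply/le_anti; rewrite ba.
Qed.

Lemma ctson_cst k a b : ctson (fun=> k) a b.
Proof. by move=> t _; exact: cvg_cst. Qed.

Lemma itg_le u v a b : ctson u a b -> ctson v a b ->
  (forall t, a <= t <= b -> u t <= v t) -> itg u a b <= itg v a b.
Proof.
move=> cu cv uv; apply: le_Rintegral => //; try exact: ctson_integrable.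
Qed.

Lemma itg_ge_cst u k a b : a <= b -> ctson u a b ->
  (forall t, a <= t <= b -> k <= u t) -> k * (b - a) <= itg u a b.
Proof. by move=> ab cu ku; rewrite -itg_cst//; apply: itg_le => //; exact: ctson_cst. Qed.

Lemma itg_le_cst u k a b : a <= b -> ctson u a b ->
  (forall t, a <= t <= b -> u t <= k) -> itg u a b <= k * (b - a).
Proof. by move=> ab cu ku; rewrite -itg_cst//; apply: itg_le => //; exact: ctson_cst. Qed.

Variables P Q : R -> R -> R.

(** [P] and [Q] are differentiable at the point and the single number [b] is both the [y]-derivative
    of [P] and the [x]-derivative of [Q]. Nothing is asked of the continuity of these derivatives,
    as in Goursat's theorem. *)
Definition closed_form_at x y := exists a b c, forall e, 0 < e -> exists2 r, 0 < r &
  forall x' y', `|x' - x| < r -> `|y' - y| < r ->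
    `|P x' y' - P x y - a * (x' - x) - b * (y' - y)| <= e * (`|x' - x| + `|y' - y|) /\
    `|Q x' y' - Q x y - b * (x' - x) - c * (y' - y)| <= e * (`|x' - x| + `|y' - y|).

(** The counterclockwise integral of [P dx + Q dy] along the boundary. *)
Definition contour x y w h :=
  (itg (P ^~ y) x (x + w) - itg (P ^~ (y + h)) x (x + w)) +
  (itg (Q (x + w)) y (y + h) - itg (Q x) y (y + h)).

Definition closed_form_on x y w h := forall x' y', x <= x' <= x + w ->
  y <= y' <= y + h -> closed_form_at x' y'.

Lemma closed_form_ctsP x y : closed_form_at x y -> {for x, continuous (P ^~ y)}.
Proof.
move=> [a [b [c H]]]; have [r r0 {}H] := H _ ltr01.
apply/(@cvgrPdist_lt _ R) => e e0.
have k0 : 0 < `|a| + 1 by rewrite ltr_wpDl.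
exists (Num.min r (e / (`|a| + 1))); first by rewrite /= lt_min r0 divr_gt0.
move=> t /=; rewrite lt_min distrC => /andP[tr te].
have [|H1 _] := H t y tr; first by rewrite subrr normr0.
move: H1; rewrite subrr normr0 mulr0 subr0 addr0 mul1r => H1.
rewrite distrC; move: te; rewrite ltr_pdivlMr// => te.
rewrite (_ : P t y - P x y = (P t y - P x y - a * (t - x)) + a * (t - x)); last by ring.
apply: le_lt_trans (ler_normD _ _) _; rewrite normrM; apply: le_lt_trans te.
by rewrite [leRHS]mulrDr mulr1 addrC [`|a| * _]mulrC lerD2l.
Qed.

Lemma closed_form_ctsQ x y : closed_form_at x y -> {for y, continuous (Q x)}.
Proof.
move=> [b [c [a H]]]; have [r r0 {}H] := H _ ltr01.
apply/(@cvgrPdist_lt _ R) => e e0.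
have k0 : 0 < `|a| + 1 by rewrite ltr_wpDl.
exists (Num.min r (e / (`|a| + 1))); first by rewrite /= lt_min r0 divr_gt0.
move=> t /=; rewrite lt_min distrC => /andP[tr te].
have [|//|_ H1] := H x t; first by rewrite subrr normr0.
move: H1; rewrite subrr normr0 mulr0 subr0 add0r mul1r => H1.
rewrite distrC; move: te; rewrite ltr_pdivlMr// => te.
rewrite (_ : Q x t - Q x y = (Q x t - Q x y - a * (t - y)) + a * (t - y)); last by ring.
apply: le_lt_trans (ler_normD _ _) _; rewrite normrM; apply: le_lt_trans te.
by rewrite [leRHS]mulrDr mulr1 addrC [`|a| * _]mulrC lerD2l.
Qed.

Lemma closed_form_ctsonP x y w h t : closed_form_on x y w h ->
  y <= t <= y + h -> ctson (P ^~ t) x (x + w).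
Proof. by move=> cf ty s sx; apply: closed_form_ctsP; exact: cf. Qed.

Lemma closed_form_ctsonQ x y w h t : closed_form_on x y w h ->
  x <= t <= x + w -> ctson (Q t) y (y + h).
Proof. by move=> cf ty s sx; apply: closed_form_ctsQ; exact: cf. Qed.

Lemma closed_form_onS x y w h x' y' w' h' : closed_form_on x y w h ->
  x <= x' -> y <= y' -> x' + w' <= x + w -> y' + h' <= y + h ->
  closed_form_on x' y' w' h'.
Proof. by move=> cf *; move=> s t *; apply: cf; lra. Qed.

Lemma contour_split x y w w' h : 0 <= w -> 0 <= w' -> 0 <= h ->
  closed_form_on x y (w + w') h ->
  contour x y (w + w') h = contour x y w h + contour (x + w) y w' h.
Proof.
move=> w0 w0' h0 cf; have cP t : y <= t <= y + h -> ctson (P ^~ t) x (x + w + w').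
  by rewrite -addrA; exact: closed_form_ctsonP.
rewrite /contour (addrA x w w').
rewrite (itg_split (u := P ^~ y) (c := x + w)) ?lerDl//; last first.
  by apply: cP; rewrite lexx lerDl.
rewrite (itg_split (u := P ^~ (y + h)) (c := x + w)) ?lerDl//; last first.
  by apply: cP; rewrite lexx lerDl h0.
by ring.
Qed.

Lemma contour_vsplit x y w h h' : 0 <= w -> 0 <= h -> 0 <= h' ->
  closed_form_on x y w (h + h') ->
  contour x y w (h + h') = contour x y w h + contour x (y + h) w h'.
Proof.
move=> w0 w0' h0 cf; have cQ t : x <= t <= x + w -> ctson (Q t) y (y + h + h').
  by rewrite -addrA; exact: closed_form_ctsonQ.
rewrite /contour (addrA y h h').
rewrite (itg_split (u := Q x) (c := y + h)) ?lerDl//; last first.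
  by apply: cQ; rewrite lexx lerDl.
rewrite (itg_split (u := Q (x + w)) (c := y + h)) ?lerDl//; last first.
  by apply: cQ; rewrite lexx lerDl w0.
by ring.
Qed.

(* On a small rectangle both differences of slices equal [b] times a side, up
   to [o(w + h)], and these two main contributions cancel. *)
Lemma contour_local x y e : 0 < e -> closed_form_at x y ->
  exists2 r, 0 < r & forall x' y' w h, 0 <= w < r -> 0 <= h < r ->
    x' <= x <= x' + w -> y' <= y <= y' + h -> closed_form_on x' y' w h ->
    `|contour x' y' w h| <= e * (w + h) ^+ 2.
Proof.
move=> e0 [a [b [c H]]].
have [r r0 {}H] := H _ (divr_gt0 e0 (ltr0n _ 2)).
exists r => // x' y' w h /andP[w0 wr] /andP[h0 hr] xx yy cf.
have lexy s t : x' <= s <= x' + w -> y' <= t <= y' + h ->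
    `|P s t - P x y - a * (s - x) - b * (t - y)| <= e / 2 * (w + h) /\
    `|Q s t - Q x y - b * (s - x) - c * (t - y)| <= e / 2 * (w + h).
  move=> sx ty.
  have sw : `|s - x| <= w by rewrite ler_norml; lra.
  have th : `|t - y| <= h by rewrite ler_norml; lra.
  have [H1 H2] := H s t (le_lt_trans sw wr) (le_lt_trans th hr).
  have le : e / 2 * (`|s - x| + `|t - y|) <= e / 2 * (w + h).
    by rewrite ler_pM2l ?divr_gt0// lerD.
  by split; [exact: le_trans le|exact: le_trans le].
have x1 : x' <= x' <= x' + w by rewrite lexx lerDl.
have x2 : x' <= x' + w <= x' + w by rewrite lexx lerDl w0.
have y1 : y' <= y' <= y' + h by rewrite lexx lerDl.
have y2 : y' <= y' + h <= y' + h by rewrite lexx lerDl h0.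
have c1 := closed_form_ctsonP cf y1; have c2 := closed_form_ctsonP cf y2.
have c3 := closed_form_ctsonQ cf x2; have c4 := closed_form_ctsonQ cf x1.
have cP : ctson (fun s => P s y' - P s (y' + h)) x' (x' + w).
  by move=> s ss; apply: cvgB; [exact: c1|exact: c2].
have cQ : ctson (fun s => Q (x' + w) s - Q x' s) y' (y' + h).
  by move=> s ss; apply: cvgB; [exact: c3|exact: c4].
rewrite /contour -!itgB//.
have bP s : x' <= s <= x' + w -> - b * h - e * (w + h) <= P s y' - P s (y' + h)
    <= - b * h + e * (w + h).
  move=> ss; have [+ _] := lexy _ _ ss y1; have [+ _] := lexy _ _ ss y2.
  rewrite !ler_norml => *; lra.
have bQ s : y' <= s <= y' + h -> b * w - e * (w + h) <= Q (x' + w) s - Q x' s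
    <= b * w + e * (w + h).
  move=> ss; have [_ +] := lexy _ _ x1 ss; have [_ +] := lexy _ _ x2 ss.
  rewrite !ler_norml => *; lra.
have P1 := itg_ge_cst (k := - b * h - e * (w + h)) _ cP.
have P2 := itg_le_cst (k := - b * h + e * (w + h)) _ cP.
have Q1 := itg_ge_cst (k := b * w - e * (w + h)) _ cQ.
have Q2 := itg_le_cst (k := b * w + e * (w + h)) _ cQ.
move: P1 P2 Q1 Q2; rewrite !lerDl => /(_ w0) P1 /(_ w0) P2 /(_ h0) Q1 /(_ h0) Q2.
have {}P1 := P1 (fun s ss => proj1 (andP (bP s ss))).
have {}P2 := P2 (fun s ss => proj2 (andP (bP s ss))).
have {}Q1 := Q1 (fun s ss => proj1 (andP (bQ s ss))).
have {}Q2 := Q2 (fun s ss => proj2 (andP (bQ s ss))).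
by rewrite ler_norml; apply/andP; split; nra.
Qed.

(** The bound [k * (w + h) ^+ 2] is additive under quartering, since doubling both sides multiplies
    it by four; hence the local estimate propagates to the whole rectangle, with [k] arbitrarily
    small. *)
Lemma goursat x y w h : 0 <= w -> 0 <= h -> closed_form_on x y w h ->
  contour x y w h = 0.
Proof.
move=> w0 h0 cf; apply/eqP; rewrite -normr_le0; apply/ler_addgt0Pl => e e0.
rewrite addr0.
pose k := e / ((w + h) ^+ 2 + 1).
have k0 : 0 < k by rewrite divr_gt0// ltr_wpDl// sqr_ge0.
have : closed_form_on x y w h -> `|contour x y w h| <= k * (w + h) ^+ 2.
  apply: (@bisection _ (fun x' y' w' h' => closed_form_on x' y' w' h' ->
     `|contour x' y' w' h'| <= k * (w' + h') ^+ 2)) => //.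
    move=> x' y' w' h' w'0 h'0 q1 q2 q3 q4 cg.
    have cv s : closed_form_on x' s (w' + w') h' ->
        contour x' s (w' + w') h' = contour x' s w' h' + contour (x' + w') s w' h'.
      by move=> ?; rewrite contour_split.
    have cf1 : closed_form_on x' y' (w' + w') h' by apply: closed_form_onS cg _ _ _ _; lra.
    have cf2 : closed_form_on x' (y' + h') (w' + w') h' by apply: closed_form_onS cg _ _ _ _; lra.
    rewrite contour_vsplit//; last by rewrite addr_ge0.
    rewrite !cv//.
    have {}q1 := q1 (closed_form_onS cg _ _ _ _); have {}q2 := q2 (closed_form_onS cg _ _ _ _).
    have {}q3 := q3 (closed_form_onS cg _ _ _ _); have {}q4 := q4 (closed_form_onS cg _ _ _ _).
    move: q1 q2 q3 q4; rewrite !ler_norml.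
    move=> /(_ _ _ _ _)/andP[||||q11 q12]; [lra..|].
    move=> /(_ _ _ _ _)/andP[||||q21 q22]; [lra..|].
    move=> /(_ _ _ _ _)/andP[||||q31 q32]; [lra..|].
    move=> /(_ _ _ _ _)/andP[||||q41 q42]; [lra..|].
    apply/andP; split; lra.
  move=> s t sx ty.
  have [|r r0 H] := @contour_local s t k k0; first exact: cf.
  by exists r.
move=> /(_ cf) /le_trans; apply.
rewrite /k mulrAC ler_pdivrMr ?ltr_wpDl ?sqr_ge0// ler_pM2l// lerDl//.
Qed.

End ContourIntegral.

Section Squares.
Variable R : realType.
Implicit Types (x y : R).

Section ClosedForms.
Variables P Q : R -> R -> R.

Definition contour_box x1 x2 y1 y2 :=
  itg (P ^~ y1) x1 x2 - itg (P ^~ y2) x1 x2 + (itg (Q x2) y1 y2 - itg (Q x1) y1 y2).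

Lemma goursat_box x1 x2 y1 y2 : x1 <= x2 -> y1 <= y2 ->
  (forall x y, x1 <= x <= x2 -> y1 <= y <= y2 -> closed_form_at P Q x y) ->
  contour_box x1 x2 y1 y2 = 0.
Proof.
move=> x12 y12 cf.
have := @goursat _ P Q x1 y1 (x2 - x1) (y2 - y1).
rewrite /contour !subrKC !subr_ge0; apply => // x y.
by rewrite !subrKC; exact: cf.
Qed.

(** The region between the rectangle and the small square is cut into two full-width strips, below
    and above, and two blocks, left and right. None of them contains the exceptional point, so each
    contour vanishes. *)
Lemma contour_annulus a1 a2 d x1 x2 y1 y2 : 0 < d -> x1 <= a1 - d -> a1 + d <= x2 ->
  y1 <= a2 - d -> a2 + d <= y2 ->
  (forall x y, x1 <= x <= x2 -> y1 <= y <= y2 ->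
     (x, y) <> (a1, a2) -> closed_form_at P Q x y) ->
  contour_box x1 x2 y1 y2 = contour_box (a1 - d) (a1 + d) (a2 - d) (a2 + d).
Proof.
move=> d0 dx1 dx2 dy1 dy2 cf.
have cfx x y : x1 <= x <= x2 -> y1 <= y <= y2 -> x <> a1 -> closed_form_at P Q x y.
  by move=> xr yr xa; apply: cf => // -[].
have cfy x y : x1 <= x <= x2 -> y1 <= y <= y2 -> y <> a2 -> closed_form_at P Q x y.
  by move=> xr yr xa; apply: cf => // -[].
have bot : contour_box x1 x2 y1 (a2 - d) = 0.
  apply: goursat_box; [lra|lra|] => x y xr yr.
  by apply: cfy => [||ye]; lra.
have top : contour_box x1 x2 (a2 + d) y2 = 0.
  apply: goursat_box; [lra|lra|] => x y xr yr.
  by apply: cfy => [||ye]; lra.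
have lft : contour_box x1 (a1 - d) (a2 - d) (a2 + d) = 0.
  apply: goursat_box; [lra|lra|] => x y xr yr.
  by apply: cfx => [||ye]; lra.
have rgt : contour_box (a1 + d) x2 (a2 - d) (a2 + d) = 0.
  apply: goursat_box; [lra|lra|] => x y xr yr.
  by apply: cfx => [||ye]; lra.
have sP y : y1 <= y <= y2 -> y <> a2 -> itg (P ^~ y) x1 x2 =
    itg (P ^~ y) x1 (a1 - d) + itg (P ^~ y) (a1 - d) (a1 + d) +
    itg (P ^~ y) (a1 + d) x2.
  move=> yr ya; have cPy : ctson (P ^~ y) x1 x2.
    by move=> x xr; apply: closed_form_ctsP; exact: cfy.
  rewrite (itg_split (c := a1 - d) _ _ cPy); [|lra|lra].
  rewrite -addrA -(@itg_split _ _ (a1 - d) (a1 + d)); [|lra|lra|]; last first.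
    by apply: ctson_sub cPy _ _; lra.
  by [].
have sQ x : x1 <= x <= x2 -> x <> a1 -> itg (Q x) y1 y2 =
    itg (Q x) y1 (a2 - d) + itg (Q x) (a2 - d) (a2 + d) + itg (Q x) (a2 + d) y2.
  move=> yr ya; have cQx : ctson (Q x) y1 y2.
    by move=> y xr; apply: closed_form_ctsQ; exact: cfx.
  rewrite (itg_split (c := a2 - d) _ _ cQx); [|lra|lra].
  rewrite -addrA -(@itg_split _ _ (a2 - d) (a2 + d)); [|lra|lra|]; last first.
    by apply: ctson_sub cQx _ _; lra.
  by [].
apply/eqP; rewrite -subr_eq0; apply/eqP.
transitivity (contour_box x1 x2 y1 (a2 - d) + contour_box x1 x2 (a2 + d) y2 +
  contour_box x1 (a1 - d) (a2 - d) (a2 + d) +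
  contour_box (a1 + d) x2 (a2 - d) (a2 + d)); last first.
  by rewrite bot top lft rgt !addr0.
rewrite /contour_box (sP (a2 - d)); [|lra|by move=> ?; lra].
rewrite (sP (a2 + d)); [|lra|by move=> ?; lra].
rewrite (sQ x2); [|lra|by move=> ?; lra].
rewrite (sQ x1); [|lra|by move=> ?; lra].
by ring.
Qed.
End ClosedForms.
End Squares.

(** * Cauchy's formula as an inequality on rectangles *)

Section CauchySquare.
Variable R : realType.
Local Notation C := (Cplx R).
Implicit Types (F G f : C -> C) (x y : R) (z a h : C).

Local Notation Rez z := (complex.Re (z : R[i])).
Local Notation Imz z := (complex.Im (z : R[i])).

Definition ccts F z := forall e : R, 0 < e ->
  exists2 r : R, 0 < r & forall h, cabs h < r -> cabs (F (z + h) - F z) <= e.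

Lemma cderiv_ccts F z d : cderiv F z d -> ccts F z.
Proof.
move=> Fd e e0; have [r r0 H] := Fd _ ltr01.
have k0 : 0 < cabs d + 1 by rewrite ltr_wpDl// cabs_ge0.
exists (Num.min r (e / (cabs d + 1))); first by rewrite lt_min r0 divr_gt0.
move=> h; rewrite lt_min ltr_pdivlMr// => /andP[hr he].
rewrite -(subrK (d * h) (F (z + h) - F z)); apply: le_trans (cabsD _ _) _.
rewrite cabsM; apply: le_trans (ltW he).
by rewrite mulrDr mulr1 [leRHS]addrC [cabs h * _]mulrC lerD2r (le_trans (H _ hr))// mul1r.
Qed.

Lemma derivable_ccts F z : derivable F z 1 -> ccts F z.
Proof. by move=> /derivable_cderiv/cderiv_ccts. Qed.

Lemma mkCE z : mkC (Rez z, Imz z) = z.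
Proof. by case: z. Qed.

Lemma mkCD (x y s t : R) : mkC (x + s, y + t) = (mkC (x, y) : C) + mkC (s, t).
Proof. by []. Qed.

Lemma mkCB (x y s t : R) : mkC (x - s, y - t) = (mkC (x, y) : C) - mkC (s, t).
Proof. by []. Qed.

Lemma ccts_slice1 F x y : ccts F (mkC (x, y)) ->
  {for x, continuous (fun t => cabs (F (mkC (t, y))))}.
Proof.
move=> Fc; apply/(@cvgrPdist_lt _ R) => e e0.
have [r r0 H] := Fc _ (divr_gt0 e0 (ltr0n _ 2)).
exists r => // t /= tr.
have := H (mkC (t - x, 0)).
have -> : cabs (mkC (t - x, 0)) = `|t - x| by exact: (@cabs_cof R).
rewrite -mkCD subrKC addr0 distrC => /(_ tr) H1.
have e2 : e / 2 < e by rewrite ltr_pdivrMr// ltr_pMr// ltr1n.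
apply: le_lt_trans e2; apply: le_trans H1; rewrite distrC.
rewrite ler_norml; apply/andP; split; last by rewrite cabs_sub.
by rewrite lerNl opprB cabsBC cabs_sub.
Qed.

Lemma ccts_slice2 F x y : ccts F (mkC (x, y)) ->
  {for y, continuous (fun t => cabs (F (mkC (x, t))))}.
Proof.
move=> Fc; apply/(@cvgrPdist_lt _ R) => e e0.
have [r r0 H] := Fc _ (divr_gt0 e0 (ltr0n _ 2)).
exists r => // t /= tr.
have := H (mkC (0, t - y)).
have H2 : cabs (mkC (0, t - y)) < r.
  by apply: le_lt_trans (cabs_mkC_le _ _) _; rewrite normr0 add0r distrC.
rewrite -mkCD subrKC addr0 => /(_ H2) H1.
have e2 : e / 2 < e by rewrite ltr_pdivrMr// ltr_pMr// ltr1n.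
apply: le_lt_trans e2; apply: le_trans H1; rewrite distrC.
rewrite ler_norml; apply/andP; split; last by rewrite cabs_sub.
by rewrite lerNl opprB cabsBC cabs_sub.
Qed.

(* Cauchy-Riemann: [Re (G dz) = Re G dx - Im G dy] is a closed form. *)
Lemma holo_closed_form G x y : derivable G (mkC (x, y)) 1 ->
  closed_form_at (fun s t => Rez (G (mkC (s, t)))) (fun s t => - Imz (G (mkC (s, t)))) x y.
Proof.
move=> /derivable_cderiv; set d := derive1 G _ => Gd.
exists (Rez d), (- Imz d), (- Rez d) => e e0.
have [r r0 H] := Gd _ e0.
exists (r / 2); first by rewrite divr_gt0.
move=> s t sr tr.
have hl := @cabs_mkC_le R (s - x) (t - y).
have := H (mkC (s - x, t - y)); rewrite -mkCD !subrKC.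
have hr : cabs (mkC (s - x, t - y)) < r by apply: le_lt_trans hl _; lra.
move=> /(_ hr) {}H.
have {}H : cabs (G (mkC (s, t)) - G (mkC (x, y)) - d * mkC (s - x, t - y)) <=
   e * (`|s - x| + `|t - y|).
  by apply: le_trans H _; rewrite ler_pM2l.
split; [apply: le_trans (le_trans (ler_Re_cabs _) H)|apply: le_trans (le_trans (ler_Im_cabs _) H)].
  apply: le_of_eq; congr `|_|; move: (G (mkC (s, t))) (G (mkC (x, y))) d {Gd H}
  => [? ?] [? ?] [? ?] /=; ring.
rewrite -normrN; apply: le_of_eq; congr `|_|; move: (G (mkC (s, t))) (G (mkC (x, y))) d {Gd H}
  => [? ?] [? ?] [? ?] /=; ring.
Qed.

Definition box (x1 x2 y1 y2 : R) : set C :=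
  [set z | x1 <= Rez z <= x2 /\ y1 <= Imz z <= y2].

Lemma Re_div (w z : C) : Rez (w / z) =
  (Rez w * Rez z + Imz w * Imz z) / (Rez z ^+ 2 + Imz z ^+ 2).
Proof. by move: w z => [p q] [u v] /=; ring. Qed.

Lemma Im_div (w z : C) : Imz (w / z) =
  (Imz w * Rez z - Rez w * Imz z) / (Rez z ^+ 2 + Imz z ^+ 2).
Proof. by move: w z => [p q] [u v] /=; ring. Qed.

(** On a side of the square of half-side [d] around [a], this is the component of [w / (z - a)]
    along the contour when [w] is close to [- i m]. The main term is at least [m / (2 * d)] because
    [|u| <= d], and each of the errors [p], [q] costs at most [e * d] in the numerator. *)
Lemma side_lower (m e d p q u : R) : 0 < d -> 2 * e <= m -> `|p| <= e ->
  `|q| <= e -> `|u| <= d -> (m - 2 * e) / (2 * d) <= (p * u + (m + q) * d) / (u ^+ 2 + d ^+ 2).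
Proof.
move=> d0 em; rewrite !ler_norml => /andP[p1 p2] /andP[q1 q2] /andP[u1 u2].
have D0 : 0 < u ^+ 2 + d ^+ 2 by rewrite ltr_wpDl ?sqr_ge0// exprn_gt0.
rewrite ler_pdivlMr// mulrAC ler_pdivrMr ?mulr_gt0//.
have ud : u ^+ 2 <= d ^+ 2 by nra.
have A : (m - 2 * e) * (u ^+ 2 + d ^+ 2) <= (m - 2 * e) * (2 * d ^+ 2).
  by apply: ler_wpM2l; lra.
apply: le_trans A _.
have B : - (e * d) <= p * u by nra.
have E : - (e * d) <= q * d by nra.
nra.
Qed.

Lemma itg_norm_le (u v : R -> R) (p q : R) : p <= q -> ctson u p q -> ctson v p q ->
  (forall t, p <= t <= q -> `|u t| <= v t) -> `|itg u p q| <= itg v p q.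
Proof.
move=> pq cu cv uv; rewrite ler_norml; apply/andP; split; last first.
  by apply: itg_le => // t /uv; apply: le_trans; exact: ler_norm.
have c0 := @ctson_cst R 0 p q.
have -> : itg u p q = - (itg (fun t => 0 - u t) p q).
  by rewrite (itgB c0 cu) itg_cst// mul0r sub0r opprK.
rewrite lerN2; apply: itg_le => //.
  by move=> t tpq; apply: cvgB; [exact: c0|exact: cu].
by move=> t /uv; apply: le_trans; rewrite sub0r -normrN ler_norm.
Qed.

(** With [G = c F / (z - a)] and [|c| = r], one has [|G| <= |F|] on the outer boundary, where
    [|z - a| >= r]. The contour can be shrunk to a tiny square around [a], where continuity of [F]
    at [a] makes the integral of [Re (G dz)] at least almost [4 |F a| r]. The exact value would have
    [2 pi] for [4]. Only continuity is required at [a], so that difference quotients can be used. *)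
Lemma box_mean F a r x1 x2 y1 y2 : 0 < r ->
  x1 <= Rez a - r -> Rez a + r <= x2 -> y1 <= Imz a - r -> Imz a + r <= y2 ->
  (forall z, box x1 x2 y1 y2 z -> z <> a -> derivable F z 1) -> ccts F a ->
  4 * (cabs (F a) * r) <= itg (fun t => cabs (F (mkC (t, y1)))) x1 x2 +
    itg (fun t => cabs (F (mkC (t, y2)))) x1 x2 +
    itg (fun t => cabs (F (mkC (x1, t)))) y1 y2 +
    itg (fun t => cabs (F (mkC (x2, t)))) y1 y2.
Proof.
move=> r0 ax1 ax2 ay1 ay2 Fh Fa; set m := cabs (F a).
have Fcts z : box x1 x2 y1 y2 z -> ccts F z.
  move=> sz; have [->//|/eqP za] := eqVneq z a.
  by apply: derivable_ccts; exact: Fh.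
have x1x2 : x1 <= x2 by lra.
have y1y2 : y1 <= y2 by lra.
have cside1 s : y1 <= s <= y2 -> ctson (fun t => cabs (F (mkC (t, s)))) x1 x2.
  by move=> sr t tr; apply: ccts_slice1; apply: Fcts.
have cside2 s : x1 <= s <= x2 -> ctson (fun t => cabs (F (mkC (s, t)))) y1 y2.
  by move=> sr t tr; apply: ccts_slice2; apply: Fcts.
have [m0|m0] := leP m 0.
  apply: (@le_trans _ _ 0); first by rewrite mulr_ge0_le0// mulr_le0_ge0// ltW.
  by rewrite !addr_ge0//; apply: Rintegral_ge0 => t _; rewrite cabs_ge0.
have m00 : m != 0 by rewrite gt_eqF.
(* The rotation makes [c * F a = - i |F a| r]; as [dz / (z - a)] integrates to [2 pi i], the contour
   integral of [Re (G dz)] becomes positive. *)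
pose c : C := Complex 0 (-1) * conjc (F a) * cof m^-1 * cof r.
have cFa : c * F a = Complex 0 (- (m * r)).
  rewrite /c cofV.
  have E : conjc (F a) * F a = cof m * cof m.
    rewrite -cofM -expr2 /m cabs_sqr; case: (F a) => p q.
    by apply/eqP; rewrite eq_complex /=; apply/andP; split; apply/eqP; ring.
  have cm0 : cof m != 0 by apply: contra m00 => /eqP [->].
  transitivity (Complex 0 (-1) * cof r * (conjc (F a) * F a) * (cof m)^-1 : C); first by ring.
  rewrite E -mulrA mulfK//.
  by apply/eqP; rewrite eq_complex /=; apply/andP; split; apply/eqP; ring.
have c1 : cabs c = r.
  apply: (mulIf m00); rewrite -[in LHS]/(cabs (F a)) -cabsM cFa.
  rewrite /cabs /= expr0n add0r sqrrN sqrtr_sqr gtr0_norm; last exact: mulr_gt0.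
  by rewrite mulrC.
pose G z := c * F z / (z - a).
have Gh z : box x1 x2 y1 y2 z -> z <> a -> derivable G z 1.
  move=> sz za; apply: derivableM; last first.
    apply: derivableV; first by rewrite subr_eq0; exact/eqP.
    by apply: derivableB; [exact: derivable_id|exact: derivable_cst].
  by apply: derivableM; [exact: derivable_cst|exact: Fh].
pose P (s t : R) := Rez (G (mkC (s, t))).
pose Q (s t : R) := - Imz (G (mkC (s, t))).
have Gcf x y : x1 <= x <= x2 -> y1 <= y <= y2 ->
     (x, y) <> (Rez a, Imz a) -> closed_form_at P Q x y.
  move=> xr yr xy; apply: holo_closed_form; apply: Gh => //.
  by move=> E; apply: xy; rewrite -E.
have GP s : y1 <= s <= y2 -> s != Imz a -> ctson (P ^~ s) x1 x2.
  move=> sr sa t td; apply: closed_form_ctsP; apply: Gcf => // -[_ sE].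
  by rewrite sE eqxx in sa.
have GQ s : x1 <= s <= x2 -> s != Rez a -> ctson (Q s) y1 y2.
  move=> sr sa t td; apply: closed_form_ctsQ; apply: Gcf => // -[sE _].
  by rewrite sE eqxx in sa.
have up : contour_box P Q x1 x2 y1 y2 <=
    itg (fun t => cabs (F (mkC (t, y1)))) x1 x2 +
    itg (fun t => cabs (F (mkC (t, y2)))) x1 x2 +
    itg (fun t => cabs (F (mkC (x1, t)))) y1 y2 +
    itg (fun t => cabs (F (mkC (x2, t)))) y1 y2.
  clear - r0 c1 G P Q GP GQ cside1 cside2 x1x2 y1y2 ax1 ax2 ay1 ay2.
  have Gle z : r <= cabs (z - a) -> cabs (G z) <= cabs (F z).
    move=> zr; rewrite /G cabsM cabsM c1 cabsV mulrAC.
    have z0 : 0 < cabs (z - a) by exact: lt_le_trans zr.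
    by rewrite ler_piMl ?cabs_ge0// ler_pdivrMr// mul1r.
  have Gre z : r <= `|Imz z - Imz a| -> `|Rez (G z)| <= cabs (F z).
    move=> zr; apply: le_trans (ler_Re_cabs _) (Gle _ _); apply: le_trans zr _.
    by apply: le_trans (ler_Im_cabs _); case: (z) (a) => [? ?] [? ?].
  have Gim z : r <= `|Rez z - Rez a| -> `|Imz (G z)| <= cabs (F z).
    move=> zr; apply: le_trans (ler_Im_cabs _) (Gle _ _); apply: le_trans zr _.
    by apply: le_trans (ler_Re_cabs _); case: (z) (a) => [? ?] [? ?].
  have rn (p q : R) : p <= q - r -> r <= `|p - q| /\ p != q.
    move=> pq; split; last by rewrite lt_eqF//; lra.
    by rewrite ltr0_norm; lra.
  have rp (p q : R) : q + r <= p -> r <= `|p - q| /\ p != q.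
    move=> pq; split; last by rewrite gt_eqF//; lra.
    by rewrite gtr0_norm; lra.
  have [[ny1 ny1'] [ny2 ny2']] := (rn _ _ ay1, rp _ _ ay2).
  have [[nx1 nx1'] [nx2 nx2']] := (rn _ _ ax1, rp _ _ ax2).
  have yy1 : y1 <= y1 <= y2 by rewrite lexx.
  have yy2 : y1 <= y2 <= y2 by rewrite lexx andbT.
  have xx1 : x1 <= x1 <= x2 by rewrite lexx.
  have xx2 : x1 <= x2 <= x2 by rewrite lexx andbT.
  have i1 : `|itg (P ^~ y1) x1 x2| <= itg (fun t => cabs (F (mkC (t, y1)))) x1 x2.
    apply: itg_norm_le => //; [exact: GP|exact: cside1|].
    by move=> t _; exact: Gre.
  have i2 : `|itg (P ^~ y2) x1 x2| <= itg (fun t => cabs (F (mkC (t, y2)))) x1 x2.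
    apply: itg_norm_le => //; [exact: GP|exact: cside1|].
    by move=> t _; exact: Gre.
  have i3 : `|itg (Q x1) y1 y2| <= itg (fun t => cabs (F (mkC (x1, t)))) y1 y2.
    apply: itg_norm_le => //; [exact: GQ|exact: cside2|].
    by move=> t _; rewrite normrN; exact: Gim.
  have i4 : `|itg (Q x2) y1 y2| <= itg (fun t => cabs (F (mkC (x2, t)))) y1 y2.
    apply: itg_norm_le => //; [exact: GQ|exact: cside2|].
    by move=> t _; rewrite normrN; exact: Gim.
  clear - i1 i2 i3 i4.
  move: i1 i2 i3 i4; rewrite /contour_box !ler_norml.
  move: (itg _ _ _) (itg _ _ _) (itg _ _ _) (itg _ _ _) => *; lra.
apply/ler_addgt0Pl => eta eta0.
have M0 : 0 < m * r by exact: mulr_gt0.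
(* The first bound is the hypothesis [2 * e <= m] of [side_lower] (with [m * r] for [m]), the second
   absorbs the final loss [8 * e] into [eta]. *)
pose e := Num.min (m * r / 2) (eta / 8).
have e0 : 0 < e by rewrite lt_min !divr_gt0.
have em : 2 * e <= m * r by rewrite mulrC -ler_pdivlMr// ge_min lexx.
have ee : 8 * e <= eta by rewrite mulrC -ler_pdivlMr// ge_min lexx orbT.
have [k k0 Hk] := Fa _ (divr_gt0 e0 r0).
pose d := Num.min r (k / 4).
have d0 : 0 < d by rewrite lt_min r0 divr_gt0.
have dr : d <= r by rewrite ge_min lexx.
have dk : 2 * d < k.
  have : d <= k / 4 by rewrite ge_min lexx orbT.
  by clear - k0; lra.
pose sq := box (Rez a - d) (Rez a + d) (Imz a - d) (Imz a + d).
have wE z : sq z -> exists p q : R, [/\ `|p| <= e, `|q| <= e &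
    c * F z = Complex p (- (m * r + q))].
  move=> [zd1 zd2]; have zd : cabs (z - a) <= 2 * d.
    rewrite -(mkCE z) -(mkCE a) -mkCB.
    apply: le_trans (cabs_mkC_le _ _) _; rewrite mulrDl mul1r.
    by rewrite lerD// ler_norml; clear - zd1 zd2; lra.
  have := Hk (z - a) (le_lt_trans zd dk); rewrite subrKC => Hz.
  have : cabs (c * F z - c * F a) <= e by rewrite -mulrBr cabsM c1 mulrC -ler_pdivlMr.
  rewrite cFa; case: (c * F z) => p q H.
  exists p, (- (m * r) - q); split; last by congr Complex; ring.
    by apply: le_trans H; apply: le_trans (ler_Re_cabs _); rewrite /= oppr0 addr0.
  apply: le_trans H; apply: le_trans (ler_Im_cabs _); rewrite /= -normrN.
  by apply: le_of_eq; congr `|_|; ring.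
(* Each of the four sides, of length [2 * d], contributes at least [lo * (2 * d)] in the
   counterclockwise orientation; in total [4 * (m * r) - 8 * e], whatever [d] is. *)
pose lo := (m * r - 2 * e) / (2 * d).
have Glo z : sq z -> [/\ Imz z - Imz a = - d -> lo <= Rez (G z),
   Imz z - Imz a = d -> Rez (G z) <= - lo, Rez z - Rez a = d -> lo <= - Imz (G z) &
   Rez z - Rez a = - d -> - Imz (G z) <= - lo].
  move=> sz; have [p [q [pe qe cFz]]] := wE _ sz; case: sz => xz yz.
  have {}xz : `|Rez z - Rez a| <= d by rewrite ler_norml; clear -xz; lra.
  have {}yz : `|Imz z - Imz a| <= d by rewrite ler_norml; clear -yz; lra.
  have pe' : `|- p| <= e by rewrite normrN.
  have E1 : Rez (z - a) = Rez z - Rez a by case: (z) (a) => [? ?] [? ?].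
  have E2 : Imz (z - a) = Imz z - Imz a by case: (z) (a) => [? ?] [? ?].
  rewrite /G Re_div Im_div cFz /= E1 E2; split => zd; rewrite zd.
  - have := side_lower d0 em pe qe xz; rewrite sqrrN -/lo.
    by move/le_trans; apply; apply: le_of_eq; congr (_ / _); ring.
  - have := side_lower d0 em pe' qe xz; rewrite -/lo -lerN2.
    by apply: le_trans; apply: le_of_eq; rewrite -mulNr; congr (_ / _); ring.
  - have := side_lower d0 em pe qe yz; rewrite -/lo.
    move/le_trans; apply; apply: le_of_eq; rewrite -mulNr; congr (_ / _); ring.
  - have := side_lower d0 em pe' qe yz; rewrite -/lo -lerN2.
    by apply: le_trans; apply: le_of_eq; rewrite -!mulNr sqrrN; congr (_ / _); ring.
have nd (s : R) : s + d != s /\ s - d != s.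
  by split; [rewrite gt_eqF// ltrDl|rewrite lt_eqF// ltrBlDr ltrDl].
have [[nI1 nI2] [nR1 nR2]] := (nd (Imz a), nd (Rez a)).
have yr (s : R) : s = Imz a - d \/ s = Imz a + d -> y1 <= s <= y2.
  by clear - ay1 ay2 dr d0 => -[->|->]; lra.
have xr (s : R) : s = Rez a - d \/ s = Rez a + d -> x1 <= s <= x2.
  by clear - ax1 ax2 dr d0 => -[->|->]; lra.
have subx : x1 <= Rez a - d /\ Rez a + d <= x2 by clear - ax1 ax2 dr; split; lra.
have suby : y1 <= Imz a - d /\ Imz a + d <= y2 by clear - ay1 ay2 dr; split; lra.
have A : contour_box P Q x1 x2 y1 y2 =
    contour_box P Q (Rez a - d) (Rez a + d) (Imz a - d) (Imz a + d).
  by case: subx suby => ? ? [? ?]; apply: contour_annulus.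
have low : lo * (8 * d) <= contour_box P Q (Rez a - d) (Rez a + d) (Imz a - d) (Imz a + d).
  clear - d0 Glo G P Q GP GQ nI1 nI2 nR1 nR2 yr xr subx suby.
  case: subx suby => bx1 bx2 [by1 by2].
  have rle (s : R) : s - d <= s + d by lra.
  have mdd (s : R) : s - d <= s - d <= s + d by lra.
  have pdd (s : R) : s - d <= s + d <= s + d by lra.
  have w2 (s : R) : s + d - (s - d) = 2 * d by ring.
  have ep (s : R) : s + d - s = d by ring.
  have en (s : R) : s - d - s = - d by ring.
  have i1 : lo * (2 * d) <= itg (P ^~ (Imz a - d)) (Rez a - d) (Rez a + d).
    rewrite -(w2 (Rez a)); apply: (itg_ge_cst (rle _)) => [|t td].
      by apply: ctson_sub bx1 bx2; apply: GP => //; apply: yr; left.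
    by have [h _ _ _] := Glo (mkC (t, Imz a - d)) (conj td (mdd _)); apply: h; exact: en.
  have i2 : itg (P ^~ (Imz a + d)) (Rez a - d) (Rez a + d) <= - lo * (2 * d).
    rewrite -(w2 (Rez a)); apply: (itg_le_cst (rle _)) => [|t td].
      by apply: ctson_sub bx1 bx2; apply: GP => //; apply: yr; right.
    by have [_ h _ _] := Glo (mkC (t, Imz a + d)) (conj td (pdd _)); apply: h; exact: ep.
  have i3 : lo * (2 * d) <= itg (Q (Rez a + d)) (Imz a - d) (Imz a + d).
    rewrite -(w2 (Imz a)); apply: (itg_ge_cst (rle _)) => [|t td].
      by apply: ctson_sub by1 by2; apply: GQ => //; apply: xr; right.
    by have [_ _ h _] := Glo (mkC (Rez a + d, t)) (conj (pdd _) td); apply: h; exact: ep.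
  have i4 : itg (Q (Rez a - d)) (Imz a - d) (Imz a + d) <= - lo * (2 * d).
    rewrite -(w2 (Imz a)); apply: (itg_le_cst (rle _)) => [|t td].
      by apply: ctson_sub by1 by2; apply: GQ => //; apply: xr; left.
    by have [_ _ _ h] := Glo (mkC (Rez a - d, t)) (conj (mdd _) td); apply: h; exact: en.
  clear - i1 i2 i3 i4; rewrite /contour_box.
  move: i1 i2 i3 i4; move: (itg _ _ _) (itg _ _ _) (itg _ _ _) (itg _ _ _) => *; lra.
have loE : lo * (8 * d) = 4 * (m * r) - 8 * e.
  by rewrite /lo; field; rewrite gt_eqF.
clear - A low loE up ee; lra.
Qed.

End CauchySquare.

(** * Cauchy estimates, growth along segments, boundedness on compact sets *)

Section CauchyEstimates.
Variable R : realType.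
Local Notation C := (Cplx R).
Implicit Types (F G f : C -> C) (x y r : R) (z a h : C).

Local Notation Rez z := (complex.Re (z : R[i])).
Local Notation Imz z := (complex.Im (z : R[i])).

Definition square a r := box (Rez a - r) (Rez a + r) (Imz a - r) (Imz a + r).

Lemma squareP a r z : square a r z <-> `|Rez (z - a)| <= r /\ `|Imz (z - a)| <= r.
Proof.
case: z a => [x y] [p q]; rewrite /square /box /= !ler_norml.
by split => -[h1 h2]; split; lra.
Qed.

Lemma square_center a r : 0 <= r -> square a r a.
Proof. by move=> r0; apply/squareP; rewrite subrr /= normr0. Qed.

Lemma square_trans a b r s z : square a r b -> square b s z -> square a (r + s) z.
Proof.
case: a b z => [a1 a2] [b1 b2] [x y]; rewrite /square /box /= => -[h1 h2] [h3 h4].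
by split; lra.
Qed.

Lemma square_le a r s z : r <= s -> square a r z -> square a s z.
Proof.
by move=> rs /squareP[h1 h2]; apply/squareP; split; apply: le_trans rs.
Qed.

Lemma square_cabs a r z : square a r z -> cabs (z - a) <= 2 * r.
Proof.
move=> /squareP[h1 h2]; rewrite -(mkCE (z - a)).
by apply: le_trans (cabs_mkC_le _ _) _; rewrite mulrDl mul1r lerD.
Qed.

Lemma cabs_square a r z : cabs (z - a) <= r -> square a r z.
Proof.
by move=> zr; apply/squareP; split; apply: le_trans zr; [exact: ler_Re_cabs|exact: ler_Im_cabs].
Qed.

Lemma square_add a r h : cabs h <= r -> square a r (a + h).
Proof. by move=> hr; apply: cabs_square; rewrite addrC addKr. Qed.

(** Four sides of length [2 * r] give [4 |F a| r <= 8 r M]. Values of [F] close to [a] do not enter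
    [M]. *)
Lemma square_bound F a r M : 0 < r ->
  (forall z, square a r z -> z <> a -> derivable F z 1) -> ccts F a ->
  (forall z, square a r z -> r <= cabs (z - a) -> cabs (F z) <= M) ->
  cabs (F a) <= 2 * M.
Proof.
move=> r0 Fh Fa FM; case: a => [a1 a2] in Fh Fa FM *; set a : C := Complex a1 a2.
have Fcts z : square a r z -> ccts F z.
  move=> sz; have [->//|/eqP za] := eqVneq z a.
  by apply: derivable_ccts; exact: Fh.
have nrm (p q : R) : p = q - r \/ p = q + r -> r <= `|p - q|.
  case=> ->; first by rewrite addrAC subrr add0r normrN gtr0_norm.
  by rewrite addrC addKr gtr0_norm.
have M1 s t : s = a2 - r \/ s = a2 + r -> a1 - r <= t <= a1 + r -> cabs (F (mkC (t, s))) <= M.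
  move=> sr tr; apply: FM.
    by split => //=; case: sr => ->; clear - r0; lra.
  by apply: le_trans (nrm _ _ sr) _; exact: (ler_Im_cabs (mkC (t - a1, s - a2))).
have M2 s t : s = a1 - r \/ s = a1 + r -> a2 - r <= t <= a2 + r -> cabs (F (mkC (s, t))) <= M.
  move=> sr tr; apply: FM.
    by split => //=; case: sr => ->; clear - r0; lra.
  by apply: le_trans (nrm _ _ sr) _; exact: (ler_Re_cabs (mkC (s - a1, t - a2))).
have c1 s : s = a2 - r \/ s = a2 + r -> ctson (fun t => cabs (F (mkC (t, s)))) (a1 - r) (a1 + r).
  move=> sr t tr; apply: ccts_slice1; apply: Fcts.
  by split => //=; case: sr => ->; clear - r0; lra.
have c2 s : s = a1 - r \/ s = a1 + r -> ctson (fun t => cabs (F (mkC (s, t)))) (a2 - r) (a2 + r).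
  move=> sr t tr; apply: ccts_slice2; apply: Fcts.
  by split => //=; case: sr => ->; clear - r0; lra.
have le (s : R) : s - r <= s + r by clear -r0; lra.
have := @box_mean _ F a r (a1 - r) (a1 + r) (a2 - r) (a2 + r) r0 (lexx _) (lexx _) (lexx _) (lexx _) Fh Fa.
have i1 := itg_le_cst (le _) (c1 _ (or_introl erefl)) (fun t => M1 _ t (or_introl erefl)).
have i2 := itg_le_cst (le _) (c1 _ (or_intror erefl)) (fun t => M1 _ t (or_intror erefl)).
have i3 := itg_le_cst (le _) (c2 _ (or_introl erefl)) (fun t => M2 _ t (or_introl erefl)).
have i4 := itg_le_cst (le _) (c2 _ (or_intror erefl)) (fun t => M2 _ t (or_intror erefl)).
move: i1 i2 i3 i4.
have -> : forall s : R, s + r - (s - r) = 2 * r by move=> s; ring.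
have -> : forall s : R, s + r - (s - r) = 2 * r by move=> s; ring.
move=> i1 i2 i3 i4 B.
have : cabs (F a) * r <= (2 * M) * r.
  clear - i1 i2 i3 i4 B; move: i1 i2 i3 i4 B.
  move: (itg _ _ _) (itg _ _ _) (itg _ _ _) (itg _ _ _) => *; lra.
by rewrite ler_pM2r.
Qed.

Lemma cderiv_local f g z d r : 0 < r -> (forall h, cabs h < r -> f (z + h) = g (z + h)) ->
  cderiv g z d -> cderiv f z d.
Proof.
move=> r0 fg gd e e0; have [k k0 H] := gd _ e0.
exists (Num.min r k); first by rewrite lt_min r0.
move=> h; rewrite lt_min => /andP[hr hk]; rewrite fg// -[z in f z]addr0 fg ?cabs0// addr0.
exact: H.
Qed.

(** The difference quotient at [a], completed by the value [f'(a)], is derivable off [a] and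
    continuous at [a], which is exactly what [square_bound] asks. On the boundary it is at most
    [2 * M / r]. *)
Lemma cauchy_estimate f a r M : 0 < r ->
  (forall z, square a r z -> derivable f z 1) ->
  (forall z, square a r z -> cabs (f z) <= M) ->
  cabs (derive1 f a) <= 4 * M / r.
Proof.
move=> r0 fh fM.
have sa : square a r a by apply: square_center; exact: ltW.
pose q z := (f z - f a) / (z - a).
pose F z := if z == a then derive1 f a else q z.
have Fa : F a = derive1 f a by rewrite /F eqxx.
have Fq z : z <> a -> F z = q z by move=> /eqP za; rewrite /F (negbTE za).
rewrite -Fa; have -> : 4 * M / r = 2 * (2 * M / r) by ring.
apply: (@square_bound F a r) => //.
- move=> z sz za; apply: cderiv_derivable; apply: (@cderiv_local F q z (derive1 q z) (cabs (z - a))).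
  + by apply: cabs_gt0; rewrite subr_eq0; exact/eqP.
  + move=> h ha; apply: Fq => E; move: ha; rewrite -E opprD addNKr cabsN ltxx//.
  apply: derivable_cderiv; apply: derivableM.
    by apply: derivableB; [exact: fh|exact: derivable_cst].
  apply: derivableV; first by rewrite subr_eq0; exact/eqP.
  by apply: derivableB; [exact: derivable_id|exact: derivable_cst].
- move=> e e0; have [k k0 H] := derivable_cderiv (fh _ sa) e0.
  exists k => // h hk; have [->|h0] := eqVneq h 0.
    by rewrite addr0 subrr cabs0 ltW.
  have ah : a + h <> a by move=> /eqP; rewrite -subr_eq0 addrC addKr (negbTE h0).
  rewrite Fa Fq// /q [a + h - a]addrC addKr.
  have := H _ hk; rewrite -ler_pdivrMr ?cabs_gt0// -cabsV -cabsM mulrBl mulfK//.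
- move=> z sz zr; have z0 : 0 < cabs (z - a) by exact: lt_le_trans zr.
  have za : z <> a by move=> E; move: z0; rewrite E subrr cabs0 ltxx.
  rewrite Fq// /q cabsM cabsV ler_pdivrMr//.
  apply: le_trans (cabsB _ _) _.
  apply: (@le_trans _ _ (2 * M)); first by rewrite mulrDl mul1r lerD// fM.
  have M0 : 0 <= M by apply: le_trans (cabs_ge0 _) (fM _ sa).
  rewrite -[2 * M / r * _]mulrA ler_peMr ?mulr_ge0//.
  by rewrite ler_pdivlMl// mulr1.
Qed.

Lemma unimodular z : exists2 c : C, cabs c = 1 & c * z = cof (cabs z).
Proof.
have [->|z0] := eqVneq z 0; first by exists 1; rewrite ?cabs1// mulr0 cabs0 cof0.
have k0 := cabs_gt0 z0; have ck : cof (cabs z) != 0 by apply/eqP => -[E]; rewrite E ltxx in k0.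
exists (cof (cabs z) / z); last by rewrite mulfVK.
by rewrite cabsM cabsV cabs_cof gtr0_norm// mulfV// gt_eqF.
Qed.

Lemma is_derive_eps (g : R -> R) (t d : R) :
  (forall e, 0 < e -> exists2 r, 0 < r & forall s, `|s| < r ->
      `|g (t + s) - g t - d * s| <= e * `|s|) -> is_derive t 1 g d.
Proof.
move=> H.
have cv : (fun h : R => h^-1 *: (g (h + t) - g t)) @ 0^' --> d.
  apply/(@cvgrPdist_lt _ R) => e e0.
  have [r r0 {}H] := H _ (divr_gt0 e0 (ltr0n _ 2)).
  exists r => // s /=; rewrite sub0r normrN => sr s0.
  have n0 : 0 < `|s| by rewrite normr_gt0.
  have -> : d - s^-1 *: (g (s + t) - g t) = - (s^-1 * (g (t + s) - g t - d * s)).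
    by rewrite [s + t]addrC /GRing.scale /=; field.
  rewrite normrN normrM normfV ltr_pdivrMl//.
  apply: le_lt_trans (H _ sr) _; rewrite mulrC ltr_pM2l//.
  by rewrite ltr_pdivrMr// ltr_pMr// ltr1n.
have E : (fun h : R => h^-1 *: (g (h *: 1 + t) - g t)) = (fun h : R => h^-1 *: (g (h + t) - g t)).
  by apply/funext => h; rewrite /GRing.scale /= mulr1.
apply: DeriveDef; first by apply/cvg_ex; exists d; rewrite /= E.
by rewrite /derive /= E; apply/cvg_lim.
Qed.

Lemma is_derive_path f a b (c : C) (t : R) : derivable f (a + cof t * (b - a)) 1 ->
  is_derive t 1 (fun s => Rez (c * f (a + cof s * (b - a))))
    (Rez (c * derive1 f (a + cof t * (b - a)) * (b - a))).
Proof.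
move=> /derivable_cderiv; set z := a + _; set d := derive1 f z => H.
apply: is_derive_eps => e e0.
have k0 : 0 < (cabs c + 1) * (cabs (b - a) + 1).
  by rewrite mulr_gt0// ltr_wpDl// cabs_ge0.
have [r r0 {}H] := H _ (divr_gt0 e0 k0).
have l0 : 0 < cabs (b - a) + 1 by rewrite ltr_wpDl// cabs_ge0.
exists (r / (cabs (b - a) + 1)); first exact: divr_gt0.
move=> s; rewrite ltr_pdivlMr// => sr.
have hs : cabs (cof s * (b - a)) <= `|s| * (cabs (b - a) + 1).
  by rewrite cabsM cabs_cof ler_wpM2l// lerDl.
have := H _ (le_lt_trans hs sr); set w := cof s * _ => H1.
have E : Rez (c * f (a + cof (t + s) * (b - a))) - Rez (c * f z) - Rez (c * d * (b - a)) * s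
   = Rez (c * (f (z + w) - f z - d * w)).
  have -> : a + cof (t + s) * (b - a) = z + w by rewrite /z /w cofD; ring.
  clear -w; move: (f (z + w)) (f z) d => D1 D2 D3; rewrite /w; move: (b - a) c D1 D2 D3
    => [? ?] [? ?] [? ?] [? ?] [? ?] /=; ring.
rewrite E; apply: le_trans (ler_Re_cabs _) _; rewrite cabsM.
apply: le_trans (ler_wpM2l (cabs_ge0 _) H1) _.
apply: (@le_trans _ _ (cabs c * (e / ((cabs c + 1) * (cabs (b - a) + 1)) * (`|s| * (cabs (b - a) + 1))))).
  by rewrite ler_wpM2l ?cabs_ge0// ler_wpM2l// divr_ge0// ltW.
have c1 : 0 < cabs c + 1 by rewrite ltr_wpDl// cabs_ge0.
have -> : cabs c * (e / ((cabs c + 1) * (cabs (b - a) + 1)) * (`|s| * (cabs (b - a) + 1))) =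
   e * `|s| * (cabs c / (cabs c + 1)) by field; rewrite !gt_eqF.
apply: ler_piMr; first by rewrite mulr_ge0// ltW.
by rewrite ler_pdivrMr// mul1r lerDl.
Qed.

(* The real mean value theorem for [V] minus the real part of a rotation of
   [f] along the segment. *)
Lemma path_growth f a b (V V' : R -> R) :
  (forall t : R, 0 <= t <= 1 -> derivable f (a + cof t * (b - a)) 1) ->
  (forall t : R, 0 <= t <= 1 -> is_derive t 1 V (V' t)) ->
  (forall t : R, 0 <= t <= 1 -> cabs (derive1 f (a + cof t * (b - a))) * cabs (b - a) <= V' t) ->
  cabs (f b - f a) <= V 1 - V 0.
Proof.
move=> fd Vd fV; have [c c1 cE] := unimodular (f b - f a).
pose g (s : R) := Rez (c * f (a + cof s * (b - a))).
pose g' (t : R) := Rez (c * derive1 f (a + cof t * (b - a)) * (b - a)).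
have gd (t : R) : 0 <= t <= 1 -> is_derive t 1 (V \- g) (V' t - g' t).
  move=> t01; have h1 := Vd t t01.
  have h2 : is_derive t 1 g (g' t) by apply: is_derive_path; exact: fd.
  exact: is_deriveB.
have [||xi] := @MVT R (V \- g) (fun t => V' t - g' t) 0 1 ltr01.
- by move=> t; rewrite in_itv /= => /andP[t0 t1]; apply: gd; rewrite !ltW.
- apply: continuous_in_subspaceT => t; rewrite inE /= in_itv /= => t01.
  apply: differentiable_continuous; apply/derivable1_diffP.
  by have [] := gd _ t01.
rewrite in_itv /= => /andP[t0 t1]; rewrite subr0 mulr1 /=.
have -> : cabs (f b - f a) = g 1 - g 0.
  rewrite /g cof1 cof0 mul1r mul0r addr0 subrKC.
  have : Rez (c * (f b - f a)) = cabs (f b - f a) by rewrite cE.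
  by move=> <-; move: c (f a) (f b) {cE c1 g g' gd} => [? ?] [? ?] [? ?] /=; ring.
move=> E; have xi01 : 0 <= xi <= 1 by rewrite !ltW.
have : g' xi <= V' xi.
  apply: le_trans (fV _ xi01); apply: le_trans (ler_norm _) _.
  by apply: le_trans (ler_Re_cabs _) _; rewrite !cabsM c1 mul1r.
by move: E; clear; lra.
Qed.

Lemma segment_square a r z w (t : R) : square a r z -> square a r w -> 0 <= t <= 1 ->
  square a r (z + cof t * (w - z)).
Proof.
case: a z w => [a1 a2] [x y] [p q]; rewrite /square /box /= => -[h1 h2] [h3 h4] t01.
by split; nra.
Qed.

Lemma lipschitz_square f a r M z w : 
  (forall z, square a r z -> derivable f z 1) ->
  (forall z, square a r z -> cabs (derive1 f z) <= M) ->
  square a r z -> square a r w -> cabs (f w - f z) <= M * cabs (w - z).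
Proof.
move=> fh fM sz sw.
have := @path_growth f z w (fun t => M * cabs (w - z) * t) (fun=> M * cabs (w - z)).
rewrite mulr1 mulr0 subr0; apply => t t01.
- by apply: fh; exact: segment_square.
- apply: is_derive_eps => e e0; exists 1 => // s _.
  rewrite (_ : _ - _ - _ = 0); last by ring.
  by rewrite normr0 mulr_ge0// ltW.
- by rewrite ler_wpM2r ?cabs_ge0// fM//; exact: segment_square.
Qed.

(** Boundedness passes from four quarters to their union by taking a maximum, so [bisection]
    applies. The set [D] allows the estimate to be localised on a disc inside the square. *)
Lemma locally_bounded_square (D : set C) (u : C -> R) a r : 0 <= r ->
  (forall z, square a r z -> exists2 e, 0 < e & exists K, forall h, cabs h < e ->
     D (z + h) -> u (z + h) <= K) ->
  exists K, forall z, square a r z -> D z -> u z <= K.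
Proof.
move=> r0 loc.
have := @bisection R (fun x y w h : R => exists K, forall z, x <= Rez z <= x + w ->
  y <= Imz z <= y + h -> D z -> u z <= K) (Rez a - r) (Imz a - r) (r + r) (r + r).
have E (s : R) : s - r + (r + r) = s + r by ring.
rewrite !E => H; case: H; [lra|lra| | |by move=> K HK; exists K => z [h1 h2]; exact: HK].
  move=> x y w h w0 h0 [K1 H1] [K2 H2] [K3 H3] [K4 H4].
  exists (Num.max (Num.max K1 K2) (Num.max K3 K4)) => z hx hy Dz.
  rewrite !le_max.
  have [x1|x1] := leP (Rez z) (x + w); have [y1|y1] := leP (Imz z) (y + h).
  - by rewrite H1 ?orbT//; lra.
  - by rewrite H3 ?orbT//; lra.
  - by rewrite H2 ?orbT//; lra.
  - by rewrite H4 ?orbT//; lra.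
move=> x y hx hy; have [//|e e0 [K HK]] := loc (mkC (x, y)).
exists (e / 2); first exact: divr_gt0.
move=> x' y' w h /andP[w0 we] /andP[h0 he] xx yy; exists K => z zx zy Dz.
have -> : z = mkC (x, y) + mkC (Rez z - x, Imz z - y) by rewrite -mkCD !subrKC mkCE.
apply: HK; last by rewrite -mkCD !subrKC mkCE.
apply: le_lt_trans (cabs_mkC_le _ _) _.
have : `|Rez z - x| <= w by rewrite ler_norml; lra.
have : `|Imz z - y| <= h by rewrite ler_norml; lra.
lra.
Qed.

Lemma ccts_bounded_square f a r : 0 <= r -> (forall z, square a r z -> ccts f z) ->
  exists K, forall z, square a r z -> cabs (f z) <= K.
Proof.
move=> r0 fc; have [z sz|K HK] := @locally_bounded_square setT (fun z => cabs (f z)) a r r0.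
  have [k k0 H] := fc _ sz _ ltr01; exists k => //.
  exists (cabs (f z) + 1) => h hk _.
  by rewrite -lerBlDl; apply: le_trans (H _ hk); exact: cabs_sub.
by exists K => z sz; exact: HK.
Qed.

Lemma ccts_bounded_disc f rho : (forall z, cabs z <= rho -> ccts f z) ->
  exists K, forall z, cabs z <= rho -> cabs (f z) <= K.
Proof.
have [rho0|rho0] := ltP rho 0; first by exists 0 => z /le_lt_trans/(_ rho0); rewrite ltNge cabs_ge0.
move=> fc; have [z _|K HK] := @locally_bounded_square [set z | cabs z <= rho]
    (fun z => cabs (f z)) 0 rho rho0.
  have [zr|zr] := leP (cabs z) rho.
    have [k k0 H] := fc _ zr _ ltr01; exists k => //.
    exists (cabs (f z) + 1) => h hk _.
    by rewrite -lerBlDl; apply: le_trans (H _ hk); exact: cabs_sub.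
  (* Close to a point outside the closed disc there is nothing to bound. *)
  exists (cabs z - rho); first by rewrite subr_gt0.
  exists 0 => h hz /= zh; have := cabs_sub z (- h); rewrite opprK cabsN.
  by move: hz zh; clear; lra.
exists K => z zr; apply: HK => //.
by apply: cabs_square; rewrite subr0.
Qed.

End CauchyEstimates.

(** * Mean value inequalities for area integrals *)

Section Integrals.
Variable R : realType.
Local Notation C := (Cplx R).
Local Notation mT := (measurableTypeR R).

(** Such an integral is a supremum over the simple functions below the restricted integrand, so a
    pointwise comparison suffices. This is how integrands with the Green function are handled: they
    are only compared with measurable ones. *)
Lemma ge0_le_integral_set d (T : measurableType d) (m : {measure set T -> \bar R})
    (A B : set T) (f g : T -> \bar R) : A `<=` B ->
  (forall x, A x -> (0 <= f x)%E) -> (forall x, B x -> (0 <= g x)%E) ->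
  (forall x, A x -> (f x <= g x)%E) -> (\int[m]_(x in A) f x <= \int[m]_(x in B) g x)%E.
Proof.
move=> AB f0 g0 fg; rewrite !ge0_integralE//.
apply: ge_ereal_sup => _ [h hf <-]; apply: ereal_sup_ubound; exists h => // x.
apply: le_trans (hf x) _; rewrite /patch.
case: ifPn => [/set_mem xA|xA]; first by rewrite mem_set ?fg//; exact: AB.
by case: ifPn => [/set_mem|//]; exact: g0.
Qed.

Definition nbox (w : mT * mT) (r : R) : set (mT * mT) :=
  [set v | `|v.1 - w.1| < r /\ `|v.2 - w.2| < r].

Lemma measurable_nbox w r : measurable (nbox w r).
Proof.
have -> : nbox w r = [set x : mT | `|x - w.1| < r] `*` [set x : mT | `|x - w.2| < r].
  by apply/seteqP; split.
have ms (c : R) : measurable [set x : mT | `|x - c| < r].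
  have -> : [set x : mT | `|x - c| < r] = `]c - r, c + r[%classic.
    by apply/seteqP; split => x /=; rewrite in_itv /= ltr_norml => h; lra.
  exact: measurable_itv.
exact: measurableX.
Qed.

(** The sigma-algebra is that of the product, so an open set is written as the countable union of
    the boxes with rational centre and radius [1 / (n + 1)] that it contains. *)
Lemma open2_measurable (O : set (mT * mT)) :
  (forall w, O w -> exists2 e : R, 0 < e & nbox w e `<=` O) -> measurable O.
Proof.
move=> Oo.
pose F (q : rat * rat * nat) : set (mT * mT) :=
  if `[< nbox (ratr q.1.1, ratr q.1.2) (q.2.+1%:R^-1) `<=` O >] then
    nbox (ratr q.1.1, ratr q.1.2) (q.2.+1%:R^-1) else set0.
pose B (n : nat) := if unpickle n is Some q then F q else set0.
have BF q : B (pickle q) = F q by rewrite /B pickleK.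
have -> : O = \bigcup_n B n.
  apply/seteqP; split => w; last first.
    move=> [n _]; rewrite /B; case: (unpickle n) => [q|//].
    by rewrite /F; case: ifPn => [/asboolP|//] sub; exact: sub.
  move=> /Oo[e e0 eO].
  have [n nP] : exists n : nat, 2 * n.+1%:R^-1 < e.
    exists (Num.truncn (2 / e)); have := truncnS_gt (2 / e).
    by rewrite ltr_pdivrMr// => h; rewrite ltr_pdivrMr// mulrC.
  have r0 : 0 < n.+1%:R^-1 :> R by rewrite invr_gt0.
  have near (c r : R) : 0 < r -> exists q : rat, `|c - ratr q| < r.
    move=> rr0; have [|q] := @rat_in_itvoo R (c - r) (c + r); first by lra.
    by rewrite in_itv /= => h; exists q; rewrite ltr_norml; lra.
  have [q1 h1] := near w.1 _ r0; have [q2 h2] := near w.2 _ r0.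
  exists (pickle (q1, q2, n)); first exact: I.
  rewrite BF /F; case: ifPn => [_|/asboolPn[]]; first by split.
  move=> v [v1 v2]; apply: eO; split => /=.
    by move: (n.+1%:R^-1) nP v1 h1 => r nP; rewrite !ltr_norml /=; lra.
  by move: (n.+1%:R^-1) nP v2 h2 => r nP; rewrite !ltr_norml /=; lra.
apply: bigcupT_measurable => n; rewrite /B; case: (unpickle n) => [q|//].
by rewrite /F; case: ifP => _ //; exact: measurable_nbox.
Qed.

Lemma continuous2_measurable (D : set (mT * mT)) (u : mT * mT -> R) : measurable D ->
  (forall w, D w -> forall e, 0 < e -> exists2 r : R, 0 < r & forall v, nbox w r v -> `|u v - u w| < e) ->
  measurable_fun D u.
Proof.
move=> mD uc _; apply: (measurability _ (RGenOInfty.measurableE R)) => //.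
move=> _ [_ [c ->] <-].
(* [O] is the interior of [{u > c}]; it is open by construction and, by continuity, has the same
   trace on [D]. *)
pose O : set (mT * mT) := [set w | exists2 e : R, 0 < e & nbox w e `<=` [set v | c < u v]].
have -> : D `&` u @^-1` `]c, +oo[ = D `&` O.
  apply/seteqP; split => w [Dw] /=; rewrite in_itv /= andbT.
    move=> cu; split => //; have [r r0 H] := uc _ Dw (u w - c) ltac:(by rewrite subr_gt0).
    by exists r => // v /H; rewrite ltr_norml /=; lra.
  by move=> [e e0 H]; split => //; apply: H; split; rewrite subrr normr0.
apply: measurableI => //; apply: open2_measurable => w [e e0 H].
exists (e / 2); first exact: divr_gt0.
move=> v [v1 v2]; exists (e / 2); first exact: divr_gt0.
move=> x [x1 x2]; apply: H; split.
  by move: v1 x1; rewrite !ltr_norml; lra.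
by move: v2 x2; rewrite !ltr_norml; lra.
Qed.

Lemma ccts_measurable (D : set (mT * mT)) (f : C -> C) : measurable D ->
  (forall w, D w -> ccts f (mkC w)) -> measurable_fun D (fun w => cabs (f (mkC w))).
Proof.
move=> mD fc; apply: continuous2_measurable => // w Dw e e0.
have [r r0 H] := fc _ Dw _ (divr_gt0 e0 (ltr0n _ 2)).
exists (r / 2); first exact: divr_gt0.
move=> v [v1 v2]; have := H (mkC (v.1 - w.1, v.2 - w.2)).
have -> : mkC w + mkC (v.1 - w.1, v.2 - w.2) = mkC v.
  by case: (v) (w) => [? ?] [? ?]; rewrite -mkCD /= !subrKC.
have hr : cabs (mkC (v.1 - w.1, v.2 - w.2)) < r.
  by apply: le_lt_trans (cabs_mkC_le _ _) _; move: v1 v2; lra.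
move=> /(_ hr) {}H; apply: (@le_lt_trans _ _ (e / 2)); last first.
  by rewrite ltr_pdivrMr// ltr_pMr// ltr1n.
apply: le_trans H; rewrite ler_norml; apply/andP; split; last by rewrite cabs_sub.
by rewrite lerNl opprB cabsBC cabs_sub.
Qed.

Definition mu2 := (@lebesgue_measure R \x @lebesgue_measure R)%E.

Definition rect (x1 x2 y1 y2 : R) : set (mT * mT) := `[x1, x2]%classic `*` `[y1, y2]%classic.

Lemma measurable_rect x1 x2 y1 y2 : measurable (rect x1 x2 y1 y2).
Proof. by apply: measurableX; exact: measurable_itv. Qed.

Lemma rectE x1 x2 y1 y2 (w : R * R) : rect x1 x2 y1 y2 w <-> box x1 x2 y1 y2 (mkC w).
Proof. by rewrite /rect /box /= !in_itv. Qed.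

Section Strip.
Variables (f : C -> C) (x1 x2 y1 y2 k : R).
Hypothesis fc : forall z, box x1 x2 y1 y2 z -> ccts f z.

Let g (w : mT * mT) : \bar R := (((fun w => (cabs (f (mkC w)))%:E) \_ (rect x1 x2 y1 y2)) w).

Let mg : measurable_fun setT g.
Proof.
apply/(measurable_restrictT _ (measurable_rect _ _ _ _)); apply/measurable_EFinP.
apply: ccts_measurable; first exact: measurable_rect.
by move=> w /rectE; exact: fc.
Qed.

Let g0 w : (0 <= g w)%E.
Proof. by rewrite /g /patch; case: ifP => // _; rewrite lee_fin cabs_ge0. Qed.

Lemma itgE (u : R -> R) a b : ctson u a b ->
  (itg u a b)%:E = (\int[@lebesgue_measure R]_(t in `[a, b]) (u t)%:E)%E.
Proof.
move=> cu; rewrite /itg /Rintegral fineK//.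
exact: (integrable_fin_num _ (ctson_integrable cu)).
Qed.

Lemma vstrip_mean : 0 <= k -> x1 <= x2 ->
  (forall x, x1 <= x <= x2 -> k <= itg (fun t => cabs (f (mkC (x, t)))) y1 y2) ->
  ((k * (x2 - x1))%:E <= \int[mu2]_(w in rect x1 x2 y1 y2) (cabs (f (mkC w)))%:E)%E.
Proof.
move=> k0 x12 kf.
have -> : (\int[mu2]_(w in rect x1 x2 y1 y2) (cabs (f (mkC w)))%:E = \int[mu2]_w g w)%E.
  by rewrite integral_mkcond.
rewrite /mu2 fubini_tonelli1//.
apply: (@le_trans _ _ (\int[@lebesgue_measure R]_(x in `[x1, x2]) (cst k%:E x))%E).
  rewrite integral_cst//= lebesgue_measure_itv/= lte_fin.
  have [ab'|ba] := ltP x1 x2; first by rewrite -EFinD -EFinM.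
  by rewrite (_ : x2 = x1) ?subrr ?mulr0 ?mule0//; apply/le_anti; rewrite ba.
apply: ge0_le_integral_set => //.
  by move=> x _; apply: integral_ge0 => y _; exact: g0.
move=> x; rewrite /= in_itv /= => xx; apply: (@le_trans _ _ (itg (fun t => cabs (f (mkC (x, t)))) y1 y2)%:E).
  by rewrite lee_fin; exact: kf.
rewrite itgE; last by move=> t tt; apply: ccts_slice2; apply: fc; split.
rewrite integral_mkcond; apply: ge0_le_integral_set => // y _.
  by rewrite /patch; case: ifP => // _; rewrite lee_fin cabs_ge0.
rewrite /g /patch; case: ifPn => [/set_mem yy|_]; last exact: g0.
by rewrite mem_set//; split => //=; rewrite in_itv.
Qed.

Lemma hstrip_mean : 0 <= k -> y1 <= y2 ->
  (forall y, y1 <= y <= y2 -> k <= itg (fun t => cabs (f (mkC (t, y)))) x1 x2) ->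
  ((k * (y2 - y1))%:E <= \int[mu2]_(w in rect x1 x2 y1 y2) (cabs (f (mkC w)))%:E)%E.
Proof.
move=> k0 x12 kf.
have -> : (\int[mu2]_(w in rect x1 x2 y1 y2) (cabs (f (mkC w)))%:E = \int[mu2]_w g w)%E.
  by rewrite integral_mkcond.
rewrite /mu2 fubini_tonelli2//.
apply: (@le_trans _ _ (\int[@lebesgue_measure R]_(x in `[y1, y2]) (cst k%:E x))%E).
  rewrite integral_cst//= lebesgue_measure_itv/= lte_fin.
  have [ab'|ba] := ltP y1 y2; first by rewrite -EFinD -EFinM.
  by rewrite (_ : y2 = y1) ?subrr ?mulr0 ?mule0//; apply/le_anti; rewrite ba.
apply: ge0_le_integral_set => //.
  by move=> x _; apply: integral_ge0 => y _; exact: g0.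
move=> x; rewrite /= in_itv /= => xx; apply: (@le_trans _ _ (itg (fun t => cabs (f (mkC (t, x)))) x1 x2)%:E).
  by rewrite lee_fin; exact: kf.
rewrite itgE; last by move=> t tt; apply: ccts_slice1; apply: fc; split.
rewrite integral_mkcond; apply: ge0_le_integral_set => // y _.
  by rewrite /patch; case: ifP => // _; rewrite lee_fin cabs_ge0.
rewrite /g /patch; case: ifPn => [/set_mem yy|_]; last exact: g0.
by rewrite mem_set//; split => //=; rewrite in_itv.
Qed.

End Strip.

Lemma inf_witness (P : R -> Prop) (u : R -> R) : (exists x, P x) -> (forall x, 0 <= u x) ->
  exists2 k, 0 <= k & (forall x, P x -> k <= u x) /\ forall c, (forall x, P x -> c <= u x) -> c <= k.
Proof.
move=> [x0 Px0] u0; pose S := [set u x | x in P].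
have Sn : S !=set0 by exists (u x0); exists x0.
have hS : has_inf S by split => //; exists 0 => _ [x _ <-].
exists (inf S); first by apply: lb_le_inf => // _ [x _ <-].
split=> [x Px|c cu]; first by apply: ge_inf; [case: hS|exists x].
by apply: lb_le_inf => // _ [x Px <-]; exact: cu.
Qed.

(** The centre is removed because the totalised Green function is [0] at its pole, where its lower
    bound would fail. *)
Definition ring2 (a : C) (r : R) : set (mT * mT) :=
  [set w | square a r (mkC w) /\ mkC w != a].

(* Moving the four sides of the square independently and averaging [box_mean]
   over their positions bounds [F a] by an area integral. *)
Lemma area_mean (F : C -> C) (a : C) (r : R) : 0 < r ->
  (forall z, square a r z -> derivable F z 1) ->
  ((r ^+ 2 * cabs (F a))%:E <= 4%:E * \int[mu2]_(w in ring2 a r) (cabs (F (mkC w)))%:E)%E.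
Proof.
case: a => a1 a2 r0 Fh; set a : C := Complex a1 a2.
have Fc z : square a r z -> ccts F z by move=> /Fh/derivable_ccts.
pose X1 := a1 - r; pose X2 := a1 + r; pose Y1 := a2 - r; pose Y2 := a2 + r.
pose H (y : R) := itg (fun t => cabs (F (mkC (t, y)))) X1 X2.
pose V (x : R) := itg (fun t => cabs (F (mkC (x, t)))) Y1 Y2.
have H0 y : 0 <= H y by apply: Rintegral_ge0 => t _; exact: cabs_ge0.
have V0 y : 0 <= V y by apply: Rintegral_ge0 => t _; exact: cabs_ge0.
have cH y : Y1 <= y <= Y2 -> ctson (fun t => cabs (F (mkC (t, y)))) X1 X2.
  by move=> yy t tt; apply: ccts_slice1; apply: Fc; split.
have cV x : X1 <= x <= X2 -> ctson (fun t => cabs (F (mkC (x, t)))) Y1 Y2.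
  by move=> xx t tt; apply: ccts_slice2; apply: Fc; split.
have itgS (u : R -> R) p q p' q' : ctson u p q -> (forall t, 0 <= u t) -> p <= p' -> p' <= q' -> q' <= q ->
    itg u p' q' <= itg u p q.
  move=> cu u0 pp pq qq; rewrite (itg_split pp _ cu); last exact: le_trans qq.
  have cu' : ctson u p' q by apply: ctson_sub cu _ _.
  rewrite (itg_split pq qq cu').
  have : 0 <= itg u p p' by apply: Rintegral_ge0.
  have : 0 <= itg u q' q by apply: Rintegral_ge0.
  by clear; lra.
(* Each side moves in a band at distance between [r / 2] and [r] from the centre; [k1], ..., [k4]
   are the infima of the four side integrals over these bands. *)
have [k1 k10 [kH1 kk1]] := @inf_witness [set y | Y1 <= y <= a2 - r / 2] H
  ltac:(by exists Y1; rewrite /Y1 /=; lra) H0.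
have [k2 k20 [kH2 kk2]] := @inf_witness [set y | a2 + r / 2 <= y <= Y2] H
  ltac:(by exists Y2; rewrite /Y2 /=; lra) H0.
have [k3 k30 [kV3 kk3]] := @inf_witness [set y | X1 <= y <= a1 - r / 2] V
  ltac:(by exists X1; rewrite /X1 /=; lra) V0.
have [k4 k40 [kV4 kk4]] := @inf_witness [set y | a1 + r / 2 <= y <= X2] V
  ltac:(by exists X2; rewrite /X2 /=; lra) V0.
have key y1 y2 x1 x2 : Y1 <= y1 <= a2 - r / 2 -> a2 + r / 2 <= y2 <= Y2 ->
    X1 <= x1 <= a1 - r / 2 -> a1 + r / 2 <= x2 <= X2 ->
    4 * (cabs (F a) * (r / 2)) <= H y1 + H y2 + V x1 + V x2.
  move=> hy1 hy2 hx1 hx2; have r20 : 0 < r / 2 by rewrite divr_gt0.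
  have sub z : box x1 x2 y1 y2 z -> square a r z.
    by rewrite /X1 /X2 /Y1 /Y2 in hy1 hy2 hx1 hx2; move=> [h1 h2]; split; rewrite /=; lra.
  have [x1m y1m] : x1 <= a1 - r / 2 /\ y1 <= a2 - r / 2 by clear - hx1 hy1; split; lra.
  have [x2m y2m] : a1 + r / 2 <= x2 /\ a2 + r / 2 <= y2 by clear - hx2 hy2; split; lra.
  have aa : square a r a by apply: square_center; exact: ltW.
  have B := @box_mean _ F a (r / 2) x1 x2 y1 y2 r20 x1m x2m y1m y2m (fun z bz _ => Fh z (sub z bz)) (Fc _ aa).
  apply: le_trans B _.
  have [h1 h2 h3] : [/\ X1 <= x1, x1 <= x2 & x2 <= X2] by rewrite /X1 /X2 in hx1 hx2 *; split; lra.
  have [g1 g2 g3] : [/\ Y1 <= y1, y1 <= y2 & y2 <= Y2] by rewrite /Y1 /Y2 in hy1 hy2 *; split; lra.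
  have yy1 : Y1 <= y1 <= Y2 by rewrite g1 (le_trans g2).
  have yy2 : Y1 <= y2 <= Y2 by rewrite g3 (le_trans g1).
  have xx1 : X1 <= x1 <= X2 by rewrite h1 (le_trans h2).
  have xx2 : X1 <= x2 <= X2 by rewrite h3 (le_trans h1).
  by rewrite /H /V; apply: lerD; [apply: lerD; [apply: lerD|]|];
     apply: itgS => //; try (by move=> t; exact: cabs_ge0);
     [exact: cH|exact: cH|exact: cV|exact: cV].
(* The positions are independent, so the side integrals can be replaced by their infima one at a
   time. *)
have tot : 2 * r * cabs (F a) <= k1 + k2 + k3 + k4.
  suff : 2 * r * cabs (F a) - (k1 + k2 + k3) <= k4 by clear; lra.
  apply: kk4 => x2 hx2; suff : 2 * r * cabs (F a) - (k1 + k2 + V x2) <= k3 by clear; lra.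
  apply: kk3 => x1 hx1; suff : 2 * r * cabs (F a) - (k1 + V x1 + V x2) <= k2 by clear; lra.
  apply: kk2 => y2 hy2; suff : 2 * r * cabs (F a) - (H y2 + V x1 + V x2) <= k1 by clear; lra.
  apply: kk1 => y1 hy1; have := key _ _ _ _ hy1 hy2 hx1 hx2; clear; lra.
have sub p q s t : X1 <= p -> q <= X2 -> Y1 <= s -> t <= Y2 ->
    p > a1 \/ q < a1 \/ s > a2 \/ t < a2 -> rect p q s t `<=` ring2 a r.
  rewrite /X1 /X2 /Y1 /Y2 => h1 h2 h3 h4 h [x y] [/=]; rewrite !in_itv /= => hx hy.
  split; first by split => /=; lra.
  by apply/eqP => -[xa ya]; move: h hx hy; rewrite xa ya; lra.
set I := (\int[mu2]_(w in ring2 a r) _)%E.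
have rI p q s t : rect p q s t `<=` ring2 a r ->
    (\int[mu2]_(w in rect p q s t) (cabs (F (mkC w)))%:E <= I)%E.
  by move=> ss; apply: ge0_le_integral_set => // w _; rewrite lee_fin cabs_ge0.
have bc p q s t : X1 <= p -> q <= X2 -> Y1 <= s -> t <= Y2 ->
    forall z, box p q s t z -> ccts F z.
  rewrite /X1 /X2 /Y1 /Y2 => h1 h2 h3 h4 z [h5 h6]; apply: Fc; split => /=; lra.
have J1 : ((k1 * (r / 2))%:E <= I)%E.
  apply: le_trans (rI X1 X2 Y1 (a2 - r / 2) _); last first.
    by apply: sub; rewrite /X1 /X2 /Y1 /Y2; [lra|lra|lra|lra|right; right; right; lra].
  have := @hstrip_mean F X1 X2 Y1 (a2 - r / 2) k1.
  rewrite (_ : a2 - r / 2 - Y1 = r / 2); last by rewrite /Y1; field.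
  by apply; [apply: bc; rewrite /X1 /X2 /Y1 /Y2; lra|by []|rewrite /Y1; lra|exact: kH1].
have J2 : ((k2 * (r / 2))%:E <= I)%E.
  apply: le_trans (rI X1 X2 (a2 + r / 2) Y2 _); last first.
    by apply: sub; rewrite /X1 /X2 /Y1 /Y2; [lra|lra|lra|lra|right; right; left; lra].
  have := @hstrip_mean F X1 X2 (a2 + r / 2) Y2 k2.
  rewrite (_ : Y2 - (a2 + r / 2) = r / 2); last by rewrite /Y2; field.
  by apply; [apply: bc; rewrite /X1 /X2 /Y1 /Y2; lra|by []|rewrite /Y2; lra|exact: kH2].
have J3 : ((k3 * (r / 2))%:E <= I)%E.
  apply: le_trans (rI X1 (a1 - r / 2) Y1 Y2 _); last first.
    by apply: sub; rewrite /X1 /X2 /Y1 /Y2; [lra|lra|lra|lra|right; left; lra].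
  have := @vstrip_mean F X1 (a1 - r / 2) Y1 Y2 k3.
  rewrite (_ : a1 - r / 2 - X1 = r / 2); last by rewrite /X1; field.
  by apply; [apply: bc; rewrite /X1 /X2 /Y1 /Y2; lra|by []|rewrite /X1; lra|exact: kV3].
have J4 : ((k4 * (r / 2))%:E <= I)%E.
  apply: le_trans (rI (a1 + r / 2) X2 Y1 Y2 _); last first.
    by apply: sub; rewrite /X1 /X2 /Y1 /Y2; [lra|lra|lra|lra|left; lra].
  have := @vstrip_mean F (a1 + r / 2) X2 Y1 Y2 k4.
  rewrite (_ : X2 - (a1 + r / 2) = r / 2); last by rewrite /X2; field.
  by apply; [apply: bc; rewrite /X1 /X2 /Y1 /Y2; lra|by []|rewrite /X2; lra|exact: kV4].
(* Each band has width [r / 2] and lies in [ring2 a r], so [k_i * (r / 2) <= I]; multiplying [tot]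
   by [r / 2] gives the left-hand side. *)
apply: (@le_trans _ _ (k1 * (r / 2) + k2 * (r / 2) + k3 * (r / 2) + k4 * (r / 2))%:E).
  by rewrite lee_fin; clear - tot r0; nra.
rewrite (_ : 4%:E = 1 + 1 + 1 + 1)%E; last by rewrite -!EFinD; congr (_%:E); ring.
have I0 : (0 <= I)%E by apply: integral_ge0 => w _; rewrite lee_fin cabs_ge0.
have o1 : (0 <= 1 :> \bar R)%E by [].
have o2 : (0 <= 1 + 1 :> \bar R)%E by rewrite adde_ge0.
have o3 : (0 <= 1 + 1 + 1 :> \bar R)%E by rewrite !adde_ge0.
rewrite (ge0_muleDl _ o3 o1) (ge0_muleDl _ o2 o1) (ge0_muleDl _ o1 o1) !mul1e !EFinD.
by rewrite !leeD.
Qed.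

End Integrals.

(** * The area mean value inequality for derivatives *)

Section DerivativeMean.
Variable R : realType.
Local Notation C := (Cplx R).
Implicit Types (f g : C -> C) (r : R) (z a h : C).
Local Notation Rez z := (complex.Re (z : R[i])).
Local Notation Imz z := (complex.Im (z : R[i])).
Local Notation mu2 := (@mu2 R).

Lemma cderivB f g z d d' : cderiv f z d -> cderiv g z d' -> cderiv (fun w => f w - g w) z (d - d').
Proof.
move=> fd gd e e0; have e20 : 0 < e / 2 by rewrite divr_gt0.
have [r r0 H1] := fd _ e20; have [s s0 H2] := gd _ e20.
exists (Num.min r s); first by rewrite lt_min r0.
move=> h; rewrite lt_min => /andP[/H1 {}H1 /H2 {}H2].
have -> : f (z + h) - g (z + h) - (f z - g z) - (d - d') * h =
  (f (z + h) - f z - d * h) - (g (z + h) - g z - d' * h) by ring.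
by apply: le_trans (cabsB _ _) _; move: H1 H2; lra.
Qed.

Lemma cderiv_shift f z h d : cderiv f (z + h) d -> cderiv (fun w => f (w + h)) z d.
Proof.
move=> fd e e0; have [r r0 H] := fd _ e0; exists r => // k /H.
by rewrite [z + k + h]addrAC.
Qed.

Lemma cderiv_mull (c : C) z : cderiv (fun w => c * w) z c.
Proof.
move=> e e0; exists 1 => // h _; rewrite (_ : _ - _ - _ = 0); last by ring.
rewrite cabs0.
by rewrite mulr_ge0 ?cabs_ge0// ltW.
Qed.

(** For fixed [h] the function [f (w + h) - f w] is holomorphic and of size at most a constant times
    [|h|] by the mean value inequality; Cauchy's estimate for it bounds [f'(z + h) - f'(z)]. The
    successive estimates use squares of half-sides [4 r], [8 r] and [16 r]. *)
Lemma deriv_lipschitz f a r : 0 < r ->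
  (forall z, square a (16 * r) z -> derivable f z 1) ->
  exists2 L, 0 <= L & forall z h, square a (4 * r) z -> square a (4 * r) (z + h) ->
    cabs (derive1 f (z + h) - derive1 f z) <= L * cabs h.
Proof.
move=> r0 fh.
have [||K HK] := @ccts_bounded_square _ f a (16 * r).
- by rewrite mulr_ge0// ltW.
- by move=> z /fh/derivable_ccts.
have r8 : 0 < 8 * r by rewrite mulr_gt0.
have r4 : 0 < 4 * r by rewrite mulr_gt0.
have K0 : 0 <= K by apply: le_trans (cabs_ge0 _) (HK a (square_center _ _)); rewrite mulr_ge0// ltW.
have s8 z : square a (8 * r) z -> square a (16 * r) z by apply: square_le; lra.
have L1 z : square a (8 * r) z -> cabs (derive1 f z) <= 4 * K / (8 * r).
  move=> sz; apply: cauchy_estimate => // w sw.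
    by apply: fh; have := square_trans sz sw; congr (square _ _ _); ring.
  by apply: HK; have := square_trans sz sw; congr (square _ _ _); ring.
exists (4 * (4 * K / (8 * r)) / (4 * r)).
  by rewrite !(divr_ge0, mulr_ge0)// ltW.
move=> z h sz szh.
have g8 w k : square a (4 * r) w -> square w (4 * r) k -> square a (8 * r) k.
  by move=> sw sk; have := square_trans sw sk; congr (square _ _ _); ring.
have sh w : square z (4 * r) w -> square (z + h) (4 * r) (w + h).
  by move=> /squareP sw; apply/squareP; rewrite opprD addrACA subrr addr0.
have gd w : square z (4 * r) w -> cderiv (fun w => f (w + h) - f w) w (derive1 f (w + h) - derive1 f w).
  move=> sw; apply: cderivB; last by apply: derivable_cderiv; apply: fh; apply: s8; exact: g8 sw.
  by apply: cderiv_shift; apply: derivable_cderiv; apply: fh; apply: s8; apply: g8 szh _; exact: sh.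
have zz : square z (4 * r) z by apply: square_center; exact: ltW.
rewrite -(cderiv_derive1 (gd _ zz)).
have -> : 4 * (4 * K / (8 * r)) / (4 * r) * cabs h = 4 * (4 * K / (8 * r) * cabs h) / (4 * r) by ring.
apply: cauchy_estimate => // w sw; first exact: cderiv_derivable (gd _ sw).
have := @lipschitz_square _ f a (8 * r) (4 * K / (8 * r)) w (w + h) (fun z sz => fh z (s8 z sz)) L1.
rewrite [w + h - w]addrC addKr; apply; first exact: g8 sw.
by apply: g8 szh _; exact: sh.
Qed.

Lemma deriv_ccts f a r : 0 < r -> (forall z, square a r z -> derivable f z 1) -> ccts (derive1 f) a.
Proof.
move=> r0 fh; have r16 : 0 < r / 16 by rewrite divr_gt0.
have [|L L0 HL] := @deriv_lipschitz f a (r / 16) r16.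
  move=> z; have -> : 16 * (r / 16) = r by field.
  exact: fh.
move=> e e0; have L1 : 0 < L + 1 by rewrite ltr_wpDl.
exists (Num.min (4 * (r / 16)) (e / (L + 1))).
  by rewrite lt_min mulr_gt0//= divr_gt0.
move=> h; rewrite lt_min ltr_pdivlMr// => /andP[hr he].
apply: le_trans (HL a h _ _) _.
- by apply: square_center; rewrite mulr_ge0// ltW.
- by apply: square_add; exact: ltW.
by have := cabs_ge0 h; nra.
Qed.

Lemma measurable_ring2 a r : measurable (ring2 a r).
Proof.
have -> : ring2 a r = rect (Rez a - r) (Rez a + r) (Imz a - r) (Imz a + r) `&` [set w | mkC w != a].
  by apply/seteqP; split => w [h1 h2]; split => //; apply/rectE.
apply: measurableI; first exact: measurable_rect.
apply: open2_measurable => w /= wa.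
have k0 : 0 < cabs (mkC w - a) by rewrite cabs_gt0// subr_eq0.
exists (cabs (mkC w - a) / 2); first by rewrite divr_gt0.
move=> v [v1 v2] /=; apply/eqP => va.
have := cabs_mkC_le (v.1 - w.1) (v.2 - w.2).
have -> : mkC (v.1 - w.1, v.2 - w.2) = a - mkC w by rewrite -va; case: (v) (w) => ? ? [? ?].
by rewrite cabsBC => h; move: v1 v2 h; clear; lra.
Qed.

Lemma mu2_ring2 a r : 0 < r -> (mu2 (ring2 a r) <= (4 * r ^+ 2)%:E)%E.
Proof.
move=> r0; apply: (@le_trans _ _ (mu2 (rect (Rez a - r) (Rez a + r) (Imz a - r) (Imz a + r)))).
  apply: le_measure; rewrite ?inE; [exact: measurable_ring2|exact: measurable_rect|].
  by move=> w [h _]; apply/rectE.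
rewrite /mu2 product_measure1E; [|exact: measurable_itv|exact: measurable_itv].
rewrite /= !lebesgue_measure_itv/= !lte_fin.
have E (s : R) : (s - r < s + r) = true by apply/idP; lra.
rewrite !E -!EFinD -EFinM lee_fin.
by apply: le_of_eq; ring.
Qed.

(** [area_mean] is applied to the difference quotient with real step [e], which differs from [f'] by
    at most [2 * L * e] on the square; then [e] tends to [0]. *)
Lemma deriv_area_mean f a r : 0 < r ->
  (forall z, square a (16 * r) z -> derivable f z 1) ->
  ((r ^+ 2 * cabs (derive1 f a))%:E <=
     4%:E * \int[mu2]_(w in ring2 a r) (cabs (derive1 f (mkC w)))%:E)%E.
Proof.
move=> r0 fh; have [L L0 HL] := deriv_lipschitz r0 fh.
have r160 : 0 < 16 * r by rewrite mulr_gt0.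
have aa s : 0 <= s -> square a s a by exact: square_center.
have fc z : square a r z -> ccts (derive1 f) z.
  move=> sz; apply: (@deriv_ccts f z (15 * r)); first by rewrite mulr_gt0.
  by move=> w sw; apply: fh; have := square_trans sz sw; congr (square _ _ _); ring.
have mf : measurable_fun (ring2 a r) (fun w => cabs (derive1 f (mkC w))).
  apply: ccts_measurable; first exact: measurable_ring2.
  by move=> w [/fc].
(* First-order Taylor remainder: the function [f w - f'(z) w] has derivative at most [2 * L * |h|]
   on the square of half-side [|h|] around [z]. *)
have dq z h : square a r z -> cabs h <= r ->
    cabs (f (z + h) - f z - derive1 f z * h) <= 2 * L * cabs h * cabs h.
  move=> sz hr.
  have sw w : square z (cabs h) w -> square a (2 * r) w.
    by move=> zw; apply: square_le (square_trans sz zw); lra.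
  have gd w : square z (cabs h) w -> cderiv (fun w => f w - derive1 f z * w) w (derive1 f w - derive1 f z).
    move=> zw; apply: cderivB; last exact: cderiv_mull.
    by apply: derivable_cderiv; apply: fh; apply: square_le (sw _ zw); lra.
  have := @lipschitz_square _ (fun w => f w - derive1 f z * w) z (cabs h) (2 * L * cabs h) z (z + h).
  rewrite [z + h - z]addrC addKr => H.
  have -> : f (z + h) - f z - derive1 f z * h =
    f (z + h) - derive1 f z * (z + h) - (f z - derive1 f z * z) by ring.
  apply: H; [by move=> w /gd/cderiv_derivable| |exact: square_center (cabs_ge0 _)|exact: square_add].
  move=> w zw; rewrite (cderiv_derive1 (gd _ zw)).
  have := HL z (w - z); rewrite subrKC => /(_ _ _)/le_trans; apply.
  - by apply: square_le sz; lra.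
  - by apply: square_le (sw _ zw); lra.
  have := square_cabs zw; have := cabs_ge0 h; nra.
set I := (\int[mu2]_(w in ring2 a r) _)%E.
have I0 : (0 <= I)%E by apply: integral_ge0 => w _; rewrite lee_fin cabs_ge0.
have key e : 0 < e -> e <= r ->
    ((r ^+ 2 * (cabs (derive1 f a) - 2 * L * e))%:E <= 4%:E * (I + (2 * L * e * (4 * r ^+ 2))%:E))%E.
  move=> e0 er; pose h : C := cof e.
  have he : cabs h = e by rewrite cabs_cof gtr0_norm.
  have h0 : h != 0 by apply: contraTneq e0 => E; rewrite -he E cabs0 ltxx.
  pose D w := (f (w + h) - f w) / h.
  have Dd z : square a r z -> cabs (D z - derive1 f z) <= 2 * L * e.
    move=> sz; have := dq z h sz; rewrite he => /(_ er).
    rewrite -ler_pdivrMr// -{1}he -cabsV -cabsM mulrBl mulfK//.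
  have Dh z : square a r z -> derivable D z 1.
    move=> sz; apply: derivableM; last exact: derivable_cst.
    apply: derivableB; last by apply: fh; apply: square_le sz; lra.
    apply: cderiv_derivable; apply: cderiv_shift; apply: derivable_cderiv; apply: fh.
    have hs : square z r (z + h) by apply: square_add; rewrite he.
    by apply: square_le (square_trans sz hs); lra.
  have := area_mean r0 Dh; set J := (\int[mu2]_(w in _) _)%E => AM.
  apply: (@le_trans _ _ (r ^+ 2 * cabs (D a))%:E).
    rewrite lee_fin ler_wpM2l ?sqr_ge0//.
    have := Dd _ (aa _ (ltW r0)); rewrite cabsBC.
    by have := cabs_sub (derive1 f a) (D a); lra.
  apply: le_trans AM _; apply: lee_wpmul2l => //.
  have Le0 : 0 <= 2 * L * e by rewrite !mulr_ge0// ltW.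
  apply: (@le_trans _ _ (\int[mu2]_(w in ring2 a r) ((cabs (derive1 f (mkC w)))%:E + (cst (2 * L * e)%:E) w))%E).
    apply: ge0_le_integral_set => // w; rewrite ?lee_fin ?cabs_ge0//.
      by move=> _; rewrite addr_ge0// cabs_ge0.
    move=> [sw _]; have := Dd _ sw; have := cabs_sub (D (mkC w)) (derive1 f (mkC w)).
    by clear; rewrite /=; lra.
  rewrite ge0_integralD//=; last 3 first.
  - exact: measurable_ring2.
  - by move=> w _; rewrite lee_fin cabs_ge0.
  - exact/measurable_EFinP.
  apply: leeD => //; rewrite integral_cst; last exact: measurable_ring2.
  by rewrite [leRHS]EFinM lee_wpmul2l ?lee_fin//; exact: mu2_ring2.
move: key I0; case: I => [I| |]// key I0; last by rewrite mulry gtr0_sg// mul1e leey.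
rewrite -EFinM lee_fin; apply/ler_addgt0Pl => e e0.
(* [c * e] collects all the error terms of [key]. *)
pose c := r ^+ 2 * (2 * L) + 4 * (2 * L * (4 * r ^+ 2)).
have r2 := sqr_ge0 r.
have c0 : 0 <= c by rewrite /c; clear - L0 r2; nra.
pose e' := Num.min r (e / (c + 1)).
have c1 : 0 < c + 1 by rewrite ltr_wpDl.
have e'0 : 0 < e' by rewrite lt_min r0 divr_gt0.
have e'r : e' <= r by rewrite ge_min lexx.
have ce : c * e' <= e.
  have : e' * (c + 1) <= e by rewrite -ler_pdivlMr// ge_min lexx orbT.
  by clear - e'0; lra.
have := key _ e'0 e'r; rewrite -EFinD -EFinM lee_fin => H.
by move: H ce; rewrite /c; clear; lra.
Qed.

End DerivativeMean.

(** * Growth of functions in the two spaces *)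

Section DiscEstimates.
Variable R : realType.
Local Notation C := (Cplx R).
Local Notation mT := (measurableTypeR R).
Implicit Types (f g : C -> C) (r : R) (z a h : C).
Local Notation mu2 := (@mu2 R).
Local Notation dA := (@dA R).
Local Notation disc := (@disc R).

Lemma cabs_conj a : cabs (conjc a) = cabs a.
Proof. by case: a => x y; rewrite /cabs /= sqrrN. Qed.

Lemma disc0 : disc 0.
Proof. by change (is_true (cabs (0 : C) < 1)); rewrite cabs0. Qed.

Lemma measurable_disc2 : measurable (@disc2 R).
Proof.
apply: open2_measurable => w wd; change (is_true (cabs (mkC w) < 1)) in wd.
have k0 : 0 < 1 - cabs (mkC w) by rewrite subr_gt0.
exists ((1 - cabs (mkC w)) / 2); first by rewrite divr_gt0.
move=> v [v1 v2]; change (is_true (cabs (mkC v) < 1)).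
have := cabs_mkC_le (v.1 - w.1) (v.2 - w.2).
have -> : mkC (v.1 - w.1, v.2 - w.2) = mkC v - mkC w by case: (v) (w) => ? ? [? ?].
have := cabs_sub (mkC v) (mkC w).
move: v1 v2; clear; lra.
Qed.

Lemma square_disc a z : disc a -> square a ((1 - cabs a) / 4) z ->
  cabs (z - a) <= (1 - cabs a) / 2 /\ disc z.
Proof.
rewrite /disc /= => a1 /square_cabs sz.
have za : cabs (z - a) <= (1 - cabs a) / 2 by move: sz; lra.
by split => //; have := cabs_sub z a; move: za a1; lra.
Qed.

Lemma integral_dA (A : set (mT * mT)) (f : mT * mT -> R) : measurable A ->
  measurable_fun A f -> (forall w, A w -> 0 <= f w) ->
  (\int[dA]_(w in A) (f w)%:E = (1 / pi)%:E * \int[mu2]_(w in A) (f w)%:E)%E.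
Proof.
move=> mA mf f0; rewrite /dA ge0_integral_mscale//.
exact/measurable_EFinP.
Qed.

Lemma integral_mu2_le (A : set (mT * mT)) (f : mT * mT -> R) (K : R) : measurable A ->
  measurable_fun A f -> (forall w, A w -> 0 <= f w) ->
  (\int[dA]_(w in A) (f w)%:E <= K%:E)%E -> (\int[mu2]_(w in A) (f w)%:E <= (pi * K)%:E)%E.
Proof.
move=> mA mf f0; rewrite integral_dA// div1r.
have p0 : 0 < pi^-1 :> R by rewrite invr_gt0 pi_gt0.
by rewrite [(pi * K)%:E]EFinM -[X in (X%:E * K%:E)%E]invrK lee_pdivlMl.
Qed.

(** Common form of the estimates in both spaces: [psi] is the power whose integral is controlled,
    and the linear bound on [|f'|] plays the part of Hölder's inequality. The term [al] is
    multiplied by the area bound [4 * r ^+ 2]. *)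
Lemma deriv_mean_bound f a r (al be I : R) (psi : R -> R) : 0 < r ->
  (forall z, square a (16 * r) z -> derivable f z 1) ->
  0 <= al -> 0 <= be -> measurable_fun setT psi ->
  (forall x, 0 <= psi x) ->
  (forall w, ring2 a r w -> cabs (derive1 f (mkC w)) <= al + be * psi (cabs (derive1 f (mkC w)))) ->
  (\int[mu2]_(w in ring2 a r) (psi (cabs (derive1 f (mkC w))))%:E <= I%:E)%E ->
  r ^+ 2 * cabs (derive1 f a) <= 4 * (al * (4 * r ^+ 2) + be * I).
Proof.
move=> r0 fh al0 be0 mpsi psi0 hpsi hI.
have mR := measurable_ring2 a r.
have mf : measurable_fun (ring2 a r) (fun w => cabs (derive1 f (mkC w))).
  apply: ccts_measurable => // w [sw _]; apply: (@deriv_ccts _ f _ (15 * r)); first by rewrite mulr_gt0.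
  by move=> z wz; apply: fh; have := square_trans sw wz; congr (square _ _ _); ring.
have mp : measurable_fun (ring2 a r) (fun w => psi (cabs (derive1 f (mkC w)))).
  exact: measurableT_comp mf.
have := deriv_area_mean r0 fh; set J := (\int[_]_(_ in _) _)%E => AM.
have JI : (J <= (al * (4 * r ^+ 2) + be * I)%:E)%E.
  apply: (@le_trans _ _ (\int[mu2]_(w in ring2 a r)
     ((cst al%:E) w + be%:E * (psi (cabs (derive1 f (mkC w))))%:E))%E).
    apply: ge0_le_integral_set => // w; rewrite ?lee_fin ?cabs_ge0//.
      by move=> _; rewrite addr_ge0// mulr_ge0.
  rewrite ge0_integralD//=.
  - rewrite EFinD leeD//.
      by rewrite integral_cst// EFinM lee_wpmul2l ?lee_fin//; exact: mu2_ring2.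
    rewrite ge0_integralZl_EFin//.
    + by rewrite EFinM lee_wpmul2l ?lee_fin.
    + by move=> w _; rewrite lee_fin.
    + exact/measurable_EFinP.
  - by move=> w _; rewrite -EFinM lee_fin mulr_ge0.
  - by apply/measurable_EFinP; exact: measurable_funM.
have := le_trans AM (lee_wpmul2l _ JI); rewrite -EFinM !lee_fin; exact.
Qed.

(* On the square of half-side [(1 - |a|) / 32] the Green function is at least
   [ln 2], so membership in [Qspace] controls the area integral of [|f'|^2]. *)
Lemma Qspace_bloch (s : R) f : 0 < s -> Qspace s f ->
  exists2 B, 0 <= B & forall z, disc z -> cabs (derive1 f z) * (1 - cabs z) <= B.
Proof.
move=> s0 [fh]; set S := [set int_disc _ | a in _] => Sfin.
have [K KP] : exists K : R, forall a, disc a ->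
   (int_disc (fun z => cabs (derive1 f z) ^+ 2 * green z a `^ s)%R <= K%:E)%E.
  have S0 : (0 <= ereal_sup S)%E.
    apply: (@le_trans _ _ (int_disc (fun z => (cabs (derive1 f z) ^+ 2 * green z 0 `^ s)%R))).
      by apply: integral_ge0 => w _; rewrite lee_fin mulr_ge0 ?powR_ge0// sqr_ge0.
    by apply: ereal_sup_ubound; exists 0 => //; exact: disc0.
  have Sf : ereal_sup S \is a fin_num by rewrite ge0_fin_numE.
  exists (fine (ereal_sup S)) => a da; rewrite fineK//.
  by apply: ereal_sup_ubound; exists a.
pose ka := ln 2 `^ s : R.
have ln2 : 0 < ln 2 :> R by rewrite ln_gt0// ltr1n.
have ka0 : 0 < ka by apply: powR_gt0.
have K0 : 0 <= K.
  rewrite -lee_fin; apply: le_trans (KP _ disc0).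
  by apply: integral_ge0 => w _; rewrite lee_fin mulr_ge0 ?powR_ge0// sqr_ge0.
pose K' := pi * (K / ka).
have K'0 : 0 <= K' by rewrite mulr_ge0 ?pi_ge0// divr_ge0// ltW.
exists (64 * (16 + 4 * K')); first by rewrite mulr_ge0// addr_ge0// mulr_ge0.
move=> a da; have d0 : 0 < 1 - cabs a by rewrite subr_gt0.
(* [16 * r] is then the half-side [(1 - |a|) / 4] for which [square_disc] keeps the square inside
   the disc. *)
pose r := (1 - cabs a) / 64.
have r0 : 0 < r by rewrite divr_gt0.
have sqd z : square a (16 * r) z -> cabs (z - a) <= (1 - cabs a) / 2 /\ disc z.
  by move=> sz; apply: square_disc => //; move: sz; congr (square _ _ _); rewrite /r; field.
have sqd1 z : square a r z -> cabs (z - a) <= (1 - cabs a) / 2 /\ disc z.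
  by move=> sz; apply: sqd; apply: square_le sz; move: r0; lra.
have mR := measurable_ring2 a r.
have mf : measurable_fun (ring2 a r) (fun w => cabs (derive1 f (mkC w))).
  apply: ccts_measurable => // w [sw _]; apply: (@deriv_ccts _ f _ (15 * r)); first by rewrite mulr_gt0.
  move=> z wz; apply: fh; apply: (proj2 (sqd z _)).
  by have := square_trans sw wz; congr (square _ _ _); ring.
have mf2 : measurable_fun (ring2 a r) (fun w => cabs (derive1 f (mkC w)) ^+ 2).
  by apply: measurable_funX.
have G w : ring2 a r w -> ka <= green (mkC w) a `^ s.
  move=> [sw wa]; have [wa2 wd] := sqd1 _ sw.
  have n0 : 0 < cabs (mkC w - a) by rewrite cabs_gt0// subr_eq0.
  have g2 : ln 2 <= green (mkC w) a.
    (* The numerator is at least [1 - |a|], and [|w - a| <= (1 - |a|) / 2]. *)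
    have h2 : 2 <= cabs ((1 - conjc a * mkC w) / (mkC w - a)).
      rewrite cabsM cabsV ler_pdivlMr//.
      have := cabs_sub 1 (conjc a * mkC w); rewrite cabs1 cabsM cabs_conj.
      have : cabs a * cabs (mkC w) <= cabs a by rewrite ler_piMr ?cabs_ge0// ltW.
      by move: wa2; clear; lra.
    by rewrite /green ler_ln ?posrE//; exact: lt_le_trans h2.
  apply: ge0_ler_powR => //; rewrite ?nnegrE ?ltW//.
  exact: lt_le_trans g2.
have I1 : (\int[mu2]_(w in ring2 a r) (cabs (derive1 f (mkC w)) ^+ 2)%:E <= K'%:E)%E.
  have H : (\int[dA]_(w in ring2 a r) (ka * cabs (derive1 f (mkC w)) ^+ 2)%:E <= K%:E)%E.
    apply: le_trans (KP _ da); apply: ge0_le_integral_set => [w [/sqd1[_ wd] _]//|w _|w _|w rw].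
    - by rewrite lee_fin mulr_ge0// ?sqr_ge0// ltW.
    - by rewrite lee_fin mulr_ge0 ?powR_ge0// sqr_ge0.
    - by rewrite lee_fin mulrC ler_wpM2l ?sqr_ge0// G.
  have := integral_mu2_le mR (measurable_funM (measurable_cst _) mf2) _ H.
  have h0 w : ring2 a r w -> 0 <= ka * cabs (derive1 f (mkC w)) ^+ 2.
    by move=> _; rewrite mulr_ge0// ?sqr_ge0// ltW.
  have -> : K'%:E = ((ka^-1)%:E * (pi * K)%:E)%E by rewrite -EFinM /K'; congr (_%:E); ring.
  move=> /(_ h0); rewrite lee_pdivlMl//.
  under eq_integral do rewrite EFinM.
  rewrite ge0_integralZl_EFin//; first by move=> w _; rewrite lee_fin sqr_ge0.
  - exact/measurable_EFinP.
  - exact: ltW.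
(* The bound [x <= 1 / r + r * x ^+ 2] has the right homogeneity: after it both terms carry one
   factor [r], leaving a bound for [r * |f'(a)|]. *)
have := @deriv_mean_bound f a r r^-1 r K' (fun x => x ^+ 2) r0 (fun z sz => fh _ (proj2 (sqd z sz))).
move=> H; have {H} : r ^+ 2 * cabs (derive1 f a) <= 4 * (r^-1 * (4 * r ^+ 2) + r * K').
  apply: H => //; rewrite ?invr_ge0 ?ltW//; first by move=> x; exact: sqr_ge0.
  move=> w _; set x := cabs _; rewrite -(ler_pM2l r0) mulrDr mulfV ?gt_eqF//.
  by rewrite mulrA -expr2 -exprMn; have := sqr_ge0 (r * x - 2^-1); clear; move: (r * x) => y; nra.
have -> : r^-1 * (4 * r ^+ 2) = 4 * r by field; rewrite gt_eqF.
move=> H; have : r * cabs (derive1 f a) <= 16 + 4 * K'.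
  by rewrite -(ler_pM2l r0); move: H; clear; lra.
by rewrite /r; lra.
Qed.

End DiscEstimates.

(** * Pointwise growth under Bloch and Dirichlet conditions *)

Section Growth.
Variable R : realType.
Local Notation C := (Cplx R).
Implicit Types (f g : C -> C) (r : R) (z a h : C).
Local Notation mu2 := (@mu2 R).
Local Notation dA := (@dA R).
Local Notation disc := (@disc R).

Lemma ler_powRn (x y q : R) : 0 < x -> x <= y -> 0 <= q -> y `^ (- q) <= x `^ (- q).
Proof.
move=> x0 xy q0; have y0 : 0 < y by exact: lt_le_trans xy.
rewrite !powRN lef_pV2 ?posrE ?powR_gt0//.
by apply: ge0_ler_powR => //; rewrite nnegrE ltW.
Qed.

Lemma cabs_cofM (t : R) z : 0 <= t -> cabs (cof t * z) = t * cabs z.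
Proof. by move=> t0; rewrite cabsM cabs_cof ger0_norm. Qed.

Lemma disc_scale (t : R) z : 0 <= t <= 1 -> disc z -> disc (cof t * z) /\ cabs (cof t * z) <= cabs z.
Proof.
move=> /andP[t0 t1] dz; suff zz : cabs (cof t * z) <= cabs z.
  by split => //; exact: le_lt_trans dz.
by rewrite cabs_cofM// ler_piMl// cabs_ge0.
Qed.

(** The derivative on the whole radius is majorised by its bound at the end point. No power is
    gained by integration, but only a finite exponent matters later. *)
Lemma power_growth f (c q : R) : Hol_disc f -> 0 <= c -> 0 <= q ->
  (forall z, disc z -> cabs (derive1 f z) <= c * (1 - cabs z) `^ (- q)) ->
  forall z, disc z -> cabs (f z) <= cabs (f 0) + c * (1 - cabs z) `^ (- q).
Proof.
move=> fh c0 q0 fq z dz; have z1 : 0 < 1 - cabs z by rewrite subr_gt0.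
pose M := c * (1 - cabs z) `^ (- q).
have M0 : 0 <= M by rewrite mulr_ge0 ?powR_ge0.
have := @path_growth _ f 0 z (fun t => M * t) (fun=> M).
rewrite mulr1 mulr0 !subr0 => H.
have {H} : cabs (f z - f 0) <= M.
  apply: H => t t01; rewrite ?add0r.
  - by apply: fh; have [] := disc_scale t01 dz.
  - apply: is_derive_eps => e e0; exists 1 => // s _.
    rewrite (_ : _ - _ - _ = 0); last by ring.
    by rewrite normr0 mulr_ge0// ltW.
  - have [d1 d2] := disc_scale t01 dz.
    apply: (@le_trans _ _ (cabs (derive1 f (cof t * z)))).
      by rewrite ler_piMr ?cabs_ge0// ltW.
    apply: le_trans (fq _ d1) _; apply: ler_wpM2l => //.
    by apply: ler_powRn => //; move: d2; lra.
by have := cabs_sub (f z) (f 0); rewrite /M; clear; lra.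
Qed.

Lemma bloch_growth f (B : R) : Hol_disc f -> 0 <= B ->
  (forall z, disc z -> cabs (derive1 f z) * (1 - cabs z) <= B) ->
  forall z, disc z -> cabs (f z) <= cabs (f 0) - B * ln (1 - cabs z).
Proof.
move=> fh B0 fB z dz; have z1 : 0 < 1 - cabs z by rewrite subr_gt0.
have zp := cabs_ge0 z.
have pos (t : R) : 0 <= t <= 1 -> 0 < 1 - t * cabs z.
  by move=> /andP[t0 t1]; have : t * cabs z <= cabs z; [rewrite ler_piMl|move: z1; lra].
have := @path_growth _ f 0 z (fun t => - B * ln (1 - t * cabs z))
  (fun t => B * cabs z / (1 - t * cabs z)).
rewrite mul1r mul0r !subr0 ln1 mulr0 subr0 => H.
have {H} : cabs (f z - f 0) <= - B * ln (1 - cabs z).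
  apply: H => t t01; rewrite ?add0r.
  - by apply: fh; have [] := disc_scale t01 dz.
  - have p := pos _ t01.
    have d1 : is_derive t 1 (fun s : R => 1 - s * cabs z) (- cabs z).
      apply: is_derive_eps => e e0; exists 1 => // s _.
      rewrite (_ : _ - _ - _ = 0); last by ring.
      by rewrite normr0 mulr_ge0// ltW.
    have d2 := is_derive1_ln p.
    have := is_deriveZ (- B) (@is_derive1_comp R (@ln R) (fun s : R => 1 - s * cabs z) t _ _ d2 d1).
    rewrite /GRing.scale /= => d3.
    by apply: is_derive_eq d3 _; ring.
  - have [d1 d2] := disc_scale t01 dz.
    have p := pos _ t01.
    rewrite ler_pdivlMr//; have := fB _ d1; case/andP: t01 => t0 _; rewrite cabs_cofM//.
    by rewrite mulrAC => h; apply: ler_wpM2r.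
have := cabs_sub (f z) (f 0); rewrite mulNr; clear; lra.
Qed.

(** The exponents exceed the natural [(p + 1) / p] unless [p = 1] forces a comparison at the level
    of [2]; what counts is that they depend on [p] alone. They come from the linear bounds of
    [deriv_mean_bound], which are not homogeneous when [p >= 1], and from replacing the weight by
    [1] when [p < 1]. *)
Lemma Dirichlet_deriv_growth (p : R) f : 0 < p -> Dirichlet p (p - 1) f ->
  exists2 c : R, 0 <= c & forall z, disc z ->
    cabs (derive1 f z) <= c * (1 - cabs z) `^ (- (if 1 <= p then p + 1 else 2 / p)).
Proof.
move=> p0 [fh]; set J := int_disc _ => Jfin.
have J0 : (0 <= J)%E by apply: integral_ge0 => w _; rewrite lee_fin mulr_ge0 ?powR_ge0.
have [K JK] : exists K : R, (J <= K%:E)%E.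
  by exists (fine J); rewrite fineK// ge0_fin_numE.
have K0 : 0 <= K by rewrite -lee_fin; exact: le_trans JK.
pose I := pi * K.
have I0 : 0 <= I by rewrite mulr_ge0 ?pi_ge0.
have fc w : disc w -> ccts (derive1 f) w.
  move=> dw; have d0 : 0 < (1 - cabs w) / 4 by rewrite divr_gt0// subr_gt0.
  by apply: deriv_ccts d0 _ => z /(square_disc dw)[_]; exact: fh.
(* A lower bound [ka] for the weight turns finiteness of the Dirichlet
   integral into a bound for the unweighted integral on a small square. *)
have loc a r (ka : R) : 0 < ka -> (forall z, square a r z -> disc z) ->
    (forall z, square a r z -> ka <= (1 - cabs z ^+ 2) `^ (p - 1)) ->
    (\int[mu2]_(w in ring2 a r) (cabs (derive1 f (mkC w)) `^ p)%:E <= (I / ka)%:E)%E.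
  move=> ka0 sd kaw; have mR := measurable_ring2 a r.
  have mf : measurable_fun (ring2 a r) (fun w => cabs (derive1 f (mkC w)) `^ p).
    apply: (measurableT_comp (measurable_powR p)).
    by apply: ccts_measurable => // w [sw _]; apply: fc; exact: sd.
  have H : (\int[dA]_(w in ring2 a r) (ka * cabs (derive1 f (mkC w)) `^ p)%:E <= K%:E)%E.
    apply: le_trans JK; apply: ge0_le_integral_set => [w [/sd]//|w _|w _|w [rw _]].
    - by rewrite lee_fin mulr_ge0 ?powR_ge0// ltW.
    - by rewrite lee_fin mulr_ge0 ?powR_ge0.
    - by rewrite lee_fin ler_wpM2r ?powR_ge0// kaw.
  have h0 w : ring2 a r w -> 0 <= ka * cabs (derive1 f (mkC w)) `^ p.
    by move=> _; rewrite mulr_ge0 ?powR_ge0// ltW.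
  have := integral_mu2_le mR (measurable_funM (measurable_cst _) mf) h0 H.
  have -> : (I / ka)%:E = ((ka^-1)%:E * (pi * K)%:E)%E by rewrite -EFinM /I; congr (_%:E); ring.
  rewrite lee_pdivlMl//.
  under eq_integral do rewrite EFinM.
  rewrite ge0_integralZl_EFin//; first by move=> w _; rewrite lee_fin powR_ge0.
  - exact/measurable_EFinP.
  - exact: ltW.
have [p1|p1] := leP 1 p.
  (* [x <= 1 + x ^ p] *)
  pose c := 16 + 4 * (64 ^+ 2) * (I * 2 `^ (p - 1)).
  have c0 : 0 <= c by have P2 := powR_ge0 2 (p - 1); rewrite addr_ge0// mulr_ge0// mulr_ge0.
  exists c => // a da; set d := 1 - cabs a.
  have d0 : 0 < d by rewrite subr_gt0.
  have d1 : d <= 1 by rewrite lerBlDr lerDl cabs_ge0.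
  pose r := d / 64; have r0 : 0 < r by rewrite divr_gt0.
  have sqd z : square a (16 * r) z -> cabs (z - a) <= (1 - cabs a) / 2 /\ disc z.
    by move=> sz; apply: square_disc => //; move: sz; congr (square _ _ _); rewrite /r /d; field.
  have sqd1 z : square a r z -> cabs (z - a) <= (1 - cabs a) / 2 /\ disc z.
    by move=> sz; apply: sqd; apply: square_le sz; move: r0; lra.
  have ka0 : 0 < (d / 2) `^ (p - 1) by rewrite powR_gt0// divr_gt0.
  have L := loc a r _ ka0 (fun z sz => proj2 (sqd1 z sz)).
  have {}L : (\int[mu2]_(w in ring2 a r) (cabs (derive1 f (mkC w)) `^ p)%:E <= (I / (d / 2) `^ (p - 1))%:E)%E.
    apply: L => z /sqd1[zd dz]; apply: ge0_ler_powR; rewrite ?nnegrE ?subr_ge0//.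
    - by rewrite divr_ge0// ltW.
    - by rewrite expr_le1// ?cabs_ge0// ltW.
    have zz : cabs z ^+ 2 <= cabs z by rewrite expr2 ler_piMr ?cabs_ge0// ltW.
    by have := cabs_sub z a; move: zz zd; rewrite /d; clear; lra.
  have := @deriv_mean_bound _ f a r 1 1 _ (fun x => x `^ p) r0 (fun z sz => fh _ (proj2 (sqd z sz)))
    ler01 ler01 (measurable_powR p) (fun x => powR_ge0 _ _) _ L.
  rewrite !mul1r => H; have {}H := H _; have {H} : r ^+ 2 * cabs (derive1 f a) <=
      4 * (4 * r ^+ 2 + I / (d / 2) `^ (p - 1)).
    apply: H => w _; rewrite ?mul1r; have [x1|x1] := leP (cabs (derive1 f (mkC w))) 1.
      by rewrite (le_trans x1)// lerDl powR_ge0.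
    by apply: (le_trans (le1r_powR (ltW x1) p1)); rewrite lerDr.
  have E : I / (d / 2) `^ (p - 1) = I * 2 `^ (p - 1) * d `^ (- (p + 1)) * d ^+ 2.
    have e1 : (d / 2) `^ (p - 1) = d `^ (p - 1) / 2 `^ (p - 1).
      rewrite powRM ?invr_ge0 ?ltW//; congr (_ * _).
      by rewrite -[in LHS](powR_inv1 (ler0n R 2)) -powRrM mulN1r powRN.
    have e2 : d `^ (- (p + 1)) * d ^+ 2 = (d `^ (p - 1))^-1.
      rewrite -(powR_mulrn 2 (ltW d0)) -powRD; last by rewrite (gt_eqF d0) implybT.
      by rewrite -powRN; congr (_ `^ _); ring.
    by rewrite -mulrA e2 e1 invf_div; ring.
  rewrite E => H.
  have D1 : 1 <= d `^ (- (p + 1)).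
    have := @ler_powRn d 1 (p + 1) d0 d1; rewrite powR1; apply.
    by move: p0; clear; lra.
  have r20 : 0 < r ^+ 2 by rewrite exprn_gt0.
  rewrite -(ler_pM2l r20); apply: le_trans H _.
  have d2 : d ^+ 2 = 64 ^+ 2 * r ^+ 2 by rewrite /r; field.
  rewrite d2 /c; move: D1 r20; move: (d `^ _) (r ^+ 2) (I * _) => D x y D1 x0.
  have : 16 * x <= 16 * (x * D) by rewrite ler_pM2l// ler_peMr// ltW.
  by clear; lra.
(* [p < 1]: the weight is at least [1].  Applying the mean value inequality to
   [x = x ^ p * x ^ (1 - p)] bounds [m := sup (r0 - |z|) ^ (2 / p) |f' z|] by
   a multiple of [m ^ (1 - p)], uniformly in [r0 < 1]. *)
pose cc := 4 * 64 ^+ 2 * 2 `^ (2 / p * (1 - p)) * I.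
have cc0 : 0 <= cc.
  by rewrite mulr_ge0// mulr_ge0 ?powR_ge0// mulr_ge0// exprn_ge0.
pose q := 2 / p; have q0 : 0 < q by rewrite divr_gt0.
have p10 : 0 <= 1 - p by rewrite subr_ge0 ltW.
suff key r0 z : r0 < 1 -> cabs z < r0 -> (r0 - cabs z) `^ q * cabs (derive1 f z) <= cc `^ p^-1.
  exists (cc `^ p^-1 * 2 `^ q); first by rewrite mulr_ge0 ?powR_ge0.
  move=> z dz; rewrite -/q; have d0 : 0 < 1 - cabs z by rewrite subr_gt0.
  (* [key] is used with [r0] half way between [|z|] and [1], at the price of the factor [2] to the
     power [q]. *)
  have E : ((1 + cabs z) / 2 - cabs z) `^ q = (1 - cabs z) `^ q / 2 `^ q.
    have -> : (1 + cabs z) / 2 - cabs z = (1 - cabs z) * 2^-1 by field.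
    rewrite powRM ?invr_ge0 ?(ltW d0)//; congr (_ * _).
    by rewrite -[in LHS](powR_inv1 (ler0n R 2)) -powRrM mulN1r powRN.
  have P1 : 0 < (1 - cabs z) `^ q by exact: powR_gt0.
  have P2 : 0 < 2 `^ q :> R by exact: powR_gt0.
  have h1 : (1 + cabs z) / 2 < 1 by move: d0; clear; lra.
  have h2 : cabs z < (1 + cabs z) / 2 by move: d0; clear; lra.
  have := key _ _ h1 h2; rewrite E powRN ler_pdivlMr// mulrAC ler_pdivrMr//.
  by rewrite [_ `^ q * cabs _]mulrC.
move=> r01; have [r00|r00] := leP r0 0.
  by move=> zr; have := cabs_ge0 z; move: zr r00; clear; lra.
have disr w : cabs w <= r0 -> disc w by move=> wr; exact: le_lt_trans r01.
(* Staying within radius [r0 < 1] makes the supremum finite, so that a power of it can be divided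
   out below. *)
have [M MP] := @ccts_bounded_disc _ (derive1 f) r0 (fun z zr => fc z (disr z zr)).
pose S := [set (r0 - cabs w) `^ q * cabs (derive1 f w) | w in [set w : C | cabs w < r0]].
have S0 : S !=set0.
  by exists ((r0 - cabs (0 : C)) `^ q * cabs (derive1 f 0)); exists 0 => //; rewrite /mkset cabs0.
have Sb : has_ubound S.
  exists (r0 `^ q * M) => _ [w wr <-].
  have M0 : 0 <= M by apply: le_trans (cabs_ge0 _) (MP w (ltW wr)).
  apply: ler_pM; rewrite ?powR_ge0 ?cabs_ge0//; last by apply: MP; exact: ltW.
  have wp := cabs_ge0 w.
  by apply: ge0_ler_powR; rewrite ?nnegrE; [exact: ltW|rewrite subr_ge0 ltW|exact: ltW|rewrite lerBlDr lerDl].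
pose m := sup S.
have mP w : cabs w < r0 -> (r0 - cabs w) `^ q * cabs (derive1 f w) <= m.
  by move=> wr; apply: ub_le_sup => //; exists w.
move=> zr; apply: le_trans (mP _ zr) _.
have [m0|m0] := leP m 0; first by rewrite (le_trans m0)// powR_ge0.
(* Dividing by the power [1 - p] of [m] gives [cc] as a bound for its power [p], independently of
   [r0]. *)
suff mm : m <= cc * m `^ (1 - p).
  have P : m `^ p <= cc.
    have -> : m `^ p = m * m `^ (- (1 - p)).
      by rewrite -{2}(powRr1 (ltW m0)) -powRD ?(gt_eqF m0) ?implybT//; congr (_ `^ _); ring.
    by rewrite powRN ler_pdivrMr ?powR_gt0.
  rewrite -[m in m <= _](powRr1 (ltW m0)) -(mulfV (lt0r_neq0 p0)) powRrM.
  by apply: ge0_ler_powR; [rewrite invr_ge0 ltW|rewrite nnegrE powR_ge0|rewrite nnegrE|].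
apply: ge_sup => // _ [a ar <-].
have da : disc a by apply: disr; exact: ltW.
pose D := r0 - cabs a; have D0 : 0 < D by rewrite subr_gt0.
pose r := D / 64; have rr0 : 0 < r by rewrite divr_gt0.
have sq z' : square a r z' -> D / 2 <= r0 - cabs z'.
  move=> /square_cabs zz; have := cabs_sub z' a; move: zz; rewrite /r /D.
  by have := D0; rewrite /D; clear; lra.
have sq16 z' : square a (16 * r) z' -> disc z'.
  move=> /square_cabs zz; apply: disr; have := cabs_sub z' a; move: zz; rewrite /r /D.
  by have := D0; rewrite /D; clear; lra.
have L := loc a r 1 ltr01 (fun z sz => sq16 z (square_le _ sz)).
have {}L : (\int[mu2]_(w in ring2 a r) (cabs (derive1 f (mkC w)) `^ p)%:E <= I%:E)%E.
  rewrite -[I]divr1; apply: L; first by move: rr0; clear; lra.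
  move=> z' sz; have dz : disc z' by apply: sq16; apply: square_le sz; move: rr0; clear; lra.
  have zz0 := cabs_ge0 z'.
  have z2 : 0 < 1 - cabs z' ^+ 2 by rewrite subr_gt0 expr_lt1.
  rewrite -[p - 1]opprB powRN invf_ge1 ?powR_gt0//.
    apply: (@le_trans _ _ (1 `^ (1 - p))); last by rewrite powR1.
    apply: ge0_ler_powR; [exact: p10|by rewrite nnegrE subr_ge0 expr_le1// ltW|by rewrite nnegrE|].
  by rewrite lerBlDr lerDl sqr_ge0.
(* By definition of [m], and since [r0 - |w| >= D / 2] on the square, this bounds the power [1 - p]
   of [|f'(w)|] there. *)
pose be := (m * (D / 2) `^ (- q)) `^ (1 - p).
have := @deriv_mean_bound _ f a r 0 be _ (fun x => x `^ p) rr0 (fun z sz => fh _ (sq16 z sz))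
    (lexx _) (powR_ge0 _ _) (measurable_powR p) (fun x => powR_ge0 _ _) _ L.
move=> H; have {}H := H _; have {H} : r ^+ 2 * cabs (derive1 f a) <= 4 * (be * I).
  suff : r ^+ 2 * cabs (derive1 f a) <= 4 * (0 * (4 * r ^+ 2) + be * I) by rewrite mul0r add0r.
  apply: H => w [sw _].
  rewrite add0r; set x := cabs _.
  have [x0|x0] := leP x 0; first by rewrite (le_trans x0)// mulr_ge0 ?powR_ge0.
  have xE : x = x `^ (1 - p) * x `^ p.
    by rewrite -powRD ?(gt_eqF x0) ?implybT// subrK powRr1// ltW.
  rewrite {1}xE; apply: ler_wpM2r; first exact: powR_ge0.
  apply: ge0_ler_powR; [exact: p10|by rewrite nnegrE ltW|by rewrite nnegrE mulr_ge0 ?powR_ge0// ltW|].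
  have sD := sq _ sw.
  have wr : cabs (mkC w) < r0 by move: sD D0; clear; lra.
  have D2 : 0 < D / 2 by rewrite divr_gt0.
  rewrite powRN ler_pdivlMr ?powR_gt0// mulrC.
  apply: le_trans (mP _ wr); apply: ler_wpM2r; first exact: ltW.
  by apply: ge0_ler_powR; [exact: ltW|rewrite nnegrE ltW|rewrite nnegrE (le_trans _ sD)// ltW|].
have D2 : 0 < D / 2 by rewrite divr_gt0.
have beE : be = m `^ (1 - p) * 2 `^ (q * (1 - p)) * D `^ 2 * D `^ (- q).
  have e1 : be = m `^ (1 - p) * ((D / 2) `^ (- q)) `^ (1 - p).
    by rewrite /be [LHS](@powRM _ m) ?powR_ge0// ltW.
  have e2 : ((D / 2) `^ (- q)) `^ (1 - p) = D `^ (- q * (1 - p)) * 2 `^ (q * (1 - p)).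
    rewrite -powRrM powRM ?invr_ge0 ?(ltW D0)//; congr (_ * _).
    by rewrite -[in LHS](powR_inv1 (ler0n R 2)) -powRrM; congr (_ `^ _); ring.
  have e3 : D `^ 2 * D `^ (- q) = D `^ (- q * (1 - p)).
    rewrite -powRD ?(gt_eqF D0) ?implybT//; congr (_ `^ _).
    by rewrite /q; field; exact: lt0r_neq0.
  by rewrite e1 e2 -!mulrA e3; ring.
rewrite beE => H.
have Dq : 0 < D `^ q by exact: powR_gt0.
have r2 : r ^+ 2 = D ^+ 2 / 64 ^+ 2 by rewrite /r; field.
move: H; rewrite r2 (powR_mulrn 2 (ltW D0)) powRN => H.
have D20 : 0 < D ^+ 2 by rewrite exprn_gt0.
rewrite -/D mulrC -ler_pdivlMr// -(ler_pM2l D20) /cc -/q.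
move: H; clear; move: (D `^ q)^-1 (D ^+ 2) (m `^ _) (2 `^ _) (cabs _) => V D2 X Y u H; lra.
Qed.

End Growth.

(** * A sufficient condition for membership in Q_s *)

Section Dyadic.
Variable R : realType.

(* Decompose [A] into the shells [rho th^k <= N < 2 rho th^k]. *)
Lemma dyadic_integral d (T : measurableType d) (m : {measure set T -> \bar R}) (A : set T)
    (N : T -> R) (ka rho th be : R) (n : nat) : measurable A -> measurable_fun A N ->
  0 < rho -> 0 < th -> 0 < be -> 0 <= ka -> th `^ (n%:R - be) < 1 ->
  (forall x, A x -> 0 <= N x) ->
  (forall x, A x -> N x != 0 -> exists k : nat, rho * th ^+ k <= N x < 2 * (rho * th ^+ k)) ->
  (forall t : R, 0 < t -> (m (A `&` [set x | N x < t]%R) <= (ka * t ^+ n)%:E)%E) ->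
  (\int[m]_(x in A) (N x `^ (- be))%:E <=
     (ka * 2 ^+ n * rho `^ (n%:R - be) / (1 - th `^ (n%:R - be)))%:E)%E.
Proof.
move=> mA mN rho0 th0 be0 ka0 q1 N0 Nk mE.
pose r k := rho * th ^+ k.
have r0 k : 0 < r k by rewrite mulr_gt0// exprn_gt0.
pose E k := A `&` [set x | N x < 2 * r k].
have mEk k : measurable (E k).
  have -> : E k = A `&` N @^-1` `]-oo, (2 * r k)[.
    by apply/seteqP; split => x [Ax] /=; rewrite in_itv.
  exact: mN.
pose g k x := ((r k `^ (- be))%:E * (\1_(E k) x)%:E)%E.
have g0 k x : (0 <= g k x)%E by rewrite mule_ge0// lee_fin ?powR_ge0.
have mg k : measurable_fun A (g k).
  by apply: emeasurable_funM => //; apply/measurable_EFinP; apply: measurable_indic.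
apply: (@le_trans _ _ (\int[m]_(x in A) (\sum_(0 <= k <oo) g k x))%E).
  apply: ge0_le_integral_set => // [x _|x _|x Ax]; first by rewrite lee_fin powR_ge0.
    by apply: nneseries_ge0 => k _ _; exact: g0.
  (* A zero base raised to the nonzero exponent [- be] is [0], so points where [N] vanishes
     contribute nothing. *)
  have [Nx0|Nx0] := eqVneq (N x) 0.
    rewrite Nx0 powR0 ?oppr_eq0 ?gt_eqF//.
    by apply: nneseries_ge0 => k _ _; exact: g0.
  have [k /andP[k1 k2]] := Nk _ Ax Nx0.
  apply: le_trans (nneseries_lim_ge (u_ := g ^~ x) (P := xpredT) (m := 0%N) k.+1 _); last by move=> i _ _; exact: g0.
  rewrite big_nat_recr//=; apply: (@le_trans _ _ (g k x)); last first.
    by rewrite leeDr//; apply: sume_ge0 => i _; exact: g0.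
  rewrite /g indicE mem_set; last by split.
  rewrite mule1 lee_fin !powRN lef_pV2 ?posrE ?powR_gt0//; last first.
    by apply: lt_le_trans k1; exact: r0.
  by apply: ge0_ler_powR; [exact: ltW|rewrite nnegrE; exact: ltW|rewrite nnegrE; exact: N0|exact: k1].
rewrite integral_nneseries//.
pose c := ka * 2 ^+ n * rho `^ (n%:R - be).
pose q := th `^ (n%:R - be).
have q0 : 0 < q by exact: powR_gt0.
have c0 : 0 <= c by rewrite mulr_ge0 ?powR_ge0// mulr_ge0// exprn_ge0.
have Ig k : (\int[m]_(x in A) g k x <= (c * q ^+ k)%:E)%E.
  rewrite ge0_integralZl_EFin ?powR_ge0//; last first.
    by apply/measurable_EFinP; apply: measurable_indic.
  rewrite integral_indic// setIAC setIid.
  have r20 : 0 < 2 * r k by rewrite mulr_gt0.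
  apply: le_trans (lee_wpmul2l _ (mE _ r20)) _; first by rewrite lee_fin powR_ge0.
  rewrite -EFinM lee_fin; apply: le_of_eq.
  rewrite exprMn /c /q.
  have e1 : r k `^ (- be) * r k ^+ n = r k `^ (n%:R - be).
    by rewrite -(powR_mulrn n (ltW (r0 k))) -powRD ?(gt_eqF (r0 k)) ?implybT// addrC.
  have e2 : r k `^ (n%:R - be) = rho `^ (n%:R - be) * (th `^ (n%:R - be)) ^+ k.
    rewrite /r powRM ?(ltW rho0) ?exprn_ge0 ?(ltW th0)//; congr (_ * _).
    by rewrite -(powR_mulrn k (ltW th0)) -(powR_mulrn k (powR_ge0 th _)) -!powRrM mulrC.
  by rewrite mulrCA -[ka * 2 ^+ n * _ * _]mulrA -e2 -e1; ring.
apply: (@le_trans _ _ (\sum_(0 <= k <oo) (c * q ^+ k)%:E)%E).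
  by apply: lee_nneseries => [k _ _|k _]; [apply: integral_ge0 => x _; exact: g0|exact: Ig].
apply: lime_le.
  by apply: is_cvg_nneseries => k _ _; rewrite lee_fin mulr_ge0// exprn_ge0// ltW.
apply: nearW => k; rewrite sumEFin lee_fin -/c -/q.
have := @geometric_le_lim R k c q c0 q0.
rewrite gtr0_norm// => /(_ q1); rewrite /series /= /geometric.
by [].
Qed.

Lemma dyadic_down (rho x : R) : 0 < rho -> 0 < x -> x < 2 * rho ->
  exists k : nat, rho * 2^-1 ^+ k <= x < 2 * (rho * 2^-1 ^+ k).
Proof.
move=> rho0 x0 xr.
have ex : exists k : nat, rho * 2^-1 ^+ k <= x.
  exists (Num.truncn (rho / x)).+1; rewrite exprVn ler_pdivrMr ?exprn_gt0//.
  rewrite mulrC -ler_pdivrMr//; apply: le_trans (ltW (truncnS_gt _)) _.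
  by rewrite -natrX ler_nat ltnW// ltn_expl.
exists (ex_minn ex); case: ex_minnP => -[kx _|k kx kmin].
  by rewrite kx expr0 mulr1 xr.
rewrite kx /=; have : ~~ (rho * 2^-1 ^+ k <= x).
  by apply/negP => /kmin; rewrite ltnn.
rewrite -ltNge => /lt_le_trans; apply.
by rewrite exprS; lra.
Qed.

Lemma dyadic_up (rho x : R) : 0 < rho -> rho <= x ->
  exists k : nat, rho * 2 ^+ k <= x < 2 * (rho * 2 ^+ k).
Proof.
move=> rho0 xr; have x0 : 0 < x by exact: lt_le_trans xr.
have ex : exists k : nat, x < 2 * (rho * 2 ^+ k).
  exists (Num.truncn (x / rho)).+1; rewrite mulrCA -exprS mulrC -ltr_pdivrMr//.
  apply: lt_trans (truncnS_gt _) _.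
  by rewrite -natrX ltr_nat; apply: ltn_trans (ltn_expl _ _) => //; rewrite ltn_exp2l.
exists (ex_minn ex); case: ex_minnP => -[kx _|k kx kmin].
  by rewrite kx expr0 mulr1 xr.
rewrite kx andbT; have : ~~ (x < 2 * (rho * 2 ^+ k)).
  by apply/negP => /kmin; rewrite ltnn.
by rewrite -leNgt exprS mulrCA.
Qed.

End Dyadic.

(** * Singular integrals and the Green function *)

Section Kernel.
Variable R : realType.
Local Notation C := (Cplx R).
Local Notation mT := (measurableTypeR R).
Implicit Types (f g : C -> C) (r t : R) (z a h c : C).
Local Notation mu2 := (@mu2 R).
Local Notation dA := (@dA R).
Local Notation disc := (@disc R).
Local Notation disc2 := (@disc2 R).
Local Notation Rez z := (complex.Re (z : R[i])).
Local Notation Imz z := (complex.Im (z : R[i])).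

Lemma integral_cover2 d (T : measurableType d) (m : {measure set T -> \bar R})
   (A B D : set T) (f g h : T -> R) : measurable B -> measurable D ->
  measurable_fun B g -> measurable_fun D h ->
  (forall x, A x -> 0 <= f x) -> (forall x, B x -> 0 <= g x) -> (forall x, D x -> 0 <= h x) ->
  (forall x, A x -> B x /\ f x <= g x \/ D x /\ f x <= h x) ->
  (\int[m]_(x in A) (f x)%:E <= \int[m]_(x in B) (g x)%:E + \int[m]_(x in D) (h x)%:E)%E.
Proof.
move=> mB mD mg mh f0 g0 h0 fgh.
pose G := (fun x => (g x)%:E) \_ B; pose H := (fun x => (h x)%:E) \_ D.
have G0 x : (0 <= G x)%E.
  by rewrite /G /patch; case: ifPn => // /set_mem Bx; rewrite lee_fin g0.
have H0 x : (0 <= H x)%E.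
  by rewrite /H /patch; case: ifPn => // /set_mem Bx; rewrite lee_fin h0.
rewrite (integral_mkcond B) (integral_mkcond D) -ge0_integralD//; first last.
- by apply/(measurable_restrictT _ mD)/measurable_EFinP.
- by apply/(measurable_restrictT _ mB)/measurable_EFinP.
apply: ge0_le_integral_set => // [x _|x Ax]; first by rewrite adde_ge0.
case: (fgh _ Ax) => -[Bx le].
  apply: (@le_trans _ _ (G x)); last by rewrite leeDl.
  by rewrite /G /patch mem_set.
apply: (@le_trans _ _ (H x)); last by rewrite leeDr.
by rewrite /H /patch mem_set.
Qed.

Definition dist2 c (w : mT * mT) : R := cabs (mkC w - c).

Lemma measurable_dist2 c (A : set (mT * mT)) : measurable A -> measurable_fun A (dist2 c).
Proof.
move=> mA; apply: (@ccts_measurable R A (fun z => z - c)) => // w _ e e0.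
exists e => // h he; rewrite (_ : _ + _ - _ - _ = h); last by ring.
exact: ltW.
Qed.

Lemma dist2_ge0 c w : 0 <= dist2 c w. Proof. exact: cabs_ge0. Qed.

Lemma measurable_dist2_lt c (A : set (mT * mT)) t : measurable A ->
  measurable (A `&` [set w | dist2 c w < t]).
Proof.
move=> mA; have := measurable_dist2 c mA.
move=> /(_ mA `]-oo, t[%classic (measurable_itv _)).
congr (measurable _); apply/seteqP; split => w [Aw] /=; rewrite ?in_itv//=.
Qed.

Lemma measurable_dist2_ge c (A : set (mT * mT)) t : measurable A ->
  measurable (A `&` [set w | t <= dist2 c w]).
Proof.
move=> mA; have := measurable_dist2 c mA.
move=> /(_ mA `[t, +oo[%classic (measurable_itv _)).
by congr (measurable _); apply/seteqP; split => w [Aw] /=; rewrite in_itv /= andbT.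
Qed.

Lemma mu2_dist2 c (A : set (mT * mT)) t : measurable A -> 0 < t ->
  (mu2 (A `&` [set w | dist2 c w < t]%R) <= (4 * t ^+ 2)%:E)%E.
Proof.
move=> mA t0; apply: (@le_trans _ _ (mu2 (rect (Rez c - t) (Rez c + t) (Imz c - t) (Imz c + t)))).
  apply: le_measure; rewrite ?inE; [exact: measurable_dist2_lt|exact: measurable_rect|].
  by move=> w [_ /= wt]; apply/rectE; apply: cabs_square; exact: ltW.
rewrite /mu2 product_measure1E; [|exact: measurable_itv|exact: measurable_itv].
rewrite /= !lebesgue_measure_itv/= !lte_fin.
have E (s : R) : (s - t < s + t) = true by apply/idP; lra.
rewrite !E -!EFinD -EFinM lee_fin.
by apply: le_of_eq; ring.
Qed.

Lemma half_powR_lt1 (x : R) : 0 < x -> 2^-1 `^ x < 1 :> R.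
Proof.
move=> x0; have h : 0 < 2^-1 :> R by rewrite invr_gt0.
rewrite -{2}(powRr0 2^-1); rewrite /powR gt_eqF// ltr_expR mul0r pmulr_rlt0//.
by apply: ln_lt0; rewrite h invf_lt1// ltr1n.
Qed.

Lemma two_powRN_lt1 (x : R) : 0 < x -> 2 `^ (- x) < 1 :> R.
Proof.
move=> x0; rewrite (_ : 2 `^ (- x) = 2^-1 `^ x); first exact: half_powR_lt1.
by rewrite -(powR_inv1 (ler0n R 2)) -powRrM mulN1r.
Qed.

(** On halving shells the area [O(t^2)] wins over the singularity because [be < 2]. The constant [K]
    is independent of the centre, as uniformity in the pole of the Green function requires. *)
Lemma singular_integral (A : set (mT * mT)) (be : R) : measurable A -> 0 < be -> be < 2 ->
  exists2 K, 0 <= K & forall c r, 0 < r ->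
   (\int[mu2]_(w in A `&` [set w | dist2 c w < r]%R) (dist2 c w `^ (- be))%:E <= (K * r `^ (2 - be))%:E)%E.
Proof.
move=> mA be0 be2; have q1 : 2^-1 `^ (2 - be) < 1 :> R by apply: half_powR_lt1; rewrite subr_gt0.
pose K := 4 * 2 ^+ 2 * (2^-1 `^ (2 - be)) / (1 - 2^-1 `^ (2 - be)) : R.
exists K; first by rewrite divr_ge0 ?subr_ge0 ?(ltW q1)// mulr_ge0// powR_ge0.
move=> c r r0; have r20 : 0 < r * 2^-1 by rewrite mulr_gt0// invr_gt0.
have mAr := measurable_dist2_lt c r mA.
have := @dyadic_integral R _ _ mu2 _ (dist2 c) 4 (r * 2^-1) 2^-1 be 2 mAr (measurable_dist2 c mAr) r20.
rewrite powRM ?(ltW r0) ?invr_ge0//.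
have -> : 4 * 2 ^+ 2 * (r `^ (2%:R - be) * 2^-1 `^ (2%:R - be)) / (1 - 2^-1 `^ (2%:R - be)) = K * r `^ (2 - be).
  by rewrite /K; ring.
apply => //; first by move=> x [_ _]; exact: dist2_ge0.
- move=> x [_ /= xr] x0; apply: dyadic_down => //; first by rewrite lt0r x0 dist2_ge0.
  by rewrite mulrCA mulfV// mulr1.
- by move=> t t0; apply: mu2_dist2.
Qed.

Lemma tail_integral (A : set (mT * mT)) (be : R) : measurable A -> 2 < be ->
  exists2 K, 0 <= K & forall c r, 0 < r ->
   (\int[mu2]_(w in A `&` [set w | r <= dist2 c w]%R) (dist2 c w `^ (- be))%:E <= (K * r `^ (2 - be))%:E)%E.
Proof.
move=> mA be2; have q1 : 2 `^ (2 - be) < 1 :> R by rewrite -opprB two_powRN_lt1// subr_gt0.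
pose K := 4 * 2 ^+ 2 / (1 - 2 `^ (2 - be)) : R.
exists K; first by rewrite divr_ge0 ?subr_ge0 ?(ltW q1).
move=> c r r0.
have mAr := measurable_dist2_ge c r mA.
have be0 : 0 < be by move: be2; lra.
have := @dyadic_integral R _ _ mu2 _ (dist2 c) 4 r 2 be 2 mAr (measurable_dist2 c mAr) r0.
have -> : 4 * 2 ^+ 2 * r `^ (2%:R - be) / (1 - 2 `^ (2%:R - be)) = K * r `^ (2 - be).
  by rewrite /K; ring.
apply => //; first by move=> x [_ _]; exact: dist2_ge0.
- by move=> x [_ /= xr] x0; apply: dyadic_up.
- by move=> t t0; apply: mu2_dist2.
Qed.

Lemma int_disc_le (u : C -> R) (v : mT * mT -> R) : measurable_fun disc2 v ->
  (forall w, disc2 w -> 0 <= u (mkC w) <= v w) ->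
  (int_disc u <= \int[mu2]_(w in disc2) (v w)%:E)%E.
Proof.
move=> mv uv; have mD := @measurable_disc2 R.
have v0 w : disc2 w -> 0 <= v w by move=> /uv/andP[]; exact: le_trans.
apply: (@le_trans _ _ (\int[dA]_(w in disc2) (v w)%:E)%E).
  by apply: ge0_le_integral_set => // w Dw; rewrite lee_fin ?v0//; case/andP: (uv _ Dw).
rewrite integral_dA// -[leRHS]mul1e; apply: lee_wpmul2r.
  by apply: integral_ge0 => w Dw; rewrite lee_fin v0.
by rewrite lee_fin ler_pdivrMr ?pi_gt0// mul1r (le_trans _ (pi_ge2 R))// ler1n.
Qed.

(** From [|1 - conj(a) z|^2 = |z - a|^2 + (1 - |a|^2) (1 - |z|^2)] and [ln (1 + x) <= x], applied to
    the squared quotient; then [1 - |a|^2 <= 2 |1 - a|], and likewise for [z]. *)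
Lemma green_bounds a z : disc a -> disc z -> z != a ->
  0 <= green z a <= 2 * cabs (1 - a) * cabs (1 - z) / cabs (z - a) ^+ 2.
Proof.
move=> da dz za; have B0 : 0 < cabs (z - a) by rewrite cabs_gt0// subr_eq0.
have a1 : cabs a < 1 by []. have z1 : cabs z < 1 by [].
have ap := cabs_ge0 a; have zp := cabs_ge0 z.
pose P := (1 - cabs a ^+ 2) * (1 - cabs z ^+ 2).
have P0 : 0 <= P.
  by rewrite mulr_ge0// subr_ge0 expr_le1// ltW.
set A := cabs (1 - conjc a * z : C).
have E : A ^+ 2 = cabs (z - a) ^+ 2 + P.
  rewrite /P /A !cabs_sqr; case: (a) (z) => [a1' a2] [x y] /=; ring.
have A0 : 0 <= A by exact: cabs_ge0.
have AB : cabs (z - a) <= A.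
  rewrite -(@ler_pXn2r _ 2)// ?nnegrE ?cabs_ge0// E lerDl//.
have q1 : 1 <= A / cabs (z - a) by rewrite ler_pdivlMr// mul1r.
have q0 : 0 < A / cabs (z - a) by exact: lt_le_trans q1.
have -> : green z a = ln (A / cabs (z - a)) by rewrite /green cabsM cabsV.
rewrite ln_ge0//=.
have h : 2 * ln (A / cabs (z - a)) <= P / cabs (z - a) ^+ 2.
  have -> : 2 * ln (A / cabs (z - a)) = ln ((A / cabs (z - a)) ^+ 2).
    by rewrite lnXn// mulr2n; ring.
  have -> : (A / cabs (z - a)) ^+ 2 = 1 + P / cabs (z - a) ^+ 2.
    by rewrite expr_div_n E mulrDl mulfV// expf_neq0// gt_eqF.
  apply: le_ln1Dx; apply: (@lt_le_trans _ _ 0) => //.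
  by rewrite divr_ge0// exprn_ge0// ltW.
have ha : 1 - cabs a <= cabs (1 - a) by have := cabs_sub 1 a; rewrite cabs1.
have hz : 1 - cabs z <= cabs (1 - z) by have := cabs_sub 1 z; rewrite cabs1.
have PP : P <= 4 * cabs (1 - a) * cabs (1 - z).
  have : P <= (2 * cabs (1 - a)) * (2 * cabs (1 - z)).
    apply: ler_pM; rewrite ?subr_ge0 ?expr_le1// ?ltW//.
      by move: ha a1 ap; clear; nra.
    by move: hz z1 zp; clear; nra.
  by clear; lra.
rewrite -(@ler_pM2l _ 2)//; apply: le_trans h _.
rewrite mulrA ler_pM2r ?invr_gt0 ?exprn_gt0//.
by apply: le_trans PP _; clear; lra.
Qed.

(** The singularities at [1] and [a] are [2 e] apart. Near each of them the other factor is at most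
    its value at distance [e], and both exponents, [2 - s] and [2 s], are below [2]. Far from both,
    the factors are comparable and the total exponent [2 + s] exceeds [2]. By scaling, each region
    contributes a multiple of the power [- s] of [e]. *)
Lemma kernel_bound (s : R) : 0 < s -> s < 1 -> exists2 K, 0 <= K & forall a, disc a ->
  (\int[mu2]_(w in disc2) (dist2 1 w `^ (- (2 - s)) * dist2 a w `^ (- (2 * s)))%:E <=
    (K * (cabs (1 - a) / 2) `^ (- s))%:E)%E.
Proof.
move=> s0 s1; have mD := @measurable_disc2 R.
have [||K1 K10 H1] := @singular_integral disc2 (2 - s) mD; [lra|lra|].
have [||K2 K20 H2] := @singular_integral disc2 (2 * s) mD; [lra|lra|].
have [|K3 K30 H3] := @tail_integral disc2 (2 + s) mD; [lra|].
have p3 := powR_ge0 3 (2 * s) : 0 <= 3 `^ (2 * s).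
exists (K1 + (K2 + 3 `^ (2 * s) * K3)); first by rewrite !addr_ge0// mulr_ge0.
move=> a da; set e := cabs (1 - a) / 2.
have d0 : 0 < cabs (1 - a).
  by have := cabs_sub 1 a; rewrite cabs1; have : cabs a < 1 by []; lra.
have e0 : 0 < e by rewrite divr_gt0.
have tri w : 2 * e <= dist2 1 w + dist2 a w.
  rewrite /e mulrC divfK// [leRHS]addrC /dist2.
  by rewrite (_ : 1 - a = (mkC w - a) - (mkC w - 1)); [exact: cabsB|ring].
have mN1 A : measurable A -> measurable_fun A (fun w => dist2 1 w `^ (- (2 - s))).
  by move=> mA; exact: (measurableT_comp (measurable_powR _) (measurable_dist2 _ mA)).
have mN2 A : measurable A -> measurable_fun A (fun w => dist2 a w `^ (- (2 * s))).
  by move=> mA; exact: (measurableT_comp (measurable_powR _) (measurable_dist2 _ mA)).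
have mN3 A : measurable A -> measurable_fun A (fun w => dist2 1 w `^ (- (2 + s))).
  by move=> mA; exact: (measurableT_comp (measurable_powR _) (measurable_dist2 _ mA)).
pose A1 := disc2 `&` [set w | dist2 1 w < e]%R.
pose A2 := disc2 `&` [set w | dist2 a w < e]%R.
pose A3 := disc2 `&` [set w | e <= dist2 1 w]%R.
have mA1 : measurable A1 by exact: measurable_dist2_lt.
have mA2 : measurable A2 by exact: measurable_dist2_lt.
have mA3 : measurable A3 by exact: measurable_dist2_ge.
pose F w := dist2 1 w `^ (- (2 - s)) * dist2 a w `^ (- (2 * s)).
have F0 w : 0 <= F w by rewrite mulr_ge0 ?powR_ge0.
have sc (c k q : R) (A : set (mT * mT)) (N : mT * mT -> R) : 0 <= c -> measurable A ->
    measurable_fun A N -> (forall w, A w -> 0 <= N w) -> c * k = q ->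
    (\int[mu2]_(w in A) (N w)%:E <= k%:E -> \int[mu2]_(w in A) (c * N w)%:E <= q%:E)%E.
  move=> c0 mA mN N0 <- h; under eq_integral do rewrite EFinM.
  rewrite ge0_integralZl_EFin//; last exact/measurable_EFinP.
  by rewrite EFinM lee_wpmul2l.
have S1 : (\int[mu2]_(w in A1) (e `^ (- (2 * s)) * dist2 1 w `^ (- (2 - s)))%:E <= (K1 * e `^ (- s))%:E)%E.
  apply: sc (H1 _ _ e0); rewrite ?powR_ge0//; [exact: mN1|by move=> w _; exact: powR_ge0|].
  by rewrite mulrCA -powRD ?(gt_eqF e0) ?implybT//; congr (_ * _ `^ _); ring.
have S2 : (\int[mu2]_(w in A2) (e `^ (- (2 - s)) * dist2 a w `^ (- (2 * s)))%:E <= (K2 * e `^ (- s))%:E)%E.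
  apply: sc (H2 _ _ e0); rewrite ?powR_ge0//; [exact: mN2|by move=> w _; exact: powR_ge0|].
  by rewrite mulrCA -powRD ?(gt_eqF e0) ?implybT//; congr (_ * _ `^ _); ring.
have S3 : (\int[mu2]_(w in A3) (3 `^ (2 * s) * dist2 1 w `^ (- (2 + s)))%:E <=
    (3 `^ (2 * s) * K3 * e `^ (- s))%:E)%E.
  apply: sc (H3 _ _ e0); rewrite ?powR_ge0//; [exact: mN3|by move=> w _; exact: powR_ge0|].
  by rewrite -mulrA; congr (_ * (_ * _ `^ _)); ring.
rewrite (mulrDl K1) (mulrDl K2) !EFinD.
apply: (le_trans _ (leeD S1 (leeD S2 S3))).
have C1 : (\int[mu2]_(w in disc2) (F w)%:E <=
   \int[mu2]_(w in A1) (e `^ (- (2 * s)) * dist2 1 w `^ (- (2 - s)))%:E + \int[mu2]_(w in A3) (F w)%:E)%E.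
  apply: integral_cover2 => //.
  - by apply: measurable_funM => //; exact: mN1.
  - by apply: measurable_funM; [exact: mN1|exact: mN2].
  - by move=> w _; rewrite mulr_ge0 ?powR_ge0.
  move=> w Dw; have [N1e|N1e] := leP e (dist2 1 w); first by right; split.
  left; split => //; rewrite /F mulrC; apply: ler_wpM2r; rewrite ?powR_ge0//.
  by apply: ler_powRn => //; have := tri w; lra.
apply: le_trans C1 _; apply: leeD => //.
apply: integral_cover2 => //.
- by apply: measurable_funM => //; exact: mN2.
- by apply: measurable_funM => //; exact: mN3.
- by move=> w _; rewrite mulr_ge0 ?powR_ge0.
- by move=> w _; rewrite mulr_ge0 ?powR_ge0.
move=> w [Dw N1e]; have [N2e|N2e] := leP e (dist2 a w); last first.
  left; split => //; apply: ler_wpM2r; rewrite ?powR_ge0//.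
  by apply: ler_powRn => //; lra.
right; split => //.
(* Here [dist2 a w >= e], so [dist2 1 w <= 3 * dist2 a w]: this is the origin of the constant
   [3]. *)
have tri' : dist2 1 w <= dist2 a w + 2 * e.
  rewrite /e mulrC divfK// /dist2 -[cabs (1 - a)]cabsN opprB.
  by rewrite (_ : mkC w - 1 = (mkC w - a) + (a - 1)); [exact: cabsD|ring].
have n1 : 0 < dist2 1 w by exact: lt_le_trans N1e.
have -> : 3 `^ (2 * s) * dist2 1 w `^ (- (2 + s)) =
   dist2 1 w `^ (- (2 - s)) * (dist2 1 w * 3^-1) `^ (- (2 * s)).
  rewrite powRM ?invr_ge0 ?(ltW n1)// mulrA -powRD ?(gt_eqF n1) ?implybT// mulrC; congr (_ `^ _ * _); first by ring.
  by rewrite -[in RHS](powR_inv1 (ler0n R 3)) -powRrM mulN1r opprK.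
apply: ler_wpM2l; rewrite ?powR_ge0//; apply: ler_powRn; first by rewrite mulr_gt0// invr_gt0.
  by rewrite ler_pdivrMr//; move: tri' N2e; clear; lra.
by rewrite mulr_ge0// ltW.
Qed.

(** The model is [log (1 / (1 - z))]. Inserting [green_bounds] produces the kernel of [kernel_bound]
    times the power [s] of [|1 - a|], which cancels the power [- s] found there; the bound is
    therefore uniform in [a]. *)
Lemma Qspace_of_log (s L : R) f : 0 < s -> s < 1 -> Hol_disc f -> 0 <= L ->
  (forall z, disc z -> cabs (derive1 f z) * cabs (1 - z) <= L) -> Qspace s f.
Proof.
move=> s0 s1 fh L0 fL; split => //; have [K K0 HK] := kernel_bound s0 s1.
pose M := L ^+ 2 * 2 `^ s * 2 `^ s * K.
apply: (@le_lt_trans _ _ M%:E); last exact: ltry.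
apply: ge_ereal_sup => _ [a da <-].
have mD := @measurable_disc2 R.
have d0 : 0 < cabs (1 - a).
  by have := cabs_sub 1 a; rewrite cabs1; have : cabs a < 1 by []; lra.
pose c := L ^+ 2 * (2 * cabs (1 - a)) `^ s.
have c0 : 0 <= c by rewrite mulr_ge0 ?powR_ge0// sqr_ge0.
pose F w := dist2 1 w `^ (- (2 - s)) * dist2 a w `^ (- (2 * s)).
have mF : measurable_fun disc2 F.
  by apply: measurable_funM; apply: (measurableT_comp (measurable_powR _)); exact: measurable_dist2.
apply: (@le_trans _ _ (\int[mu2]_(w in disc2) (c * F w)%:E)%E).
  apply: int_disc_le; first exact: measurable_funM.
  move=> w Dw; rewrite mulr_ge0 ?powR_ge0 ?sqr_ge0//=.
  have F0 : 0 <= F w by rewrite mulr_ge0 ?powR_ge0.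
  have [->|wa] := eqVneq (mkC w) a.
    have -> : green a a = 0 by rewrite /green subrr invr0 mulr0 cabs0 ln0.
    by rewrite powR0 ?gt_eqF// mulr0 mulr_ge0.
  have dw : disc (mkC w) by [].
  have /andP[g0 g1] := green_bounds da dw wa.
  have n1 : 0 < cabs (1 - mkC w).
    by have := cabs_sub 1 (mkC w); rewrite cabs1; have : cabs (mkC w) < 1 by []; lra.
  have n2 : 0 < cabs (mkC w - a) by rewrite cabs_gt0// subr_eq0.
  have gs : green (mkC w) a `^ s <= (2 * cabs (1 - a)) `^ s * cabs (1 - mkC w) `^ s * cabs (mkC w - a) `^ (- (2 * s)).
    apply: (@le_trans _ _ ((2 * cabs (1 - a) * cabs (1 - mkC w) / cabs (mkC w - a) ^+ 2) `^ s)).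
      apply: ge0_ler_powR => //; rewrite ?nnegrE//; first exact: ltW.
      exact: le_trans g1.
    rewrite powRM ?invr_ge0 ?exprn_ge0 ?mulr_ge0 ?cabs_ge0// powRM ?mulr_ge0 ?cabs_ge0//.
    apply: le_of_eq; congr (_ * _).
    rewrite -(powR_mulrn 2 (cabs_ge0 _)) -(powR_inv1 (powR_ge0 _ _)) -!powRrM; congr (_ `^ _); ring.
  have f2 : cabs (derive1 f (mkC w)) ^+ 2 <= L ^+ 2 * cabs (1 - mkC w) `^ (- 2).
    rewrite powRN (powR_mulrn 2 (cabs_ge0 _)) ler_pdivlMr ?exprn_gt0// -exprMn.
    by rewrite ler_pXn2r ?nnegrE ?mulr_ge0 ?cabs_ge0// fL.
  apply: (le_trans (ler_pM (sqr_ge0 _) (powR_ge0 _ _) f2 gs)).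
  apply: le_of_eq; rewrite /c /F /dist2 [cabs (mkC w - 1)]cabsBC.
  have -> : - (2 - s) = - 2 + s by ring.
  rewrite (powRD (r := - 2)) ?(gt_eqF n1) ?implybT//; ring.
under eq_integral do rewrite EFinM.
rewrite ge0_integralZl_EFin//; first last.
- exact/measurable_EFinP.
- by move=> w _; rewrite lee_fin mulr_ge0 ?powR_ge0.
apply: le_trans (lee_wpmul2l _ (HK a da)) _; first by rewrite lee_fin.
rewrite -EFinM lee_fin; apply: le_of_eq; rewrite /c /M.
have e1 : (2 * cabs (1 - a)) `^ s = 2 `^ s * 2 `^ s * (cabs (1 - a) / 2) `^ s.
  by rewrite -!powRM ?divr_ge0 ?mulr_ge0 ?cabs_ge0//; congr (_ `^ _); field.
rewrite e1 powRN; field.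
by rewrite gt_eqF// powR_gt0// divr_gt0.
Qed.

End Kernel.

(** * Sufficiency of the growth condition *)

Section Annulus.
Variable R : realType.
Local Notation C := (Cplx R).
Local Notation mT := (measurableTypeR R).
Implicit Types (f g : C -> C) (r t : R) (z a h c : C).
Local Notation mu2 := (@mu2 R).
Local Notation leb := (@lebesgue_measure R).
Local Notation disc2 := (@disc2 R).

Lemma lebesgue_itvcc (p q : R) : p <= q -> leb `[p, q]%classic = (q - p)%:E.
Proof.
move=> pq; rewrite lebesgue_measure_itv/= lte_fin.
have [ab'|ba] := ltP p q => //.
by rewrite (_ : q = p) ?subrr//; apply/le_anti; rewrite ba.
Qed.

Lemma slice_bound (S : set mT) (c p q : R) : 0 <= c ->
  (forall x : R, S x -> p - c <= x <= p \/ q - c <= x <= q) ->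
  (\int[leb]_x (\1_S x)%:E <= (2 * c)%:E)%E.
Proof.
move=> c0 Sx.
have E1 : (\int[leb]_x (\1_S x)%:E = \int[leb]_(x in S) ((fun=> 1) x : R)%:E)%E.
  rewrite [RHS]integral_mkcond; apply: eq_integral => x _.
  by rewrite /patch indicE; case: ifP.
have E2 : (\int[leb]_(x in S) ((fun=> 1) x : R)%:E <=
    \int[leb]_(x in `[(p - c)%R, p]) ((fun=> 1) x : R)%:E + \int[leb]_(x in `[(q - c)%R, q]) ((fun=> 1) x : R)%:E)%E.
  apply: integral_cover2 => // x /Sx[h|h]; [left|right]; split => //=; rewrite in_itv //.
have E3 (u v : R) : u <= v -> (\int[leb]_(x in `[u, v]) ((fun=> 1) x : R)%:E = (v - u)%:E)%E.
  by move=> uv; rewrite integral_cst//= mul1e lebesgue_itvcc.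
rewrite E1; apply: le_trans E2 _.
rewrite !E3 ?lerBlDr ?lerDl// -EFinD lee_fin.
by clear; lra.
Qed.

Lemma mu2_slices1 (E : set (mT * mT)) (l c : R) : measurable E -> 0 <= l -> 0 <= c ->
  (forall x y, E (x, y) -> `|y| <= l) ->
  (forall y, exists p q : R, forall x, E (x, y) -> p - c <= x <= p \/ q - c <= x <= q) ->
  (mu2 E <= (4 * c * l)%:E)%E.
Proof.
move=> mE l0 c0 El Es.
have -> : mu2 E = (\int[mu2]_w (\1_E w)%:E)%E by rewrite integral_indic// setIT.
rewrite /mu2 fubini_tonelli2//; last by apply/measurable_EFinP; exact: measurable_indic.
apply: (@le_trans _ _ (\int[leb]_(y in `[(- l)%R, l]) (cst (2 * c)%:E y))%E); last first.
  rewrite integral_cst//= lebesgue_itvcc ?lerN2// -?EFinM ?lee_fin; last by rewrite -subr_ge0 opprK addr_ge0.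
  by clear; lra.
rewrite [leRHS]integral_mkcond; apply: ge0_le_integral_set => // [y _|y _|y _].
- by apply: integral_ge0 => x _; rewrite lee_fin.
- by rewrite /patch; case: ifP => // _; rewrite lee_fin mulr_ge0.
rewrite /patch; case: ifPn => [_|/negP yl].
  have [p [q H]] := Es y.
  have := @slice_bound [set x | E (x, y)] c p q c0 H.
  by apply: le_trans; apply: le_of_eq; apply: eq_integral => x _; rewrite !indicE.
rewrite (_ : fubini_G _ _ y = 0)//.
apply: integral0_eq => x _; rewrite indicE memNset// => Exy.
by apply: yl; rewrite inE /= in_itv /= -ler_norml; exact: El Exy.
Qed.

Lemma mu2_slices2 (E : set (mT * mT)) (l c : R) : measurable E -> 0 <= l -> 0 <= c ->
  (forall x y, E (x, y) -> `|x| <= l) ->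
  (forall x, exists p q : R, forall y, E (x, y) -> p - c <= y <= p \/ q - c <= y <= q) ->
  (mu2 E <= (4 * c * l)%:E)%E.
Proof.
move=> mE l0 c0 El Es.
have -> : mu2 E = (\int[mu2]_w (\1_E w)%:E)%E by rewrite integral_indic// setIT.
rewrite /mu2 fubini_tonelli1//; last by apply/measurable_EFinP; exact: measurable_indic.
apply: (@le_trans _ _ (\int[leb]_(y in `[(- l)%R, l]) (cst (2 * c)%:E y))%E); last first.
  rewrite integral_cst//= lebesgue_itvcc ?lerN2// -?EFinM ?lee_fin; last by rewrite -subr_ge0 opprK addr_ge0.
  by clear; lra.
rewrite [leRHS]integral_mkcond; apply: ge0_le_integral_set => // [x _|x _|x _].
- by apply: integral_ge0 => y _; rewrite lee_fin.
- by rewrite /patch; case: ifP => // _; rewrite lee_fin mulr_ge0.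
rewrite /patch; case: ifPn => [_|/negP yl].
  have [p [q H]] := Es x.
  have := @slice_bound [set y | E (x, y)] c p q c0 H.
  by apply: le_trans; apply: le_of_eq; apply: eq_integral => y _; rewrite !indicE.
rewrite (_ : fubini_F _ _ x = 0)//.
apply: integral0_eq => y _; rewrite indicE memNset// => Exy.
by apply: yl; rewrite inE /= in_itv /= -ler_norml; exact: El Exy.
Qed.

(* [X] is the half-chord at height [y]; where [|y| <= 3 / 4] it is at least
   [1 / 2], so the annulus has slices of length at most [4 t] at both ends. *)
Lemma chord_slice (x y t : R) : `|y| <= 3 / 4 -> x ^+ 2 + y ^+ 2 < 1 ->
  1 - Num.sqrt (x ^+ 2 + y ^+ 2) < t -> let X := Num.sqrt (1 - y ^+ 2) in
  X - 4 * t <= x <= X \/ (- X + 4 * t) - 4 * t <= x <= - X + 4 * t.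
Proof.
move=> y34 xy1; set r := Num.sqrt _ => rt X.
have r2 : r ^+ 2 = x ^+ 2 + y ^+ 2 by rewrite sqr_sqrtr// addr_ge0// sqr_ge0.
have r0 : 0 <= r by exact: sqrtr_ge0.
have y2 : y ^+ 2 <= 9 / 16 by move: y34; rewrite ler_norml; nra.
have X2 : X ^+ 2 = 1 - y ^+ 2 by rewrite sqr_sqrtr//; move: y2; clear; lra.
have X0 : 0 <= X by exact: sqrtr_ge0.
have X12 : 1 / 2 <= X by clear - X2 X0 y2; nra.
have r1 : r < 1 by clear - r2 r0 xy1; nra.
have xX : x ^+ 2 < X ^+ 2 by move: xy1 X2; clear; lra.
(* [X^2 - x^2 = 1 - r^2 = (1 - r) (1 + r)]. Dividing by [X + |x| >= 1 / 2] gives slices of length at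
   most [4 * t]. *)
have key : X ^+ 2 - x ^+ 2 < 2 * t by clear - r0 r1 r2 X2 rt; nra.
have t0 : 0 < t by move: rt r1; clear; lra.
clear - X0 X12 xX key t0; have [x0|x0] := leP 0 x.
  by left; apply/andP; split; nra.
by right; apply/andP; split; nra.
Qed.

Lemma measurable_1mcabs (A : set (mT * mT)) : measurable A ->
  measurable_fun A (fun w => 1 - cabs (mkC w)).
Proof.
move=> mA; apply: measurable_funB => //.
have := measurable_dist2 (0 : C) mA; congr measurable_fun.
by apply/funext => w; rewrite /dist2 subr0.
Qed.

(** In the disc one of [|x|], [|y|] is at most [3 / 4], as [2 * (9 / 16) > 1]. Slicing parallel to
    the other axis, each of the two parts has area at most [12 * t]. *)
Lemma mu2_annulus t : 0 < t ->
  (mu2 (disc2 `&` [set w | (1 - cabs (mkC w) < t)%R]) <= (24 * t)%:E)%E.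
Proof.
move=> t0; have mD := @measurable_disc2 R.
set E0 := _ `&` _; pose E : set (mT * mT) := E0.
rewrite -[E0]/E; have mE : measurable E.
  have := measurable_1mcabs mD; move=> /(_ mD `]-oo, t[%classic (measurable_itv _)).
  by congr (measurable _); apply/seteqP; split => w [Aw] /=; rewrite in_itv.
have xyE x y : disc2 (x, y) -> x ^+ 2 + y ^+ 2 < 1.
  move=> dxy; have : cabs (mkC (x, y)) < 1 by [].
  have <- : cabs (mkC (x, y)) ^+ 2 = x ^+ 2 + y ^+ 2 := cabs_sqr _.
  by have := cabs_ge0 (mkC (x, y)); clear; nra.
have t4 : 0 <= 4 * t by rewrite mulr_ge0// ltW.
pose E1 : set (mT * mT) := E `&` [set w | `|w.2| <= 3 / 4]; pose E2 : set (mT * mT) := E `&` [set w | `|w.1| <= 3 / 4].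
have m34 : measurable [set x : mT | `|x| <= 3 / 4].
  have -> : [set x : mT | `|x| <= 3 / 4] = `[- (3 / 4), 3 / 4]%classic.
    by apply/seteqP; split => x /=; rewrite in_itv /= ler_norml.
  exact: measurable_itv.
have mE1 : measurable E1.
  apply: measurableI => //.
  have -> : [set w : mT * mT | `|w.2| <= 3 / 4] = setT `*` [set x : mT | `|x| <= 3 / 4].
    by apply/seteqP; split => w /=; [move=> h; split|case].
  exact: measurableX.
have mE2 : measurable E2.
  apply: measurableI => //.
  have -> : [set w : mT * mT | `|w.1| <= 3 / 4] = [set x : mT | `|x| <= 3 / 4] `*` setT.
    by apply/seteqP; split => w /=; [move=> h; split|case].
  exact: measurableX.
have l0 : 0 <= 3 / 4 :> R by rewrite divr_ge0.
have B1 : (mu2 E1 <= (4 * (4 * t) * (3 / 4))%:E)%E.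
  apply: mu2_slices1 => // [x y [_]//|y].
  have [y34|y34] := leP `|y| (3 / 4); last first.
    by exists 0, 0 => x [_ /=]; rewrite leNgt y34.
  exists (Num.sqrt (1 - y ^+ 2)), (- Num.sqrt (1 - y ^+ 2) + 4 * t) => x [[dxy xt] _].
  by apply: chord_slice => //; exact: xyE.
have B2 : (mu2 E2 <= (4 * (4 * t) * (3 / 4))%:E)%E.
  apply: mu2_slices2 => // [x y [_]//|x].
  have [x34|x34] := leP `|x| (3 / 4); last first.
    by exists 0, 0 => y [_ /=]; rewrite leNgt x34.
  exists (Num.sqrt (1 - x ^+ 2)), (- Num.sqrt (1 - x ^+ 2) + 4 * t) => y [[dxy xt] _].
  apply: chord_slice => //; first by rewrite addrC; exact: xyE.
  by rewrite [y ^+ 2 + _]addrC.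
apply: (@le_trans _ _ (mu2 (E1 `|` E2))).
  apply: le_measure; rewrite ?inE//; first exact: measurableU.
  move=> [x y] Exy; have [y34|y34] := leP `|y| (3 / 4); first by left; split.
  right; split => //=; have [dxy _] := Exy; have := xyE _ _ dxy.
  rewrite -(real_normK (num_real x)) -(real_normK (num_real y)); clear - y34.
  by have := normr_ge0 x; nra.
apply: le_trans (measureU2 _ mE1 mE2) _; apply: le_trans (leeD B1 B2) _.
by rewrite -EFinD lee_fin; clear; lra.
Qed.

Lemma radial_integral (be : R) : 0 < be < 1 -> exists K : R,
  (\int[mu2]_(w in disc2) ((1 - cabs (mkC w)) `^ (- be))%:E <= K%:E)%E.
Proof.
move=> /andP[be0 be1]; have mD := @measurable_disc2 R.
have q1 : 2^-1 `^ (1 - be) < 1 :> R by apply: half_powR_lt1; rewrite subr_gt0.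
have h0 : 0 < 2^-1 :> R by rewrite invr_gt0.
eexists; apply: (@dyadic_integral R _ _ mu2 disc2 (fun w => 1 - cabs (mkC w)) 24 1 2^-1 be 1
  mD (measurable_1mcabs mD) ltr01 h0 be0 _ q1) => //.
- by move=> w dw; rewrite subr_ge0 ltW.
- move=> w dw w0; apply: dyadic_down => //.
    by rewrite lt0r w0 subr_ge0 ltW.
  by have := cabs_ge0 (mkC w); clear; lra.
- by move=> t t0; rewrite expr1; exact: mu2_annulus.
Qed.

End Annulus.

(** * From [Q_s] to the Dirichlet space by superposition *)

Section Superposition.
Variable R : realType.
Local Notation C := (Cplx R).
Local Notation mT := (measurableTypeR R).
Implicit Types (f g phi : C -> C) (r t : R) (z a h c : C).
Local Notation mu2 := (@mu2 R).
Local Notation disc := (@disc R).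
Local Notation disc2 := (@disc2 R).

Lemma cderiv_comp phi f z d d' : cderiv f z d -> cderiv phi (f z) d' ->
  cderiv (phi \o f) z (d' * d).
Proof.
move=> fd pd e e0.
have dp := cabs_ge0 d; have dp' := cabs_ge0 d'.
have d10 : 0 < cabs d + 1 by rewrite ltr_wpDl.
have d10' : 0 < cabs d' + 1 by rewrite ltr_wpDl.
have [r1 r10 H1] := pd _ (divr_gt0 (divr_gt0 e0 (ltr0n _ 2)) d10).
have [r2 r20 H2] := fd _ ltr01.
have [r3 r30 H3] := fd _ (divr_gt0 (divr_gt0 e0 (ltr0n _ 2)) d10').
exists (Num.min (Num.min r2 r3) (r1 / (cabs d + 1))).
  by rewrite !lt_min r20 r30 divr_gt0.
move=> h; rewrite !lt_min ltr_pdivlMr// => /andP[/andP[h2 h3] h1].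
pose k := f (z + h) - f z.
have kh : cabs k <= (cabs d + 1) * cabs h.
  rewrite /k -(subrK (d * h) (f (z + h) - f z)); apply: le_trans (cabsD _ _) _.
  by rewrite cabsM; have := H2 _ h2; lra.
have kr : cabs k < r1 by apply: le_lt_trans kh _; rewrite mulrC.
have -> : (phi \o f) (z + h) - (phi \o f) z - d' * d * h =
   (phi (f z + k) - phi (f z) - d' * k) + d' * (f (z + h) - f z - d * h).
  by rewrite /k subrKC /=; ring.
apply: le_trans (cabsD _ _) _; rewrite cabsM.
have A1 : e / 2 / (cabs d + 1) * cabs k <= e / 2 * cabs h.
  by rewrite mulrAC ler_pdivrMr// -[leRHS]mulrA ler_pM2l ?divr_gt0// mulrC.
have A2 : cabs d' * cabs (f (z + h) - f z - d * h) <= e / 2 * cabs h.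
  apply: (@le_trans _ _ (cabs d' * (e / 2 / (cabs d' + 1) * cabs h))).
    by apply: ler_wpM2l => //; exact: H3.
  rewrite mulrA; apply: ler_wpM2r; first exact: cabs_ge0.
  by rewrite mulrA ler_pdivrMr// mulrC ler_pM2l ?divr_gt0// lerDl.
by have := H1 _ kr; move: A1 A2; clear; lra.
Qed.

Lemma derivable_superposition phi f z : derivable f z 1 -> derivable phi (f z) 1 ->
  derivable (superposition phi f) z 1 /\
  derive1 (superposition phi f) z = derive1 phi (f z) * derive1 f z.
Proof.
move=> /derivable_cderiv fd /derivable_cderiv pd.
have := cderiv_comp fd pd => H.
by split; [exact: cderiv_derivable H|exact: cderiv_derive1 H].
Qed.

(** One condition for order less than one and for order one with type zero, constants included; the
    equivalence is [type_zero_of_order] and [order_of_type_zero]. *)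
Definition type_zero phi := forall e : R, 0 < e ->
  exists K, forall z, cabs (phi z) <= K * expR (e * cabs z).

Lemma type_zero_deriv phi : entire phi -> type_zero phi -> type_zero (derive1 phi).
Proof.
move=> phe G e e0; have [K KP] := G e e0.
have K0 : 0 <= K.
  by have := KP 0; rewrite cabs0 mulr0 expR0 mulr1; exact: le_trans (cabs_ge0 _).
exists (4 * (K * expR (e * 2))) => z.
have := @cauchy_estimate _ phi z 1 (K * expR (e * (cabs z + 2))) ltr01 (fun w _ => phe w).
rewrite divr1 => H; apply: le_trans (H _) _.
  move=> w /square_cabs; rewrite mulr1 => wz; apply: le_trans (KP w) _.
  apply: ler_wpM2l => //; rewrite ler_expR ler_pM2l//.
  by have := cabs_sub w z; move: wz; clear; lra.
by rewrite mulrDr expRD; apply: le_of_eq; ring.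
Qed.

(* Young's inequality when [p < 2]; for [p >= 2] the factor [x ^ (p - 2)] is
   absorbed by [(x d) ^ (p - 2) <= B ^ (p - 2)]. *)
Lemma weighted_young (p s B : R) : 0 < p -> 0 < s -> s < 1 -> 0 < B ->
  exists eta K be : R, [/\ 0 < eta, 0 <= K, 0 < be < 1 & forall x d, 0 <= x -> 0 < d <= 1 -> x * d <= B ->
    d `^ (p - 1 - eta) * x `^ p <= K * (x ^+ 2 * d `^ s + d `^ (- be))].
Proof.
move=> p0 s0 s1 B0; have [p2|p2] := leP 2 p.
  (* With this [eta] the exponent of [d] is [s + (p - 2)], so nothing is lost; the value [1 / 2] is
     arbitrary between [0] and [1]. *)
  exists (1 - s), (B `^ (p - 2)), (1 / 2); split; [lra|exact: powR_ge0|lra|].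
  move=> x d x0 /andP[d0 d1] xd.
  have dn : d != 0 by rewrite gt_eqF.
  have -> : d `^ (p - 1 - (1 - s)) = d `^ s * d `^ (p - 2).
    by rewrite -powRD ?dn ?implybT//; congr (_ `^ _); ring.
  have -> : x `^ p = x ^+ 2 * x `^ (p - 2).
    rewrite -(powR_mulrn 2 x0) -powRD; first by congr (_ `^ _); ring.
    by rewrite (_ : 2 + (p - 2) = p); [rewrite gt_eqF|ring].
  rewrite mulrACA [d `^ s * _]mulrC [leRHS]mulrC [x ^+ 2 * _]mulrC [leLHS]mulrC [leRHS]mulrC.
  apply: ler_pM; rewrite ?mulr_ge0 ?powR_ge0 ?sqr_ge0//; last by rewrite lerDl powR_ge0.
  rewrite -powRM ?(ltW d0)//; apply: ge0_ler_powR.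
  - by rewrite subr_ge0.
  - by rewrite nnegrE mulr_ge0// ltW.
  - by rewrite nnegrE ltW.
  - by rewrite mulrC.
(* The exponent [g] that Young's inequality leaves on [d] must exceed [-1], which amounts to
   [2 * eta < p * (1 - s)]. *)
pose eta := p * (1 - s) / 4.
have eta0 : 0 < eta by rewrite divr_gt0// mulr_gt0// subr_gt0.
have q0 : 0 < 2 - p by rewrite subr_gt0.
pose u := p - 1 - eta - s * p / 2.
pose g := u * (2 / (2 - p)).
have g1 : -1 < g.
  rewrite /g mulrA ltr_pdivlMr// /u /eta.
  have : 0 < p * (1 - s) by rewrite mulr_gt0// subr_gt0.
  by clear; lra.
pose be := Num.max (- g) (1 / 2).
have be1 : be < 1 by rewrite gt_max; apply/andP; split; lra.
have be0 : 0 < be by rewrite lt_max; apply/orP; right; rewrite divr_gt0.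
exists eta, 1, be; split => //; first by rewrite be0 be1.
move=> x d x0 /andP[d0 d1] xd; rewrite mul1r.
have dn : d != 0 by rewrite gt_eqF.
pose a := x * d `^ (s / 2); pose b := d `^ u.
have a0 : 0 <= a by rewrite mulr_ge0 ?powR_ge0.
have b0 : 0 < b by exact: powR_gt0.
have E1 : d `^ (p - 1 - eta) * x `^ p = a `^ p * b.
  rewrite /a /b powRM ?powR_ge0// -powRrM -mulrA -powRD ?dn ?implybT// mulrC.
  by congr (_ * _ `^ _); rewrite /u; ring.
have E2 : x ^+ 2 * d `^ s = a ^+ 2.
  rewrite /a exprMn; congr (_ * _); rewrite -(powR_mulrn 2 (powR_ge0 _ _)) -powRrM.
  by congr (_ `^ _); field.
have E3 : b `^ (2 / (2 - p)) <= d `^ (- be).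
  rewrite /b -powRrM -/g; apply: ger_powR; first by rewrite d0 d1.
  by rewrite lerNl le_max lexx.
(* Young's inequality by cases: the product is at most the term of the dominating factor, according
   to whether [b] is below the power [2 - p] of [a]. *)
rewrite E1 E2; have [ba|ba] := leP b (a `^ (2 - p)).
  apply: (@le_trans _ _ (a ^+ 2)); last by rewrite lerDl powR_ge0.
  rewrite -(powR_mulrn 2 a0) (_ : 2%:R = p + (2 - p)); last by ring.
  rewrite powRD; first by apply: ler_wpM2l => //; exact: powR_ge0.
  by rewrite (_ : p + (2 - p) = 2) ?pnatr_eq0//; ring.
apply: (@le_trans _ _ (b `^ (2 / (2 - p)))); last first.
  by apply: (le_trans E3); rewrite lerDr sqr_ge0.
have -> : 2 / (2 - p) = p / (2 - p) + 1 by field; rewrite gt_eqF.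
rewrite powRD ?(gt_eqF b0) ?implybT// powRr1 ?(ltW b0)//.
apply: ler_wpM2r; first exact: ltW.
have -> : a `^ p = (a `^ (2 - p)) `^ (p / (2 - p)).
  by rewrite -powRrM; congr (_ `^ _); field; rewrite gt_eqF.
apply: ge0_ler_powR; [by rewrite divr_ge0// ltW|by rewrite nnegrE powR_ge0|by rewrite nnegrE ltW|exact: ltW].
Qed.

(** Take the pole at [0]: there the Green function is [- ln |z| >= 1 - |z|]. *)
Lemma Qspace_area (s : R) f : 0 < s -> Qspace s f -> exists K : R,
  (\int[mu2]_(w in disc2) (cabs (derive1 f (mkC w)) ^+ 2 * (1 - cabs (mkC w)) `^ s)%:E <= K%:E)%E.
Proof.
move=> s0 [fh Sfin]; have mD := @measurable_disc2 R.
set u := fun w => cabs (derive1 f (mkC w)) ^+ 2 * (1 - cabs (mkC w)) `^ s.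
have u0 w : 0 <= u w by rewrite mulr_ge0 ?powR_ge0// sqr_ge0.
have fc w : disc w -> ccts (derive1 f) w.
  move=> dw; have d0 : 0 < (1 - cabs w) / 4 by rewrite divr_gt0// subr_gt0.
  by apply: deriv_ccts d0 _ => z /(square_disc dw)[_]; exact: fh.
have mf : measurable_fun disc2 (fun w => cabs (derive1 f (mkC w))).
  by apply: ccts_measurable => // w Dw; exact: fc.
have mu : measurable_fun disc2 u.
  apply: measurable_funM; first exact: measurable_funX.
  exact: (measurableT_comp (measurable_powR _) (measurable_1mcabs mD)).
(* At the origin the totalised Green function is [0] and the comparison fails; this null set is
   removed first. *)
pose N : set (mT * mT) := [set 0] `*` [set 0].
have mN : measurable N by apply: measurableX; exact: measurable_set1.
have mN0 : mu2 N = 0.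
  rewrite /mu2 product_measure1E; [|exact: measurable_set1|exact: measurable_set1].
  by rewrite [X in (X * _)%E](lebesgue_measure_set1 (0 : R)) mul0e.
have [K KP] : exists K : R, (int_disc (fun z => cabs (derive1 f z) ^+ 2 * green z 0 `^ s)%R <= K%:E)%E.
  move: Sfin; set S := [set int_disc _ | a in _] => Sfin.
  have uS : (int_disc (fun z => (cabs (derive1 f z) ^+ 2 * green z 0 `^ s)%R) <= ereal_sup S)%E.
    by apply: ereal_sup_ubound; exists 0 => //; exact: disc0.
  have S0 : (0 <= ereal_sup S)%E.
    apply: le_trans uS.
    by apply: integral_ge0 => w _; rewrite lee_fin mulr_ge0 ?powR_ge0// sqr_ge0.
  by exists (fine (ereal_sup S)); rewrite fineK// ge0_fin_numE.
exists (pi * K).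
rewrite (@ge0_negligible_integral _ _ _ mu2 disc2 N)//; last 2 first.
- exact/measurable_EFinP.
- by move=> w _; rewrite lee_fin; exact: u0.
have mDN : measurable (disc2 `\` N) by exact: measurableD.
apply: integral_mu2_le; [exact: mDN|exact: measurable_funS mu|by move=> w _; exact: u0|].
apply: le_trans KP; apply: ge0_le_integral_set => [w []//|w _|w _|w [Dw Nw]].
- by rewrite lee_fin; exact: u0.
- by rewrite lee_fin mulr_ge0 ?powR_ge0// sqr_ge0.
rewrite lee_fin; apply: ler_wpM2l; first exact: sqr_ge0.
have w1 : cabs (mkC w) < 1 by [].
have w0 : 0 < cabs (mkC w).
  by apply: cabs_gt0; apply: contra_notN Nw => /eqP; case: (w) => x y [-> ->]; split.
have -> : green (mkC w) 0 = - ln (cabs (mkC w)).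
  rewrite /green (_ : conjc (0 : C) = 0); last by rewrite /conjc /= oppr0.
  by rewrite mul0r !subr0 cabsM cabs1 mul1r cabsV lnV.
have lw : 1 - cabs (mkC w) <= - ln (cabs (mkC w)).
  have := @le_ln1Dx R (cabs (mkC w) - 1); rewrite subrKC => H.
  have := H _; have : -1 < cabs (mkC w) - 1 by lra.
  by move=> h /(_ h); lra.
apply: ge0_ler_powR; [exact: ltW|by rewrite nnegrE subr_ge0 ltW| |exact: lw].
by rewrite nnegrE (le_trans _ lw)// subr_ge0 ltW.
Qed.

Lemma superposition_Dirichlet phi f (s p : R) : 0 < s -> s < 1 -> 0 < p -> entire phi ->
  type_zero phi -> Qspace s f -> Dirichlet p (p - 1) (superposition phi f).
Proof.
move=> s0 s1 p0 phe G Qf; have [fh _] := Qf; have mD := @measurable_disc2 R.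
have dd z : disc z -> derivable (superposition phi f) z 1 /\
  derive1 (superposition phi f) z = derive1 phi (f z) * derive1 f z.
  by move=> dz; apply: derivable_superposition; [exact: fh|exact: phe].
split; first by move=> z /dd[].
have [B0 B00 HB0] := Qspace_bloch s0 Qf.
pose B := B0 + 1; have B1 : 0 < B by rewrite ltr_wpDl.
have HB z : disc z -> cabs (derive1 f z) * (1 - cabs z) <= B.
  by move=> /HB0; rewrite /B; lra.
have [eta [K [be [eta0 K0 be01 HK]]]] := weighted_young p0 s0 s1 B1.
have pB : 0 < p * B by rewrite mulr_gt0.
(* As [|f| <= |f 0| - B ln (1 - |z|)], the rate [eta / (p * B)] makes [phi'(f z)] a multiple of the
   power [- eta / p] of [1 - |z|]; raised to [p], it costs exactly [eta]. *)
have [A HA] := type_zero_deriv phe G (divr_gt0 eta0 pB).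
have A0 : 0 <= A.
  by have := HA 0; rewrite cabs0 mulr0 expR0 mulr1; exact: le_trans (cabs_ge0 _).
pose A1 := A * expR (eta / (p * B) * cabs (f 0)).
have A10 : 0 <= A1 by rewrite mulr_ge0// expR_ge0.
have phf z : disc z -> cabs (derive1 phi (f z)) <= A1 * (1 - cabs z) `^ (- (eta / p)).
  move=> dz; have d0 : 0 < 1 - cabs z by rewrite subr_gt0.
  apply: le_trans (HA _) _; rewrite /A1 -mulrA; apply: ler_wpM2l => //.
  rewrite /powR gt_eqF// -expRD ler_expR.
  have := bloch_growth fh (ltW B1) HB dz => bg.
  have ep : 0 < eta / (p * B) by rewrite divr_gt0.
  apply: le_trans (ler_wpM2l (ltW ep) bg) _.
  apply: le_of_eq; field.
  by rewrite !gt_eqF.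
pose c := 2 `^ p * A1 `^ p * K.
have c0 : 0 <= c by rewrite !mulr_ge0// powR_ge0.
pose v1 (w : mT * mT) := cabs (derive1 f (mkC w)) ^+ 2 * (1 - cabs (mkC w)) `^ s.
pose v2 (w : mT * mT) := (1 - cabs (mkC w)) `^ (- be).
have fc w : disc w -> ccts (derive1 f) w.
  move=> dw; have d0 : 0 < (1 - cabs w) / 4 by rewrite divr_gt0// subr_gt0.
  by apply: deriv_ccts d0 _ => z /(square_disc dw)[_]; exact: fh.
have mv1 : measurable_fun disc2 v1.
  apply: measurable_funM.
    by apply: measurable_funX; apply: ccts_measurable => // w Dw; exact: fc.
  exact: (measurableT_comp (measurable_powR _) (measurable_1mcabs mD)).
have mv2 : measurable_fun disc2 v2.
  exact: (measurableT_comp (measurable_powR _) (measurable_1mcabs mD)).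
have v10 w : 0 <= v1 w by rewrite mulr_ge0 ?powR_ge0// sqr_ge0.
have v20 w : 0 <= v2 w by rewrite powR_ge0.
apply: (@le_lt_trans _ _ (\int[mu2]_(w in disc2) (c * (v1 w + v2 w))%:E)%E).
  apply: int_disc_le.
    by apply: measurable_funM => //; exact: measurable_funD.
  move=> w Dw; rewrite mulr_ge0 ?powR_ge0//=.
  have dw : disc (mkC w) by [].
  have w1 : cabs (mkC w) < 1 by []; have w0 := cabs_ge0 (mkC w).
  have [_ ->] := dd _ dw; set d := 1 - cabs (mkC w).
  have d0 : 0 < d by rewrite subr_gt0.
  have d1 : d <= 1 by rewrite lerBlDr lerDl.
  set x := cabs (derive1 f (mkC w)).
  have x0 : 0 <= x by exact: cabs_ge0.
  (* [1 - |w|^2] lies between [d] and [2 * d]; which end is used depends on the sign of [p - 1]. *)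
  have W : (1 - cabs (mkC w) ^+ 2) `^ (p - 1) <= 2 `^ p * d `^ (p - 1).
    have e0 : 0 <= 1 - cabs (mkC w) ^+ 2 by rewrite subr_ge0 expr_le1// ltW.
    have [p1|p1] := leP 1 p.
      apply: (@le_trans _ _ ((2 * d) `^ (p - 1))).
        apply: ge0_ler_powR; rewrite ?subr_ge0// ?nnegrE//; first by rewrite mulr_ge0// ltW.
        by rewrite /d; clear; have := sqr_ge0 (cabs (mkC w) - 1); rewrite sqrrB1; lra.
      rewrite powRM ?(ltW d0)//; apply: ler_wpM2r; first exact: powR_ge0.
      by apply: ler_powR; [rewrite ler1n|rewrite lerBlDr lerDl].
    apply: (@le_trans _ _ (d `^ (p - 1))).
      rewrite -[p - 1]opprB; apply: ler_powRn => //; last by rewrite subr_ge0 ltW.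
      by rewrite /d; clear - w0 w1; nra.
    rewrite ler_peMl ?powR_ge0// -[leLHS](powRr0 2); apply: ler_powR; [by rewrite ler1n|exact: ltW].
  have P : cabs (derive1 phi (f (mkC w)) * derive1 f (mkC w)) `^ p <=
     A1 `^ p * d `^ (- eta) * x `^ p.
    have Y : cabs (derive1 phi (f (mkC w))) `^ p <= A1 `^ p * d `^ (- eta).
      apply: (@le_trans _ _ ((A1 * d `^ (- (eta / p))) `^ p)).
        apply: ge0_ler_powR; [exact: ltW|by rewrite nnegrE cabs_ge0|by rewrite nnegrE mulr_ge0 ?powR_ge0|exact: phf].
      rewrite powRM ?powR_ge0// -powRrM; apply: le_of_eq.
      by congr (_ * _ `^ _); field; rewrite gt_eqF.
    rewrite cabsM (powRM _ (cabs_ge0 _) x0).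
    exact: (ler_wpM2r (powR_ge0 x p) Y).
  apply: (le_trans (ler_pM (powR_ge0 _ _) (powR_ge0 _ _) W P)).
  have -> : 2 `^ p * d `^ (p - 1) * (A1 `^ p * d `^ (- eta) * x `^ p) =
    2 `^ p * A1 `^ p * (d `^ (p - 1 - eta) * x `^ p).
    by rewrite (powRD (r := p - 1)) ?(gt_eqF d0) ?implybT//; ring.
  rewrite /c -[leRHS]mulrA; apply: ler_wpM2l; first by rewrite mulr_ge0 ?powR_ge0.
  by apply: HK => //; [rewrite d0|exact: HB].
under eq_integral do rewrite EFinM EFinD.
rewrite ge0_integralZl_EFin//; first last.
- by apply: emeasurable_funD; exact/measurable_EFinP.
- by move=> w _; rewrite adde_ge0// lee_fin.
rewrite ge0_integralD//; first last.
- exact/measurable_EFinP.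
- by move=> w _; rewrite lee_fin.
- exact/measurable_EFinP.
- by move=> w _; rewrite lee_fin.
have [I1 H1] := Qspace_area s0 Qf; have [I2 H2] := radial_integral be01.
apply: (@le_lt_trans _ _ (c%:E * (I1%:E + I2%:E))%E).
  by apply: lee_wpmul2l; [rewrite lee_fin|exact: leeD].
by rewrite -EFinD -EFinM ltry.
Qed.

End Superposition.

(** * Test functions in Q_s and necessity *)

Section TestFunctions.
Variable R : realType.
Local Notation C := (Cplx R).
Implicit Types (f g phi : C -> C) (z a h c : C).
Local Notation disc := (@disc R).
Local Notation Rez z := (complex.Re (z : R[i])).
Local Notation Imz z := (complex.Im (z : R[i])).

Lemma geo_sum_le (n : nat) : \sum_(0 <= j < n) (2 ^+ j)^-1 <= 2 :> R.
Proof.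
suff : \sum_(0 <= j < n) (2 ^+ j)^-1 = 2 - 2 / 2 ^+ n :> R.
  by move=> ->; rewrite gerBl divr_ge0// exprn_ge0.
elim: n => [|n ih]; first by rewrite big_nil expr0 divr1 subrr.
by rewrite big_nat_recr//= ih exprS; field; rewrite expf_neq0.
Qed.

(** The lower ends [s n - t n] of the intervals around the partial sums are bounded by all the upper
    ends; their supremum is the sum, with the explicit tail that the construction of test functions
    needs. *)
Lemma real_sum_lim (u : nat -> R) (K : R) : (forall j, `|u j| <= K / 2 ^+ j) ->
  exists S, forall n, `|S - \sum_(0 <= j < n) u j| <= 2 * K / 2 ^+ n.
Proof.
move=> uK; pose s n := \sum_(0 <= j < n) u j.
pose t (n : nat) := 2 * K / 2 ^+ n : R.
have K0 : 0 <= K by have := uK 0%N; rewrite expr0 divr1; exact: le_trans.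
have t0 n : 0 <= t n by rewrite divr_ge0 ?exprn_ge0// mulr_ge0.
have st n k : `|s (n + k)%N - s n| <= t n - t (n + k)%N.
  elim: k => [|k ih]; first by rewrite addn0 !subrr normr0.
  rewrite addnS {1}/s big_nat_recr//= -/(s (n + k)%N).
  have -> : s (n + k)%N + u (n + k)%N - s n = (s (n + k)%N - s n) + u (n + k)%N by ring.
  apply: le_trans (ler_normD _ _) _; apply: le_trans (lerD ih (uK _)) _.
  apply: le_of_eq; rewrite /t exprS; field.
  by rewrite !expf_neq0.
pose A := [set s n - t n | n in setT].
have ub n m : s n - t n <= s m + t m.
  have [nm|mn] := leqP n m.
    by have := st n (m - n)%N; rewrite subnKC// ler_norml; have := t0 m; have := t0 n; lra.
  by have := st m (n - m)%N; rewrite subnKC ?(ltnW mn)// ler_norml; have := t0 m; have := t0 n; lra.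
have hA : has_sup A.
  by split; [exists (s 0%N - t 0%N); exists 0%N|exists (s 0%N + t 0%N) => _ [n _ <-]].
exists (sup A) => n; rewrite -/(s n) -/(t n).
have h1 : s n - t n <= sup A by apply: (sup_upper_bound hA); exists n.
have h2 : sup A <= s n + t n by apply: ge_sup; [case: hA|move=> _ [m _ <-]].
by rewrite ler_norml; lra.
Qed.

Lemma Re_sum (u : nat -> C) n : Rez (\sum_(0 <= j < n) u j) = \sum_(0 <= j < n) Rez (u j).
Proof.
elim: n => [|n ih]; first by rewrite !big_nil.
by rewrite !big_nat_recr//= -ih; case: (\sum_(0 <= i < n) u i) (u n) => [? ?] [? ?].
Qed.

Lemma Im_sum (u : nat -> C) n : Imz (\sum_(0 <= j < n) u j) = \sum_(0 <= j < n) Imz (u j).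
Proof.
elim: n => [|n ih]; first by rewrite !big_nil.
by rewrite !big_nat_recr//= -ih; case: (\sum_(0 <= i < n) u i) (u n) => [? ?] [? ?].
Qed.

Lemma complex_sum_lim (u : nat -> C) (K : R) : (forall j, cabs (u j) <= K / 2 ^+ j) ->
  exists S : C, forall n, cabs (S - \sum_(0 <= j < n) u j) <= 4 * K / 2 ^+ n.
Proof.
move=> uK.
have [x xP] := @real_sum_lim (fun j => Rez (u j)) K (fun j => le_trans (ler_Re_cabs _) (uK j)).
have [y yP] := @real_sum_lim (fun j => Imz (u j)) K (fun j => le_trans (ler_Im_cabs _) (uK j)).
exists (mkC (x, y)) => n; rewrite -(mkCE (\sum_(0 <= j < n) u j)) Re_sum Im_sum -mkCB.
apply: le_trans (cabs_mkC_le _ _) _; apply: le_trans (lerD (xP n) (yP n)) _.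
by apply: le_of_eq; ring.
Qed.

Lemma cabs_sum_le (u : nat -> C) n : cabs (\sum_(0 <= j < n) u j) <= \sum_(0 <= j < n) cabs (u j).
Proof.
elim: n => [|n ih]; first by rewrite !big_nil cabs0.
by rewrite !big_nat_recr//=; apply: le_trans (cabsD _ _) _; rewrite lerD2r.
Qed.

(* Summands of the test functions: a dyadic discretisation of [log (1 / (1 - z))]. *)
Definition pole (j : nat) z : C := 1 + cof (2 ^+ j) * (1 - z).

Lemma disc_Re z : disc z -> 0 < Rez (1 - z).
Proof.
move=> dz; have z1 : cabs z < 1 by [].
have := le_lt_trans (le_trans (ler_norm _) (ler_Re_cabs z)) z1.
by case: (z) => x y /=; rewrite subr_gt0.
Qed.

Lemma disc_1m z : disc z -> 0 < cabs (1 - z).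
Proof.
move=> /disc_Re h; apply: lt_le_trans h _; exact: le_trans (ler_norm _) (ler_Re_cabs _).
Qed.

(** The cross term in the squared modulus of [1 + l (1 - z)] is nonnegative because
    [Re (1 - z) > 0]. *)
Lemma pole_lower j z : disc z -> 1 + (2 ^+ j * cabs (1 - z)) ^+ 2 <= cabs (pole j z) ^+ 2.
Proof.
move=> dz; have h := disc_Re dz; have p2 : 0 < 2 ^+ j :> R by rewrite exprn_gt0.
rewrite exprMn !cabs_sqr /pole; move: h p2; move: (1 - z) (2 ^+ j) => [x y] l /= x0 l0.
have : 0 <= l * x by rewrite mulr_ge0// ltW.
by clear; nra.
Qed.

Lemma pole_ge j z : disc z -> 2 ^+ j * cabs (1 - z) <= cabs (pole j z).
Proof.
move=> dz; have h := pole_lower j dz.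
have p2 : 0 <= 2 ^+ j * cabs (1 - z) by rewrite mulr_ge0 ?cabs_ge0// exprn_ge0.
rewrite -(@ler_pXn2r _ 2)// ?nnegrE ?cabs_ge0//; apply: le_trans h.
by rewrite lerDr.
Qed.

Lemma pole_gt0 j z : disc z -> 0 < cabs (pole j z).
Proof.
by move=> dz; apply: lt_le_trans (pole_ge j dz); rewrite mulr_gt0 ?disc_1m// exprn_gt0.
Qed.

Lemma pole_neq0 j z : disc z -> pole j z != 0.
Proof. by move=> /(pole_gt0 j); apply: contraTneq => ->; rewrite cabs0 ltxx. Qed.

(** With [t = 2^j |1 - z|], the inequality [(1 + 2 t) (1 + t) <= 4 (1 + t^2)] bounds each term by an
    increment of [u (t) = t / (1 + t)] from [t] to [2 t]. The sum telescopes and [u] stays between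
    [0] and [1]. *)
Lemma pole_deriv_sum z n : disc z ->
  \sum_(0 <= j < n) (2 ^+ j / cabs (pole j z) ^+ 2) <= 4 / cabs (1 - z).
Proof.
move=> dz; have d0 := disc_1m dz; set d := cabs (1 - z).
pose u (t : R) := t / (1 + t).
have u1 (t : R) : 0 <= t -> 0 <= u t <= 1.
  by move=> t0; rewrite /u divr_ge0 ?addr_ge0//= ler_pdivrMr ?mul1r ?lerDr// ltr_wpDr.
have step j : 2 ^+ j / cabs (pole j z) ^+ 2 <= 4 / d * (u (2 ^+ j.+1 * d) - u (2 ^+ j * d)).
  have l0 : 0 < 2 ^+ j :> R by rewrite exprn_gt0.
  have := pole_lower j dz; rewrite -/d [2 ^+ j.+1]exprS; set P := cabs _ ^+ 2.
  move: (2 ^+ j) l0 => l l0 h; pose t := l * d.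
  have t0 : 0 < t by rewrite mulr_gt0.
  have -> : 4 / d * (u (2 * l * d) - u (l * d)) = l / ((1 + 2 * t) * (1 + t) / 4).
    by rewrite /u /t; field; rewrite !gt_eqF//; move: t0; rewrite /t; clear; lra.
  have P0 : 0 < (1 + 2 * t) * (1 + t) / 4.
    by rewrite divr_gt0// mulr_gt0//; move: t0; clear; lra.
  rewrite ler_pM2l// lef_pV2 ?posrE//; first by move: h; rewrite -/t; clear - t0; nra.
  by apply: lt_le_trans h; rewrite ltr_wpDr ?sqr_ge0.
apply: (@le_trans _ _ (4 / d * (u (2 ^+ n * d) - u (2 ^+ 0 * d)))).
  elim: n => [|n ih]; first by rewrite big_nil subrr mulr0.
  by rewrite big_nat_recr//=; have := step n; move: ih; clear; lra.
rewrite ler_piMr ?divr_ge0 ?(ltW d0)//.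
have p (k : nat) : 0 <= 2 ^+ k * d by rewrite mulr_ge0 ?(ltW d0)// exprn_ge0.
by have := u1 _ (p n); have := u1 _ (p 0%N); clear; lra.
Qed.

Definition grid (n : nat) : C := cof (1 - (2 ^+ n)^-1).

Lemma grid_disc n : disc (grid n) /\ 1 - cabs (grid n) = (2 ^+ n)^-1.
Proof.
have p0 : 0 < (2 ^+ n)^-1 :> R by rewrite invr_gt0 exprn_gt0.
have p1 : (2 ^+ n)^-1 <= 1 :> R by rewrite invf_le1 ?exprn_gt0// exprn_ege1// ler1n.
have E : cabs (grid n) = 1 - (2 ^+ n)^-1 by rewrite cabs_cof ger0_norm// subr_ge0.
split; last by rewrite E subKr.
by change (is_true (cabs (grid n) < 1)); rewrite E gtrBl.
Qed.

Definition weight (n j : nat) : R := (1 + 2 ^+ j / 2 ^+ n)^-1.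

Lemma pole_grid n j : (pole j (grid n))^-1 = cof (weight n j).
Proof.
rewrite /pole /grid /weight cofV; congr (_^-1).
by rewrite -cof1 -cofB -cofM -cofD subKr.
Qed.

(** [f] is the sum of [c j / pole j] and [g] that of the termwise derivatives. Differentiability
    comes from a quadratic Taylor remainder that is uniform over partial sums. *)
Lemma test_function (c : nat -> C) (L : R) : (forall j, cabs (c j) <= L) ->
  exists2 f, Hol_disc f & (forall z, disc z -> cabs (derive1 f z) * cabs (1 - z) <= 4 * L) /\
    forall n m, cabs (f (grid n) - \sum_(0 <= j < m) c j * cof (weight n j)) <= 4 * L * 2 ^+ n / 2 ^+ m.
Proof.
move=> cL; have L0 : 0 <= L by apply: le_trans (cabs_ge0 _) (cL 0%N).
have p2 j : 0 < 2 ^+ j :> R by rewrite exprn_gt0.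
have term z j : disc z -> cabs (c j / pole j z) <= L / cabs (1 - z) / 2 ^+ j.
  move=> dz; have d0 := disc_1m dz; rewrite cabsM cabsV.
  rewrite -mulrA -invfM; apply: ler_pM; rewrite ?cabs_ge0 ?invr_ge0 ?cabs_ge0//.
  by rewrite lef_pV2 ?posrE ?mulr_gt0// ?pole_gt0// mulrC pole_ge.
have term' z j : disc z -> cabs (c j * cof (2 ^+ j) / pole j z ^+ 2) <= L / cabs (1 - z) ^+ 2 / 2 ^+ j.
  move=> dz; have d0 := disc_1m dz; rewrite !cabsM cabsV cabsX cabs_cof gtr0_norm//.
  rewrite -!mulrA; apply: ler_pM; rewrite ?cabs_ge0 ?mulr_ge0 ?invr_ge0 ?exprn_ge0 ?cabs_ge0//.
  rewrite ler_pdivrMr ?exprn_gt0 ?pole_gt0//.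
  have h : (2 ^+ j * cabs (1 - z)) ^+ 2 <= cabs (pole j z) ^+ 2.
    by apply: le_trans (pole_lower j dz); rewrite lerDr.
  have q0 : 0 < (cabs (1 - z) ^+ 2)^-1 / 2 ^+ j by rewrite divr_gt0// invr_gt0 exprn_gt0.
  apply: le_trans (ler_wpM2l (ltW q0) h); apply: le_of_eq.
  by field; rewrite !gt_eqF.
have /choice[f fP] : forall z, exists S : C, disc z -> forall n,
    cabs (S - \sum_(0 <= j < n) c j / pole j z) <= 4 * (L / cabs (1 - z)) / 2 ^+ n.
  move=> z; have [dz|nd] := pselect (disc z); last by exists 0.
  by have [S SP] := complex_sum_lim (fun j => term z j dz); exists S.
have /choice[g gP] : forall z, exists S : C, disc z -> forall n,
    cabs (S - \sum_(0 <= j < n) c j * cof (2 ^+ j) / pole j z ^+ 2) <= 4 * (L / cabs (1 - z) ^+ 2) / 2 ^+ n.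
  move=> z; have [dz|nd] := pselect (disc z); last by exists 0.
  by have [S SP] := complex_sum_lim (fun j => term' z j dz); exists S.
have small (x y K : R) : (forall n : nat, x <= y + K / 2 ^+ n) -> x <= y.
  move=> H; apply/ler_addgt0Pl => e e0.
  pose n := (Num.truncn (`|K| / e)).+1; apply: le_trans (H n) _; rewrite addrC lerD2r.
  rewrite ler_pdivrMr//; apply: le_trans (ler_norm _) _; rewrite mulrC -ler_pdivrMr//.
  apply: le_trans (ltW (truncnS_gt _)) _.
  by rewrite -natrX ler_nat ltnW// ltn_expl.
(* With [P = pole j z] and [l = 2^j], the remainder of [1 / P] is exactly
   [l^2 w^2 / (P^2 (P - l w))]; three factors of size at least [l |1 - z|], up to a factor [2],
   leave the summable [1 / l]. *)
have rem z w j : disc z -> cabs w <= cabs (1 - z) / 2 -> disc (z + w) ->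
   cabs (c j / pole j (z + w) - c j / pole j z - c j * cof (2 ^+ j) / pole j z ^+ 2 * w) <=
   2 * L * cabs w ^+ 2 / cabs (1 - z) ^+ 3 * (2 ^+ j)^-1.
  move=> dz wd dzw; have d0 := disc_1m dz; set d := cabs (1 - z) in wd d0 *.
  have n1 := pole_neq0 j dz; have n2 := pole_neq0 j dzw.
  have -> : c j / pole j (z + w) - c j / pole j z - c j * cof (2 ^+ j) / pole j z ^+ 2 * w =
    c j * cof (2 ^+ j) ^+ 2 * w ^+ 2 / (pole j z ^+ 2 * pole j (z + w)).
    have E : pole j (z + w) = pole j z - cof (2 ^+ j) * w by rewrite /pole; ring.
    by rewrite E in n2 *; field; rewrite n1 n2.
  rewrite !cabsM cabsV cabsM !cabsX cabs_cof gtr0_norm//.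
  have h1 : (2 ^+ j * d) ^+ 2 <= cabs (pole j z) ^+ 2.
    by apply: le_trans (pole_lower j dz); rewrite lerDr.
  have h2 : 2 ^+ j * (d / 2) <= cabs (pole j (z + w)).
    apply: le_trans (pole_ge j dzw); rewrite ler_pM2l//.
    by have := cabs_sub (1 - z) w; rewrite -/d opprD addrA; move: wd; clear; lra.
  have h3 : (2 ^+ j * d) ^+ 2 * (2 ^+ j * (d / 2)) <= cabs (pole j z) ^+ 2 * cabs (pole j (z + w)).
    by apply: ler_pM => //; [exact: sqr_ge0|apply: mulr_ge0; [exact: ltW|rewrite divr_ge0// ltW]].
  have h4 : 0 < (2 ^+ j * d) ^+ 2 * (2 ^+ j * (d / 2)) by rewrite !(mulr_gt0, exprn_gt0, divr_gt0).
  rewrite ler_pdivrMr ?(lt_le_trans h4)//.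
  have q0 : 0 <= 2 * L * cabs w ^+ 2 / d ^+ 3 / 2 ^+ j.
    by rewrite divr_ge0 ?(ltW (p2 j))// divr_ge0 ?(exprn_ge0 _ (ltW d0))// !mulr_ge0 ?cabs_ge0.
  apply: le_trans (ler_wpM2l q0 h3).
  have -> : 2 * L * cabs w ^+ 2 / d ^+ 3 / 2 ^+ j * ((2 ^+ j * d) ^+ 2 * (2 ^+ j * (d / 2))) =
    L * (2 ^+ j) ^+ 2 * cabs w ^+ 2 by field; rewrite !gt_eqF.
  rewrite -!mulrA; apply: ler_wpM2r (cL j).
  by rewrite !mulr_ge0 ?cabs_ge0 ?(ltW (p2 j)).
have fg z : disc z -> cderiv f z (g z).
  move=> dz; have d0 := disc_1m dz; set d := cabs (1 - z) in d0.
  have key w : cabs w <= d / 2 -> disc (z + w) ->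
      cabs (f (z + w) - f z - g z * w) <= 4 * L * cabs w ^+ 2 / d ^+ 3.
    move=> wd dzw; apply: (small _ _ (4 * (L / cabs (1 - (z + w))) + 4 * (L / d) + 4 * (L / d ^+ 2) * cabs w)) => n.
    have F1 := fP _ dzw n; have F2 := fP _ dz n; have F3 := gP _ dz n.
    set s1 := \sum_(0 <= j < n) _ in F1; set s2 := \sum_(0 <= j < n) _ in F2; set s3 := \sum_(0 <= j < n) _ in F3.
    have S : cabs (s1 - s2 - s3 * w) <= 4 * L * cabs w ^+ 2 / d ^+ 3.
      have -> : s1 - s2 - s3 * w = \sum_(0 <= j < n)
         (c j / pole j (z + w) - c j / pole j z - c j * cof (2 ^+ j) / pole j z ^+ 2 * w).
        by rewrite /s1 /s2 /s3 mulr_suml -!sumrB.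
      apply: le_trans (cabs_sum_le _ _) _.
      apply: (@le_trans _ _ (\sum_(0 <= j < n) (2 * L * cabs w ^+ 2 / d ^+ 3 * (2 ^+ j)^-1))).
        by apply: ler_sum => j _; exact: rem.
      rewrite -mulr_sumr; apply: le_trans (ler_wpM2l _ (geo_sum_le n)) _.
        by rewrite divr_ge0 ?(exprn_ge0 _ (ltW d0))// !mulr_ge0 ?cabs_ge0.
      by apply: le_of_eq; ring.
    have -> : f (z + w) - f z - g z * w = (f (z + w) - s1) - (f z - s2) - (g z - s3) * w + (s1 - s2 - s3 * w) by ring.
    apply: le_trans (cabsD _ _) _; rewrite addrC; apply: lerD => //.
    apply: le_trans (cabsB _ _) _; rewrite cabsM.
    have H3 := ler_wpM2r (cabs_ge0 w) F3; have H12 := cabsB (f (z + w) - s1) (f z - s2).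
    by move: F1 F2 H3 H12; rewrite -/d; clear; lra.
  move=> e e0; have dz1 : 0 < 1 - cabs z by rewrite subr_gt0.
  have q0 : 0 < e * d ^+ 3 / (4 * L + 1) by rewrite divr_gt0 ?mulr_gt0 ?exprn_gt0// ltr_wpDl// mulr_ge0.
  exists (Num.min (Num.min (d / 2) (1 - cabs z)) (e * d ^+ 3 / (4 * L + 1))).
    by rewrite !lt_min dz1 q0 divr_gt0.
  move=> w; rewrite !lt_min => /andP[/andP[w1 w2] w3].
  have dzw : disc (z + w).
    change (is_true (cabs (z + w) < 1)); apply: le_lt_trans (cabsD _ _) _.
    by move: w2; clear; lra.
  apply: le_trans (key w (ltW w1) dzw) _.
  have -> : 4 * L * cabs w ^+ 2 / d ^+ 3 = 4 * L * cabs w / d ^+ 3 * cabs w by ring.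
  apply: ler_wpM2r (cabs_ge0 w) _ _ _.
  have L1 : 0 < 4 * L + 1 by rewrite ltr_wpDl// mulr_ge0.
  move: w3; rewrite ltr_pdivlMr// => w3.
  rewrite ler_pdivrMr ?exprn_gt0//; apply: le_trans (ltW w3).
  by have := cabs_ge0 w; clear - L0; nra.
exists f; first by move=> z /fg/cderiv_derivable.
split=> [z dz|n m].
  rewrite (cderiv_derive1 (fg z dz)); have d0 := disc_1m dz.
  rewrite -ler_pdivlMr//; apply: (small _ _ (4 * (L / cabs (1 - z) ^+ 2))) => n.
  have F3 := gP _ dz n; set s3 := \sum_(0 <= j < n) _ in F3.
  rewrite -(subrK s3 (g z)) addrC; apply: le_trans (cabsD _ _) _; rewrite addrC [leRHS]addrC.
  apply: lerD => //; apply: le_trans (cabs_sum_le _ _) _.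
  apply: (@le_trans _ _ (\sum_(0 <= j < n) L * (2 ^+ j / cabs (pole j z) ^+ 2))).
    apply: ler_sum => j _; rewrite !cabsM cabsV cabsX cabs_cof gtr0_norm// -mulrA.
    by apply: ler_wpM2r => //; rewrite divr_ge0 ?exprn_ge0 ?cabs_ge0.
  rewrite -mulr_sumr; apply: le_trans (ler_wpM2l L0 (pole_deriv_sum n dz)) _.
  by apply: le_of_eq; ring.
(* At the grid point [1 / |1 - z| = 2^n], which is the factor in the tail estimate. *)
have [gd _] := grid_disc n; have := fP _ gd m.
have -> : cabs (1 - grid n) = (2 ^+ n)^-1.
  by rewrite /grid -cof1 -cofB subKr cabs_cof gtr0_norm// invr_gt0.
rewrite invrK mulrA; apply: le_trans; apply: le_of_eq; congr (cabs (_ - _)).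
by apply: eq_bigr => j _; rewrite pole_grid.
Qed.

End TestFunctions.

(** * Prescribing values on the grid, and the resulting bounds on [phi] *)

Section GrowthOnDiscs.
Variable R : realType.
Local Notation C := (Cplx R).
Implicit Types (f g phi : C -> C) (z a h c : C).

Definition grid_value (c : nat -> C) n m : C := \sum_(0 <= j < m) c j * cof (weight R n j).

Lemma weight_le1 n j : 0 <= weight R n j <= 1.
Proof.
have h : 0 <= 2 ^+ j / 2 ^+ n :> R by rewrite divr_ge0 ?exprn_ge0.
by rewrite /weight invr_ge0 addr_ge0//= invf_le1 ?lerDl// ltr_wpDr.
Qed.

Lemma weight_ge_half n j : (j <= n)%N -> 2^-1 <= weight R n j :> R.
Proof.
move=> jn; have p2 k : 0 < 2 ^+ k :> R by rewrite exprn_gt0.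
rewrite /weight lef_pV2 ?posrE//.
have : 2 ^+ j / 2 ^+ n <= 1 :> R by rewrite ler_pdivrMr// mul1r ler_weXn2l ?ler1n.
by lra.
Qed.

(** A linear equation for one constant coefficient [a] on the indices from [m] to [n]. The earlier
    indices contribute at most [8 A m < A n], so [a] has to supply at most [2 A n]; the weights of
    the block sum to at least [(n - m) / 2 >= 7 n / 16], hence [|a| <= 8 A]. Thus the bound on
    coefficients does not deteriorate from block to block. *)
Lemma block_coefficient (c : nat -> C) (A : R) m n w : 0 < A -> (8 * m < n)%N ->
  (forall j, cabs (c j) <= 8 * A) -> cabs w <= A * n%:R ->
  exists2 a : C, cabs a <= 8 * A & forall k, (n <= k)%N ->
    grid_value (fun j => if (j < m)%N then c j else if (j < n)%N then a else 0) n k = w.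
Proof.
move=> A0 mn cA wA; have mn' : (m <= n)%N by rewrite ltnW// (leq_ltn_trans _ mn)// leq_pmull.
pose S : R := \sum_(m <= j < n) weight R n j.
have Slo : (n%:R - m%:R) / 2 <= S.
  apply: (@le_trans _ _ (\sum_(m <= j < n) 2^-1)).
    by rewrite sumr_const_nat -[leRHS]mulr_natl natrB.
  by rewrite big_nat [leRHS]big_nat; apply: ler_sum => j /andP[_ /ltnW]; exact: weight_ge_half.
have mnR : 8 * m%:R < n%:R :> R by rewrite -natrM ltr_nat.
have m0 : 0 <= m%:R :> R by [].
have S0 : 0 < S by apply: lt_le_trans Slo; rewrite divr_gt0//; move: mnR m0; clear; lra.
have Sn0 : cof S != 0 by rewrite -cof0 (inj_eq (@complexI R)) gt_eqF.
exists ((w - grid_value c n m) / cof S).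
  rewrite cabsM cabsV cabs_cof gtr0_norm// ler_pdivrMr//.
  have cm : cabs (grid_value c n m) <= 8 * A * m%:R.
    apply: le_trans (cabs_sum_le _ _) _.
    apply: (@le_trans _ _ (\sum_(0 <= j < m) 8 * A)).
      apply: ler_sum => j _; have /andP[b0 b1] := weight_le1 n j.
      rewrite cabsM cabs_cof ger0_norm//; apply: le_trans (cA j).
      by rewrite ler_piMr ?cabs_ge0.
    by rewrite sumr_const_nat subn0 mulr_natr.
  apply: le_trans (cabsB _ _) _.
  have A8 : 0 <= 8 * A by rewrite mulr_ge0// ltW.
  apply: le_trans (ler_wpM2l A8 Slo).
  by move: wA cm mnR m0 A0; clear; nra.
move=> k nk; rewrite /grid_value (big_cat_nat (n := n))//= (big_cat_nat (n := m))//=.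
rewrite [X in _ + X]big_nat [X in _ + X]big1 => [|j /andP[nj jk]]; last first.
  by rewrite !ltnNge nj (leq_trans mn' nj)/= mul0r.
rewrite addr0 (eq_big_nat _ _ (F2 := fun j => c j * cof (weight R n j))); last by move=> j /andP[_ ->].
rewrite -/(grid_value c n m) [X in _ + X](eq_big_nat _ _
   (F2 := fun j => (w - grid_value c n m) / cof S * cof (weight R n j))); last first.
  by move=> j /andP[mj jn]; rewrite ltnNge mj /= jn.
rewrite -mulr_sumr.
have -> : \sum_(m <= j < n) cof (weight R n j) = cof S.
  by rewrite /S; elim/big_rec2: _ => [|j x y _ ->]; rewrite ?cof0// cofD.
by rewrite divfK// addrC subrK.
Qed.

(* [(c, m)] stands for coefficients already chosen for indices below [m]. *)
Definition extends (phi : C -> C) (V : nat -> R) (L : R) (k : nat) (x y : (nat -> C) * nat) :=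
  [/\ forall j, (j < x.2)%N -> y.1 j = x.1 j, (x.2 < y.2)%N, forall j, cabs (y.1 j) <= L &
   exists n, forall v, cabs (v - grid_value y.1 n y.2) <= 4 * L * 2 ^+ n / 2 ^+ y.2 ->
     k%:R * V n < cabs (phi v)].

Lemma extension phi (V : nat -> R) (A : R) : (forall z, ccts phi z) -> (forall n, 1 <= V n) -> 0 < A ->
  ~ (exists K, forall w n, cabs w <= A * n%:R -> cabs (phi w) <= K * V n) ->
  forall k x, (forall j, cabs (x.1 j) <= 8 * A) -> exists y, extends phi V (8 * A) k x y.
Proof.
move=> cphi V1 A0 nK k [c m] /= cA.
(* Exceeding the maximum [K0] of [phi] on this disc forces [n > 8 * m + 8], the room needed for a
   new block. *)
have [K0 K0P] := ccts_bounded_disc (fun z (_ : cabs z <= A * (8 * m + 8)%:R) => cphi z).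
have [w [n [wA wK]]] : exists w n, cabs w <= A * n%:R /\ Num.max k%:R K0 * V n < cabs (phi w).
  apply: contrapT => H; apply: nK; exists (Num.max k%:R K0) => w n wA.
  by rewrite leNgt; apply/negP => h; apply: H; exists w, n.
have V0 : 0 < V n by apply: lt_le_trans (V1 n).
have mn : (8 * m + 8 < n)%N.
  rewrite ltnNge; apply/negP => nm; have : cabs (phi w) <= K0.
    by apply: K0P; apply: le_trans wA _; rewrite ler_pM2l// ler_nat.
  apply/negP; rewrite -ltNge; apply: le_lt_trans wK.
  have M0 : 0 <= Num.max k%:R K0 by rewrite le_max ler0n.
  have := ler_wpM2l M0 (V1 n); rewrite mulr1; apply: le_trans.
  by rewrite le_max lexx orbT.
have [a aA aP] := block_coefficient A0 (leq_ltn_trans (leq_addr 8 (8 * m)) mn) cA wA.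
have kV : k%:R * V n < cabs (phi w).
  by apply: le_lt_trans wK; rewrite ler_pM2r// le_max lexx.
have e0 : 0 < (cabs (phi w) - k%:R * V n) / 2 by rewrite divr_gt0// subr_gt0.
have [d d0 dP] := cphi w _ e0.
have q0 : 0 < 4 * (8 * A) * 2 ^+ n by rewrite !mulr_gt0// exprn_gt0.
pose t := (Num.truncn (4 * (8 * A) * 2 ^+ n / d)).+1.
(* Zero coefficients up to [m'] make every later choice move the value at the n-th grid point by
   less than [d], the radius on which [phi] stays large. *)
pose m' := (maxn n t).
exists (fun j => if (j < m)%N then c j else if (j < n)%N then a else 0, m'); split => /=.
- by move=> j ->.
- by rewrite /m' leq_max (leq_ltn_trans _ mn)// (leq_trans (leq_pmull m _) (leq_addr _ _)).
- by move=> j; case: ifP => // _; case: ifP => // _; rewrite cabs0 mulr_ge0// ltW.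
exists n => v; rewrite (aP m') ?leq_maxl// => vw.
have tm : 4 * (8 * A) * 2 ^+ n / 2 ^+ m' < d.
  rewrite ltr_pdivrMr ?exprn_gt0// [ltRHS]mulrC -ltr_pdivrMr//.
  apply: lt_trans (truncnS_gt _) _; rewrite -[ltRHS]natrX ltr_nat.
  by apply: leq_ltn_trans (leq_maxr n t) _; rewrite ltn_expl.
have := dP (v - w) (le_lt_trans vw tm); rewrite [w + _]addrC subrK => h.
have := cabs_sub (phi w) (phi w - phi v); rewrite subKr.
have -> : cabs (phi w - phi v) = cabs (phi v - phi w) by rewrite cabsBC.
by move: h kV; clear; lra.
Qed.

(** Gliding hump: if the bound failed, successive extensions would produce one [f] in [Q_s] for
    which, at every stage [k], the value of [phi o f] exceeds [k * V n] at some grid point. *)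
Lemma growth_on_discs phi (s : R) (V : nat -> R) : 0 < s -> s < 1 ->
  (forall z, ccts phi z) -> (forall n, 1 <= V n) ->
  (forall f, Qspace s f -> exists K, forall n, cabs (phi (f (grid R n))) <= K * V n) ->
  forall A : R, 0 < A -> exists K, forall w n, cabs w <= A * n%:R -> cabs (phi w) <= K * V n.
Proof.
move=> s0 s1 cphi V1 HQ A A0; apply: contrapT => nK; pose L := 8 * A.
have L0 : 0 <= L by rewrite mulr_ge0// ltW.
have /choice[nxt nxtP] : forall kx : nat * ((nat -> C) * nat), exists y,
    (forall j, cabs (kx.2.1 j) <= L) -> extends phi V L kx.1 kx.2 y.
  move=> [k x]; have [h|h] := pselect (forall j, cabs (x.1 j) <= L); last by exists x.
  by have [y yP] := extension cphi V1 A0 nK k h; exists y.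
pose st := fix st k := if k is k'.+1 then nxt (k', st k') else (fun=> 0 : C, 0%N).
have stL k : forall j, cabs ((st k).1 j) <= L.
  elim: k => [|k ih] j; first by rewrite cabs0.
  by have [] := nxtP (k, st k) ih.
have stP k : extends phi V L k (st k) (st k.+1) by exact: (nxtP (k, st k) (stL k)).
have st_mono k i : ((st k).2 <= (st (k + i)%N).2)%N.
  elim: i => [|i ih]; first by rewrite addn0.
  by rewrite addnS; have [_ h _ _] := stP (k + i)%N; exact: leq_trans ih (ltnW h).
have st_ge k : (k <= (st k).2)%N.
  by elim: k => // k ih; have [_ h _ _] := stP k; exact: leq_ltn_trans ih h.
have agree k i j : (j < (st k).2)%N -> (st (k + i)%N).1 j = (st k).1 j.
  move=> jk; elim: i => [|i ih]; first by rewrite addn0.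
  by rewrite addnS -ih; have [-> //] := stP (k + i)%N; exact: leq_trans jk (st_mono _ _).
(* Stage [j + 1] has already fixed at least [j + 1] coefficients, so the j-th one is final there. *)
pose c j := (st j.+1).1 j.
have cP k j : (j < (st k).2)%N -> c j = (st k).1 j.
  move=> jk; have [h|h] := leqP k j.+1.
    by have := agree k (j.+1 - k)%N j jk; rewrite subnKC.
  by have := agree j.+1 (k - j.+1)%N j (st_ge j.+1); rewrite subnKC// ltnW.
have [f hf [f1 f2]] := test_function (fun j => stL j.+1 j : cabs (c j) <= L).
have [K KP] := HQ f (Qspace_of_log s0 s1 hf (mulr_ge0 (ler0n R 4) L0) f1).
pose k := (Num.truncn K).+1; have [_ _ _ [n nP]] := stP k.
have := nP (f (grid R n)).
have -> : grid_value (st k.+1).1 n (st k.+1).2 = \sum_(0 <= j < (st k.+1).2) c j * cof (weight R n j).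
  by apply: eq_big_nat => j /andP[_ jk]; rewrite (cP k.+1 j jk).
move=> /(_ (f2 n _)) h; have := lt_le_trans h (KP n).
rewrite ltr_pM2r; last by apply: lt_le_trans (V1 n).
by apply/negP; rewrite -leNgt ltW// truncnS_gt.
Qed.

End GrowthOnDiscs.

(** * Necessity of the growth condition and of constancy *)

Section Necessity.
Variable R : realType.
Local Notation C := (Cplx R).
Implicit Types (f g phi : C -> C) (z a h c : C).

(** The rate [b = q * ln 2] is chosen before [F], which lets [type_zero_necessary] fit the constant
    [A] to it. *)
Lemma Dirichlet_grid_growth (p : R) : 0 < p -> exists2 b, 0 <= b & forall F,
  Dirichlet p (p - 1) F -> exists K, forall n, cabs (F (grid R n)) <= K * expR (b * n%:R).
Proof.
move=> p0; pose q := if 1 <= p then p + 1 else 2 / p.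
have q0 : 0 <= q.
  by rewrite /q; case: ifP => _; [rewrite addr_ge0// ltW|rewrite divr_ge0// ltW].
have ln2 : 0 <= ln 2 :> R by rewrite ln_ge0// ler1n.
have b0 : 0 <= q * ln 2 by rewrite mulr_ge0.
exists (q * ln 2) => // F DF; have [c c0 cP] := Dirichlet_deriv_growth p0 DF.
exists (cabs (F 0) + c) => n; have [gd gE] := grid_disc R n.
have [Fh _] := DF; apply: le_trans (power_growth Fh c0 q0 cP gd) _.
have -> : (1 - cabs (grid R n)) `^ (- q) = expR (q * ln 2 * n%:R).
  have p2 : 0 < 2 ^+ n :> R by rewrite exprn_gt0.
  rewrite gE -powR_inv1 ?(ltW p2)// -powRrM mulrNN mul1r /powR gt_eqF//.
  by rewrite lnXn// -[ln 2 *+ n]mulr_natr mulrA.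
rewrite mulrDl; apply: lerD => //.
by rewrite ler_peMr ?cabs_ge0// -[leLHS]expR0 ler_expR (mulr_ge0 b0).
Qed.

Lemma type_zero_necessary phi (s p : R) : 0 < s -> s < 1 -> 0 < p -> entire phi ->
  superposition phi @` Qspace s `<=` Dirichlet p (p - 1) -> type_zero phi.
Proof.
move=> s0 s1 p0 phe H e e0; have [b b0 bP] := Dirichlet_grid_growth p0.
(* With [n] about [|w| / A], the bound [exp (b n)] becomes at most [exp (b + e |w|)], because
   [b / A <= e]. *)
pose A := b / e + 1.
have A0 : 0 < A by rewrite ltr_wpDl// divr_ge0// ltW.
have V1 n : 1 <= expR (b * n%:R) by rewrite -expR0 ler_expR mulr_ge0.
have HQ f : Qspace s f -> exists K, forall n, cabs (phi (f (grid R n))) <= K * expR (b * n%:R).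
  by move=> Qf; apply: (bP (superposition phi f)); apply: H; exists f.
have [K KP] := growth_on_discs s0 s1 (fun z => derivable_ccts (phe z)) V1 HQ A0.
have K0 : 0 <= K.
  have := KP 0 0%N; rewrite cabs0 mulr0 mulr0 expR0 mulr1 => /(_ (lexx _)).
  exact: le_trans (cabs_ge0 _).
exists (K * expR b) => w; pose n := (Num.truncn (cabs w / A)).+1.
have wA0 : 0 <= cabs w / A by rewrite divr_ge0 ?cabs_ge0// ltW.
apply: le_trans (KP w n _) _.
  by rewrite mulrC -ler_pdivrMr// ltW// truncnS_gt.
rewrite -mulrA -expRD; apply: ler_wpM2l => //; rewrite ler_expR /n -natr1 mulrDr mulr1 addrC lerD2l.
have h : (Num.truncn (cabs w / A))%:R <= cabs w / A by rewrite truncn_le.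
apply: le_trans (ler_wpM2l b0 h) _; rewrite mulrCA mulrC; apply: ler_wpM2r; first exact: cabs_ge0.
by rewrite ler_pdivrMr// /A mulrDr mulr1 mulrC divfK ?gt_eqF// lerDl ltW.
Qed.

Definition csqr z : C := z ^+ 2.

Lemma entire_csqr : entire csqr.
Proof.
move=> z; apply: (@cderiv_derivable _ _ _ (2 * z)) => e e0; exists e => // h he.
have -> : csqr (z + h) - csqr z - 2 * z * h = h * h by rewrite /csqr; ring.
by rewrite cabsM; apply: ler_wpM2r; [exact: cabs_ge0|exact: ltW].
Qed.

Lemma type_zero_csqr : type_zero csqr.
Proof.
move=> e e0; exists ((2 / e) ^+ 2) => z; rewrite /csqr cabsX.
have -> : e * cabs z = 2 * (e * cabs z / 2) by field.
have h : cabs z <= 2 / e * expR (e * cabs z / 2).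
  have h := expR_ge1Dx (e * cabs z / 2); rewrite mulrAC ler_pdivlMr// [cabs z * e]mulrC.
  by move: h; clear; lra.
rewrite expRM_natl -exprMn; apply: lerXn2r h; rewrite nnegrE ?cabs_ge0//.
by rewrite mulr_ge0 ?expR_ge0// divr_ge0// ltW.
Qed.

(** Every complex number is a square, so [phi] grows at most like a square root, and Cauchy's
    estimate on large squares gives [phi' = 0]. *)
Lemma sqrt_growth_constant phi (K : R) : entire phi ->
  (forall w, cabs (phi (w ^+ 2)) <= K * (cabs w + 2)) -> is_constant phi.
Proof.
move=> phe H; exists (phi 0) => z.
have K0 : 0 <= K.
  have := le_trans (cabs_ge0 _) (H 0); rewrite cabs0 add0r.
  by rewrite pmulr_lge0.
have d0 a : cabs (derive1 phi a) = 0.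
  apply/eqP; rewrite eq_le cabs_ge0 andbT; apply/ler_addgt0Pl => e e0; rewrite addr0.
  have a0 := cabs_ge0 a.
  (* On the square of half-side [T^2] around [a], [|w| <= 4 * T^2] and [|phi w| <= 4 * K * T], so
     Cauchy's estimate is [16 * K / T <= e]. *)
  pose T := 1 + cabs a + 16 * K / e.
  have Ke : 0 <= 16 * K / e by rewrite divr_ge0 ?mulr_ge0// ltW.
  have Ta : 1 + cabs a <= T by rewrite /T lerDl.
  have T1 : 1 <= T by apply: le_trans Ta; rewrite lerDl.
  have T0 : 0 < T by apply: lt_le_trans T1.
  have := @cauchy_estimate _ phi a (T ^+ 2) (4 * K * T) (exprn_gt0 2 T0) (fun z _ => phe z).
  have eT : 16 * K <= e * T.
    by rewrite [leRHS]mulrC -ler_pdivrMr// /T lerDr addr_ge0.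
  move=> h; apply: le_trans (h _) _.
    move=> w /square_cabs wa; have wT : cabs w <= 4 * T ^+ 2.
      by have := cabs_sub w a; move: wa Ta T1; clear; nra.
    have E : w = sqrtc w ^+ 2 by rewrite sqr_sqrtc.
    have sT : cabs (sqrtc w) <= 2 * T.
      rewrite -(@ler_pXn2r _ 2)// ?nnegrE ?cabs_ge0 ?mulr_ge0 ?(ltW T0)//.
      by rewrite -cabsX -E exprMn; move: wT; clear; lra.
    rewrite E; apply: le_trans (H _) _.
    have := ler_wpM2l K0 sT; have := ler_wpM2l K0 T1; clear; lra.
  rewrite ler_pdivrMr ?exprn_gt0//.
  by have := ler_wpM2r (ltW T0) eT; clear; lra.
have := @lipschitz_square _ phi 0 (cabs z) 0 0 z (fun z _ => phe z).
move=> h; have : cabs (phi z - phi 0) <= 0.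
  rewrite -(mul0r (cabs (z - 0))); apply: h => [w _||].
  - by rewrite d0.
  - by apply: square_center; exact: cabs_ge0.
  - by apply: cabs_square; rewrite subr0.
move=> h0; apply/eqP; rewrite -subr_eq0; apply/eqP; apply: cabs_eq0.
by apply/eqP; rewrite eq_le h0 cabs_ge0.
Qed.

Lemma constant_necessary phi (s p : R) : 0 < s -> s < 1 -> 0 < p -> entire phi ->
  superposition phi @` Dirichlet p (p - 1) `<=` Qspace s -> is_constant phi.
Proof.
move=> s0 s1 p0 phe H; pose psi := phi \o csqr.
have psie : entire psi.
  by move=> z; have [] := derivable_superposition (@entire_csqr z) (phe (csqr z)).
have HQ f : Qspace s f -> exists K, forall n, cabs (psi (f (grid R n))) <= K * n.+1%:R.
  move=> Qf; have QF : Qspace s (psi \o f).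
    apply: H; exists (superposition csqr f) => //.
    exact: superposition_Dirichlet s0 s1 p0 entire_csqr type_zero_csqr Qf.
  have [B B0 BP] := Qspace_bloch s0 QF; have [Fh _] := QF.
  exists (cabs (psi (f 0)) + B) => n; have [gd gE] := grid_disc R n.
  apply: le_trans (bloch_growth Fh B0 BP gd) _.
  rewrite gE lnV ?posrE ?exprn_gt0// mulrN opprK lnXn// mulrDl; apply: lerD.
    by rewrite ler_peMr ?cabs_ge0// ler1n.
  apply: ler_wpM2l => //; rewrite -[leLHS]mulr_natr.
  have l2 : ln 2 <= 1 :> R by rewrite -ler_expR lnK ?posrE//; exact: expR_ge1Dx.
  apply: (@le_trans _ _ (1 * n%:R)); first by apply: ler_wpM2r.
  by rewrite mul1r ler_nat.
have [K KP] := growth_on_discs s0 s1 (fun z => derivable_ccts (psie z))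
  (fun n => (ler1n _ _ : 1 <= n.+1%:R :> R)) HQ ltr01.
apply: (@sqrt_growth_constant _ K phe) => w.
pose n := (Num.truncn (cabs w)).+1.
have K0 : 0 <= K.
  have := KP 0 0%N; rewrite cabs0 mulr0 mulr1 => /(_ (lexx _)).
  exact: le_trans (cabs_ge0 _).
apply: le_trans (KP w n _) _; first by rewrite mul1r ltW// truncnS_gt.
apply: ler_wpM2l => //; rewrite /n -addn2 natrD lerD2r truncn_le//.
exact: cabs_ge0.
Qed.

Lemma Qspace_of_constant phi f (s : R) : is_constant phi -> Qspace s (superposition phi f).
Proof.
move=> [c cP]; have -> : superposition phi f = cst c by apply/funext => z; exact: cP.
split=> [z _|]; first exact: derivable_cst.
apply: (@le_lt_trans _ _ 0%E); last exact: ltry.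
apply: ge_ereal_sup => _ [a _ <-]; rewrite /int_disc integral0_eq// => w _.
by rewrite derive1_cst cabs0 expr0n mul0r.
Qed.

End Necessity.

(** * Order and type *)

Section OrderType.
Variable R : realType.
Local Notation C := (Cplx R).
Implicit Types (f g phi : C -> C) (z a h c : C).

Lemma limf_esup_pinfty_lt (u : R -> R) (a : \bar R) :
  (limf_esup (fun r => (u r)%:E) (pinfty_nbhs R) < a)%E ->
  exists2 l : \bar R, (l < a)%E & exists N : R, forall r, N < r -> ((u r)%:E <= l)%E.
Proof.
move=> /ereal_inf_lt[_ [A [N [_ AN]] <-] la]; exists (ereal_sup [set (u r)%:E | r in A]) => //.
by exists N => r Nr; apply: ereal_sup_ubound; exists r => //; exact: AN.
Qed.

Lemma limf_esup_pinfty_le (u : R -> R) (a : \bar R) (N : R) :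
  (forall r, N < r -> ((u r)%:E <= a)%E) ->
  (limf_esup (fun r => (u r)%:E) (pinfty_nbhs R) <= a)%E.
Proof.
move=> H; apply: (@le_trans _ _ (ereal_sup [set (u r)%:E | r in [set r | N < r]])).
  apply: ereal_inf_lbound; exists [set r | N < r] => //.
  by exists N; split => //; exact: num_real.
by apply: ge_ereal_sup => _ [r Nr <-]; exact: H.
Qed.

Lemma maxmod_ub phi z : (forall z, ccts phi z) -> cabs (phi z) <= maxmod phi (cabs z).
Proof.
move=> cphi; have [K KP] := ccts_bounded_disc (fun w (_ : cabs w <= cabs z) => cphi w).
apply: ub_le_sup; last by exists z.
by exists K => _ [w /= wz <-]; apply: KP; rewrite wz.
Qed.

Lemma maxmod_le phi (r K : R) : 0 <= r -> (forall z, cabs z = r -> cabs (phi z) <= K) ->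
  maxmod phi r <= K.
Proof.
move=> r0 H; apply: ge_sup => [|_ [z zr <-]]; last exact: H.
by exists (cabs (phi (cof r))); exists (cof r) => //; change (cabs (cof r : C) = r); rewrite cabs_cof ger0_norm.
Qed.

(** For [x <= 0] it rests on the convention [ln x = 0]; this covers iterated logarithms of small
    moduli. *)
Lemma le_expR_ln (x : R) : x <= expR (ln x).
Proof.
have [x0|x0] := ltP 0 x; first by rewrite lnK.
by rewrite (le_trans x0)// expR_ge0.
Qed.

Lemma ln_le_of_expR (x y : R) : 0 <= y -> x <= expR y -> ln x <= y.
Proof.
move=> y0 xy; have [x0|x0] := ltP 0 x; last by rewrite ln0.
by rewrite -(expRK y) ler_ln// posrE expR_gt0.
Qed.

Lemma type_zero_maxmod phi : (forall z, ccts phi z) -> type_zero phi <->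
  forall e : R, 0 < e -> exists N, forall r, N < r -> ln (maxmod phi r) <= e * r.
Proof.
move=> cphi; split=> H e e0.
  have e20 : 0 < e / 2 by rewrite divr_gt0.
  (* Half of the exponent absorbs the constant: beyond this threshold
     [K <= 1 + (e / 2) r <= exp ((e / 2) r)]. *)
  have [K KP] := H _ e20; exists (`|K| / (e / 2)) => r Kr.
  have r0 : 0 < r by apply: le_lt_trans Kr; rewrite divr_ge0// ltW.
  apply: ln_le_of_expR; first by rewrite mulr_ge0// ltW.
  apply: maxmod_le => [|z zr]; first exact: ltW.
  apply: le_trans (KP z) _; rewrite zr.
  have -> : e * r = e / 2 * r + e / 2 * r by field.
  rewrite expRD; apply: ler_wpM2r; first exact: expR_ge0.
  apply: le_trans (ler_norm K) _; apply: le_trans (expR_ge1Dx _).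
  by move: Kr; rewrite ltr_pdivrMr// [r * _]mulrC; clear; lra.
have [N NP] := H e e0; have [K KP] := ccts_bounded_disc (fun w (_ : cabs w <= N) => cphi w).
exists (Num.max 1 K) => z.
have E1 : 1 <= expR (e * cabs z) by rewrite -[leLHS]expR0 ler_expR mulr_ge0 ?cabs_ge0// ltW.
have [zN|zN] := leP (cabs z) N.
  apply: le_trans (KP z zN) _; apply: (@le_trans _ _ (Num.max 1 K)); first by rewrite le_max lexx orbT.
  by rewrite ler_peMr// le_max ler01.
apply: le_trans (maxmod_ub z cphi) _; apply: le_trans (le_expR_ln _) _.
apply: (@le_trans _ _ (expR (e * cabs z))); first by rewrite ler_expR NP.
by rewrite ler_peMl ?expR_ge0// le_max lexx.
Qed.

Lemma type_zero_of_order phi : entire phi ->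
  (growth_order phi < 1)%E \/ growth_order phi = 1%E /\ growth_type phi = 0%E -> type_zero phi.
Proof.
move=> phe; have cphi z := derivable_ccts (phe z).
have [[c cP] _ e e0|nc] := pselect (is_constant phi).
  exists (cabs c) => z; rewrite cP ler_peMr ?cabs_ge0//.
  by rewrite -[leLHS]expR0 ler_expR mulr_ge0 ?cabs_ge0// ltW.
move=> H; apply/(type_zero_maxmod cphi) => e e0; case: H => [|H].
  rewrite /growth_order asboolF// => /limf_esup_pinfty_lt[l l1 [N NP]].
  (* [l] is only known to be an extended real below [1]; [rho] is a real number above it with
     [0 <= rho < 1]. *)
  pose rho := Num.max (fine l) 0.
  have lrho : (l <= rho%:E)%E.
    by case: l l1 @rho {NP} => [x _ rho| |_ rho]; [rewrite lee_fin le_max lexx| |rewrite leNye].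
  have rho1 : 0 < 1 - rho.
    by rewrite subr_gt0 gt_max ltr01 andbT; case: l l1 {NP rho lrho} => [x| |] //=.
  (* The last threshold is where [rho * ln r <= ln e + ln r] begins to hold. *)
  exists (Num.max (Num.max N 1) (expR (- ln e / (1 - rho)))) => r.
  rewrite !gt_max => /andP[/andP[Nr r1] re].
  have r0 : 0 < r by apply: lt_trans r1.
  have lr0 : 0 < ln r by rewrite ln_gt0.
  have h1 : ln (ln (maxmod phi r)) <= rho * ln r.
    by rewrite -ler_pdivrMr// -lee_fin; apply: le_trans lrho; exact: NP.
  apply: le_trans (le_expR_ln _) _.
  rewrite -[e]lnK// -[X in _ * X]lnK// -expRD ler_expR.
  have : - ln e / (1 - rho) <= ln r by rewrite -(expRK (_ / _)) ler_ln ?posrE ?expR_gt0// ltW.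
  by rewrite ler_pdivrMr//; move: h1; clear; lra.
case: H => H1; rewrite /growth_type H1 => t0.
have : (limf_esup (fun r => (ln (maxmod phi r) / r `^ fine (1 : \bar R))%:E) (pinfty_nbhs R) < e%:E)%E.
  by rewrite t0 lte_fin.
move=> /limf_esup_pinfty_lt[l le_ [N NP]].
exists (Num.max N 0) => r; rewrite gt_max => /andP[Nr r0].
have := le_trans (NP r Nr) (ltW le_).
by rewrite [fine _]/= powRr1 ?(ltW r0)// lee_fin ler_pdivrMr.
Qed.

Lemma order_of_type_zero phi : entire phi -> type_zero phi ->
  (growth_order phi < 1)%E \/ growth_order phi = 1%E /\ growth_type phi = 0%E.
Proof.
move=> phe; have cphi z := derivable_ccts (phe z).
have [c|nc] := pselect (is_constant phi).
  by left; rewrite /growth_order asboolT// lte_fin.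
move=> /(type_zero_maxmod cphi) H.
have oE : growth_order phi = limf_esup (fun r => (ln (ln (maxmod phi r)) / ln r)%:E) (pinfty_nbhs R).
  by rewrite /growth_order asboolF.
have o1 : (growth_order phi <= 1)%E.
  have [N NP] := H 1 ltr01; rewrite oE.
  apply: (@limf_esup_pinfty_le _ _ (Num.max N 1)) => r; rewrite gt_max => /andP[Nr r1].
  have lr0 : 0 < ln r by rewrite ln_gt0.
  rewrite lee_fin ler_pdivrMr// mul1r; apply: ln_le_of_expR; first exact: ltW.
  by rewrite lnK ?posrE ?(lt_trans _ r1)//; have := NP r Nr; rewrite mul1r.
have [|o1'] := ltP (growth_order phi) 1%E; [by left|right].
have oe : growth_order phi = 1%E by apply/eqP; rewrite eq_le o1.
split => //; apply/eqP; rewrite eq_le; apply/andP; split.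
  apply/lee_addgt0Pr => e e0; rewrite add0e; have [N NP] := H e e0.
  rewrite /growth_type oe; apply: (@limf_esup_pinfty_le _ _ (Num.max N 0)) => r.
  by rewrite gt_max => /andP[Nr r0]; rewrite [fine _]/= powRr1 ?(ltW r0)// lee_fin ler_pdivrMr// NP.
(* A negative type would make [ln (maxmod phi r)] negative for large [r]; then its logarithm is [0]
   by convention and the order would be at most [0], not [1]. *)
rewrite leNgt; apply/negP; rewrite /growth_type oe => /limf_esup_pinfty_lt[l l0 [N NP]].
suff : (growth_order phi <= 0)%E by rewrite oe lee_fin ler10.
rewrite oE; apply: (@limf_esup_pinfty_le _ _ (Num.max N 0)) => r.
rewrite gt_max => /andP[Nr r0].
have := le_lt_trans (NP r Nr) l0; rewrite [fine _]/= powRr1 ?(ltW r0)// lte_fin => h.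
rewrite [ln (ln _)]ln0 ?mul0r//.
by move: h; rewrite ltr_pdivrMr// mul0r => /ltW.
Qed.

End OrderType.

Theorem theorem2 (R : realType) (phi : Cplx R -> Cplx R) (s p : R)
    (phi_entire : entire phi) (s_gt0 : 0 < s) (s_lt1 : s < 1) (p_gt0 : 0 < p) :
  (superposition phi @` Qspace s `<=` Dirichlet p (p - 1) <->
     ((growth_order phi < 1)%E \/ growth_order phi = 1%E /\ growth_type phi = 0%E)) /\
  (superposition phi @` Dirichlet p (p - 1) `<=` Qspace s <->
     is_constant phi).
Proof.
split; split.
- by move=> /(type_zero_necessary s_gt0 s_lt1 p_gt0 phi_entire); exact: order_of_type_zero.
- move=> /(type_zero_of_order phi_entire) G _ [f Qf <-].
  exact: superposition_Dirichlet G Qf.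
- exact: constant_necessary.
- by move=> c _ [f _ <-]; exact: Qspace_of_constant.
Qed.
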